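(* Let $\alpha_0,\alpha_1,\beta>0$ and let $\mathcal E:=\mathbb K^{n\times p}\times\mathbb K^{p\times p}$ be an embedded ambient space of $\mathcal M=\mathrm{St}_{\mathbb K,p,n}\times\mathrm S^+_{\mathbb K,p}\subset\mathcal E$. Identify the manifold $\mathrm S^+_{\mathbb K,p,n}$ of positive-semidefinite matrices of size $n$ and rank $p$ with $\mathcal B=(\mathrm{St}_{\mathbb K,p,n}\times\mathrm S^+_{\mathbb K,p})/\mathrm U_{\mathbb K,p}$, where the pair $S=(Y,P)$ represents $YPY^{\mathfrak t}$ and $U\in\mathrm U_{\mathbb K,p}$ sends $(Y,P)$ to $(YU,U^{\mathfrak t}PU)$. The self-adjoint metric operator $$\mathsf g(S)(\omega_Y,\omega_P)=(\alpha_0\omega_Y+(\alpha_1-\alpha_0)YY^{\mathfrak t}\omega_Y,\ \beta P^{-1}\omega_PP^{-1}),\qquad(\omega_Y,\omega_P)\in\mathcal E,$$ defines the inner product $\mathrm{Tr}_{\mathbb R}(\alpha_0\omega_Y^{\mathfrak t}\omega_Y+(\alpha_1-\alpha_0)\omega_Y^{\mathfrak t}YY^{\mathfrak t}\omega_Y+\beta\omega_P^{\mathfrak t}P^{-1}\omega_PP^{-1})$ on $\mathcal E$, which induces a metric on $\mathrm{St}_{\mathbb K,p,n}\times\mathrm S^+_{\mathbb K,p}$ invariant under the action of $\mathrm U_{\mathbb K,p}$, and induces a quotient metric on $\mathrm S^+_{\mathbb K,p,n}$. The tangent bundle $T\mathrm S^+_{\mathbb K,p,n}$ lifts to the subbundle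 $\mathcal H\subset T(\mathrm{St}_{\mathbb K,p,n}\times\mathrm S^+_{\mathbb K,p})$ horizontal to the group action, where a tangent vector $\eta=(\eta_Y,\eta_P)$ at $S=(Y,P)$ is horizontal if and only if $$\alpha_1Y^{\mathfrak t}\eta_Y+\beta\eta_PP^{-1}-\beta P^{-1}\eta_P=0.$$ $\mathcal H_S$ is the range of the one-to-one operator $\mathrm N(S)$ from $\mathcal E_{\mathrm N}=\mathbb K^{(n-p)\times p}\times\mathrm{Sym}_{\mathfrak t,\mathbb K,p}$ to $\mathcal E$ given by $$\mathrm N(S)(B,D)=(\beta Y(P^{-1}D-DP^{-1})+Y_\perp B,\ \alpha_1D),$$ where $Y_\perp$ is an orthogonal complement matrix to $Y$, $(Y|Y_\perp)\in\mathrm U_{\mathbb K,n}$. The projection of $\omega=(\omega_Y,\omega_P)\in\mathcal E$ to the horizontal space $\mathcal H_{(Y,P)}$ is $$\Pi_{\mathcal H}(S)(\omega_Y,\omega_P)=(\beta Y(P^{-1}\mathcal D-\mathcal DP^{-1})+\omega_Y-YY^{\mathfrak t}\omega_Y,\ \alpha_1\mathcal D),$$ $$\text{with }\mathcal D=\mathcal D(P)\omega:=L(P)^{-1}\mathrm{sym}_{\mathfrak t}(\omega_P+Y^{\mathfrak t}\omega_YP-PY^{\mathfrak t}\omega_Y),\qquad L(P)X:=(\alpha_1-2\beta)X+\beta(PXP^{-1}+P^{-1}XP).$$ The operator $L(P)$ is invertible: if $P=U\Lambda U^{\mathfrak t}$ is an eigenvalue decomposition with $U\in\mathrm U_{\mathbb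 K,p}$ and eigenvalues $\Lambda_1,\dots,\Lambda_p$, then $L(P)^{-1}B=U\{(U^{\mathfrak t}BU)/M\}U^{\mathfrak t}$, where $/$ is entrywise division and $M_{ij}=\alpha_1+\beta(\Lambda_i^{-1}\Lambda_j+\Lambda_i\Lambda_j^{-1}-2)$. The lift of the Levi-Civita connection is given, for horizontal lifts $\xi=(\xi_Y,\xi_P)$, $\eta=(\eta_Y,\eta_P)$ of tangent vector fields of $\mathrm S^+_{\mathbb K,p,n}$, by $$\nabla^{\mathcal H}_\xi\eta:=\Pi_{\mathcal H}\nabla_\xi\eta=\mathrm D_\xi\eta-(\mathrm D_\xi\Pi_{\mathcal H})\eta+\Pi_{\mathcal H}\mathsf g^{-1}\mathrm K(\xi,\eta),$$ and, for a function $f$ on $\mathrm S^+_{\mathbb K,p,n}$ with ambient gradient $\hat f_S$ and ambient Hessian $\hat f_{SS}$ (of its lift to $\mathcal M$), the Riemannian Hessian (lifted) is $$\mathsf{rhess}^{11}_{\mathcal H,f}\xi=\Pi_{\mathcal H}\mathsf g^{-1}\big(\hat f_{SS}\xi+\mathsf g(\mathrm D_\xi\Pi_{\mathcal H})\mathsf g^{-1}\hat f_S-(\mathrm D_\xi\mathsf g)\mathsf g^{-1}\hat f_S+\mathrm K(\xi,\Pi_{\mathcal H}\mathsf g^{-1}\hat f_S)\big),$$ where $$\mathrm K(\xi,\eta)_Y=\frac{\alpha_1-\alpha_0}2\big(Y(\eta_Y^{\mathfrak t}\xi_Y+\xi_Y^{\mathfrak t}\eta_Y)-2(\eta_Y\xi_Y^{\mathfrak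 t}+\xi_Y\eta_Y^{\mathfrak t})Y\big),$$ $$\mathrm K(\xi,\eta)_P=-\frac\beta2\big(P^{-1}\eta_PP^{-1}\xi_PP^{-1}+P^{-1}\xi_PP^{-1}\eta_PP^{-1}\big).$$ Setting $$\mathring{\mathcal D}=(\mathrm D_\xi\mathcal D)\omega=L(P)^{-1}\Big\{\mathrm{sym}_{\mathfrak t}(\xi_Y^{\mathfrak t}\omega_YP-P\xi_Y^{\mathfrak t}\omega_Y+Y^{\mathfrak t}\omega_Y\xi_P-\xi_PY^{\mathfrak t}\omega_Y)-\beta(\xi_P\mathcal DP^{-1}+P^{-1}\mathcal D\xi_P-P\mathcal DP^{-1}\xi_PP^{-1}-P^{-1}\xi_PP^{-1}\mathcal DP)\Big\},$$ we have $$(\mathrm D_\xi\Pi_{\mathcal H})\omega=\big(((\mathrm D_\xi\Pi_{\mathcal H})\omega)_Y,\ \alpha_1\mathring{\mathcal D}\big),$$ $$((\mathrm D_\xi\Pi_{\mathcal H})\omega)_Y=\beta\xi_Y(P^{-1}\mathcal D-\mathcal DP^{-1})+\beta Y\big(P^{-1}\mathring{\mathcal D}-\mathring{\mathcal D}P^{-1}+\mathcal DP^{-1}\xi_PP^{-1}-P^{-1}\xi_PP^{-1}\mathcal D\big)-(\xi_YY^{\mathfrak t}+Y\xi_Y^{\mathfrak t})\omega_Y.$$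
   Context: $\mathbb K$ is $\mathbb R$ or $\mathbb C$; $\mathfrak t$ is the transpose if $\mathbb K=\mathbb R$ and the Hermitian transpose if $\mathbb K=\mathbb C$. $\mathrm{Tr}_{\mathbb R}$ is the trace, respectively the real part of the trace. Matrix spaces are real inner product spaces with $\langle a,b\rangle=\mathrm{Tr}_{\mathbb R}(ab^{\mathfrak t})$, and $\mathcal E$ carries the direct sum inner product $\langle,\rangle_{\mathcal E}$. $\mathrm{sym}_{\mathfrak t}X=\frac12(X+X^{\mathfrak t})$; $\mathrm{Sym}_{\mathfrak t,\mathbb K,p}=\{X\in\mathbb K^{p\times p}:X^{\mathfrak t}=X\}$; $\mathrm U_{\mathbb K,m}=\{U\in\mathbb K^{m\times m}:U^{\mathfrak t}U=I_m\}$; $\mathrm{St}_{\mathbb K,p,n}=\{Y\in\mathbb K^{n\times p}:Y^{\mathfrak t}Y=I_p\}$; $\mathrm S^+_{\mathbb K,p}$ is the manifold of $\mathfrak t$-symmetric positive-definite matrices in $\mathbb K^{p\times p}$. Tangent vectors of $\mathcal M$ are viewed as elements of $\mathcal E$; $\mathcal M$ has the Riemannian metric $\langle\xi,\mathsf g(S)\eta\rangle_{\mathcal E}$, with Levi-Civita connection $\nabla$. Horizontal tangent vectors are those orthogonal, in this metric, to the orbits of $\mathrm U_{\mathbb K,p}$. $\Pi_{\mathcal H}(S):\mathcal E\to\mathcal H_S$ is the projection orthogonal for $\langle\cdot,\mathsf g(S)\cdot\rangle_{\mathcal E}$. $\mathrm D_\xi$ is the directional derivative along $\xi$ of scalar-,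 $\mathcal E$- or operator-valued functions on $\mathcal M$. In $\mathrm D_\xi\mathcal D$, $\omega$ is held fixed. An ambient gradient $\hat f_S:\mathcal M\to\mathcal E$ of $f$ satisfies $\langle\eta,\hat f_S\rangle_{\mathcal E}=\mathrm D_\eta f$ for all vector fields $\eta$ on $\mathcal M$, and $\hat f_{SS}\xi=\mathrm D_\xi\hat f_S$. The lifted Riemannian Hessian is $\mathsf{rhess}^{11}_{\mathcal H,f}\xi=\Pi_{\mathcal H}\nabla_\xi(\Pi_{\mathcal H}\mathsf g^{-1}\hat f_S)$. The subscripts $Y,P$ of an element of $\mathcal E$ denote its components in $\mathbb K^{n\times p}$ and $\mathbb K^{p\times p}$. *)

(* Defs.v *)
(* MathComp-Analysis; R[i] is the complex field of mathcomp-real-closed. *)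
From HB Require Import structures.
From mathcomp Require Import all_boot all_order all_algebra.
From mathcomp Require Import all_classical all_reals all_analysis.
From mathcomp Require Import complex.
From mathcomp Require Import ring lra.

Set Implicit Arguments.
Unset Strict Implicit.
Unset Printing Implicit Defensive.

Import Order.TTheory GRing.Theory Num.Theory.
Import numFieldNormedType.Exports.

Local Open Scope classical_set_scope.
Local Open Scope ring_scope.

Variant scalars := RealScalars | ComplexScalars.

Definition scal (R : realType) (k : scalars) : numFieldType :=
  match k with RealScalars => R | ComplexScalars => R[i] end.

Section Scalars.
Context {R : realType} {k : scalars}.
Local Notation K := (scal R k).

Definition inK : R -> K :=
  match k return R -> scal R k with
  | RealScalars => id
  | ComplexScalars => fun x => Complex x 0
  end.

Definition reK : K -> R :=
  match k return scal R k -> R with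
  | RealScalars => id
  | ComplexScalars => @complex.Re R
  end.

Definition conjK : K -> K :=
  match k return scal R k -> scal R k with
  | RealScalars => id
  | ComplexScalars => @conjc R
  end.

Definition ctrmx m n (A : 'M[K]_(m, n)) : 'M[K]_(n, m) := map_mx conjK A^T.

Definition trR n (A : 'M[K]_n) : R := reK (\tr A).

Definition ip m n (A B : 'M[K]_(m, n)) : R := trR (A *m ctrmx B).

Definition symt n (A : 'M[K]_n) : 'M[K]_n := 2%:R^-1 *: (A + ctrmx A).

End Scalars.

Notation "x %:K" := (inK x) (at level 1, format "x %:K").
Notation "A ^H" := (ctrmx A) (at level 8, format "A ^H").

Section Frobenius.
Context {R : realType} {k : scalars}.
Local Notation K := (scal R k).
Implicit Types (x y : K) (a : R).

Lemma inK_is_additive : {morph @inK R k : x y / x - y}.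
Proof. by case: k => x y //=; rewrite /inK; simpc. Qed.

Lemma inKD : {morph @inK R k : x y / x + y}.
Proof. by case: k => x y //=; rewrite /inK; simpc. Qed.

Lemma inKM : {morph @inK R k : x y / x * y}.
Proof. by case: k => x y //=; rewrite /inK; simpc. Qed.

Lemma inK1 : @inK R k 1 = 1.
Proof. by case: k. Qed.

Lemma reKD : {morph @reK R k : x y / x + y}.
Proof. by rewrite /reK; case: k => // -[x1 x2] [y1 y2]. Qed.

Lemma reK0 : @reK R k 0 = 0.
Proof. by rewrite /reK; case: k. Qed.

Lemma reKZ a x : reK (a%:K * x) = a * reK x.
Proof. by move: x; rewrite /reK /inK; case: k => // -[x1 x2] /=; rewrite mul0r subr0. Qed.

Lemma reKC x y : reK (x * conjK y) = reK (y * conjK x).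
Proof.
move: x y; rewrite /reK /conjK; case: k => /= [x y|[a b] [c d] /=].
  exact: mulrC.
by rewrite !mulrN (mulrC a) (mulrC b).
Qed.

Lemma reK_ge0 x : 0 <= reK (x * conjK x).
Proof.
move: x; rewrite /reK /conjK; case: k => /= [x|[a b] /=]; first exact: sqr_ge0.
by rewrite mulrN opprK addr_ge0 // -expr2 sqr_ge0.
Qed.

Lemma reK_eq0 x : reK (x * conjK x) = 0 -> x = 0.
Proof.
move: x; rewrite /reK /conjK; case: k => /= [x|[a b] /=].
  by move=> /eqP; rewrite mulf_eq0 orbb => /eqP.
move=> /eqP; rewrite mulrN opprK -!expr2 paddr_eq0 ?sqr_ge0 // !sqrf_eq0.
by case/andP=> /eqP -> /eqP ->.
Qed.

Lemma ipE m n (A B : 'M[K]_(m, n)) :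
  ip A B = \sum_i \sum_j reK (A i j * conjK (B i j)).
Proof.
rewrite /ip /trR /mxtrace (big_morph _ reKD reK0).
apply: eq_bigr => i _; rewrite mxE (big_morph _ reKD reK0).
by apply: eq_bigr => j _; rewrite !mxE.
Qed.

Lemma ipC m n (A B : 'M[K]_(m, n)) : ip A B = ip B A.
Proof. by rewrite !ipE; do 2!apply: eq_bigr => ? _; rewrite reKC. Qed.

Lemma ipDl m n (A B C : 'M[K]_(m, n)) : ip (A + B) C = ip A C + ip B C.
Proof.
rewrite !ipE -big_split; apply: eq_bigr => i _ /=; rewrite -big_split.
by apply: eq_bigr => j _ /=; rewrite !mxE mulrDl reKD.
Qed.

Lemma ipZl m n a (A B : 'M[K]_(m, n)) : ip (a%:K *: A) B = a * ip A B.
Proof.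
rewrite !ipE mulr_sumr; apply: eq_bigr => i _ /=; rewrite mulr_sumr.
by apply: eq_bigr => j _ /=; rewrite !mxE -mulrA reKZ.
Qed.

Lemma ip_ge0 m n (A : 'M[K]_(m, n)) : 0 <= ip A A.
Proof. by rewrite ipE; do 2!apply: sumr_ge0 => ? _; exact: reK_ge0. Qed.

Lemma ip_eq0 m n (A : 'M[K]_(m, n)) : ip A A = 0 -> A = 0.
Proof.
rewrite ipE => /eqP; rewrite psumr_eq0 => [/allP h|i _]; last first.
  by apply: sumr_ge0 => j _; exact: reK_ge0.
apply/matrixP => i j; rewrite mxE; apply: reK_eq0; apply/eqP.
have := h i (mem_index_enum i); rewrite /= psumr_eq0 => [/allP h'|? _].
  exact: h' j (mem_index_enum j).
exact: reK_ge0.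
Qed.

Lemma ip_CS m n (A B : 'M[K]_(m, n)) : ip A B ^+ 2 <= ip A A * ip B B.
Proof.
have [B0|B0] := eqVneq (ip B B) 0.
  have -> : ip A B = 0.
    rewrite (ip_eq0 B0) ipC -(scale0r (0 : 'M[K]_(m, n))) -(subrr (@inK R k 0)).
    by rewrite -inK_is_additive ipZl subr0 mul0r.
  by rewrite expr0n /= B0 mulr0.
have Bpos : 0 < ip B B by rewrite lt_def B0 ip_ge0.
have := ip_ge0 ((ip B B)%:K *: A + (- ip A B)%:K *: B).
rewrite ipDl !ipZl ![ip _ (_ + _)]ipC !ipDl !ipZl (ipC B A).
set a := ip A A; set b := ip B B; set c := ip A B.
have -> : b * (b * a + - c * c) + - c * (b * c + - c * b) =
          b * (a * b - c ^+ 2) by rewrite expr2; ring.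
by rewrite pmulr_rge0 // subr_ge0.
Qed.

End Frobenius.

(* K-matrices as a real normed space; 'M[K]_(m, n) itself carries the K-module
   structure of MathComp, hence the alias. *)
Definition rmx (R : realType) (k : scalars) (m n : nat) : Type :=
  'M[scal R k]_(m, n).

Section RealNormedMatrices.
Context (R : realType) (k : scalars) (m n : nat).
Local Notation M := (rmx R k m n).
Implicit Types (a b : R) (A B : M).

HB.instance Definition _ := GRing.Zmodule.copy M 'M[scal R k]_(m, n).

Let rscale a A : M := (a%:K *: (A : 'M[scal R k]_(m, n))).

Lemma rscaleA a b A : rscale a (rscale b A) = rscale (a * b) A.
Proof. by rewrite /rscale inKM scalerA. Qed.

Lemma rscale1 : left_id 1 rscale.
Proof. by move=> A; rewrite /rscale inK1 scale1r. Qed.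

Lemma rscaleDr : right_distributive rscale +%R.
Proof. by move=> a A B; exact: scalerDr. Qed.

Lemma rscaleDl A : {morph rscale^~ A : a b / a + b}.
Proof. by move=> a b; rewrite /rscale inKD scalerDl. Qed.

HB.instance Definition _ :=
  GRing.Zmodule_isLmodule.Build R M rscaleA rscale1 rscaleDr rscaleDl.

Let frob A : R := Num.sqrt (ip (A : 'M[scal R k]_(m, n)) A).

Lemma frobD A B : frob (A + B) <= frob A + frob B.
Proof.
rewrite /frob -[leRHS]ger0_norm ?addr_ge0 ?sqrtr_ge0 // -sqrtr_sqr.
rewrite ler_wsqrtr // sqrrD !sqr_sqrtr ?ip_ge0 //.
have -> : ip (A + B : 'M[scal R k]_(m, n)) (A + B) = ip A A + ip A B *+ 2 + ip B B.
  by rewrite ipDl (ipC A) (ipC B) !ipDl (ipC B A) mulr2n !addrA.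
rewrite -sqrtrM ?ip_ge0 //.
set x := ip _ _; set y := ip _ _; set z := ip _ _.
have h : y <= Num.sqrt (x * z).
  by rewrite (le_trans (ler_norm _)) // -sqrtr_sqr ler_wsqrtr // ip_CS.
lra.
Qed.

Lemma frobZ a A : frob (a *: A) = `|a| * frob A.
Proof.
rewrite /frob ipZl ipC ipZl mulrA -expr2 sqrtrM ?sqr_ge0 //.
by rewrite sqrtr_sqr.
Qed.

Lemma frob_eq0 A : frob A = 0 -> A = 0.
Proof.
move=> /eqP; rewrite sqrtr_eq0 => h; apply: ip_eq0; apply/eqP.
by rewrite eq_le h ip_ge0.
Qed.

HB.instance Definition _ := Lmodule_isNormed.Build R M frobD frobZ frob_eq0.

End RealNormedMatrices.

Section EmbeddedManifolds.
Context {R : realType} {V : normedModType R}.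

(* For V finite-dimensional these are the C^k maps on the open set U: all
   iterated directional derivatives of order at most k exist and are
   continuous. *)
Fixpoint Ck {W : normedModType R} (k : nat) (U : set V) (F : V -> W) : Prop :=
  (forall x, U x -> {for x, continuous F}) /\
  (if k is k'.+1
   then forall v, (forall x, U x -> derivable F x v) /\ Ck k' U ('D_v F)
   else True).

(* Values outside M are irrelevant: F is locally, on M, the restriction of a
   C^infinity map of the ambient space. *)
Definition smooth_on {W : normedModType R} (M : set V) (F : V -> W) : Prop :=
  forall x, M x -> exists (U : set V) (G : V -> W),
    [/\ open U, U x, forall k, Ck k U G & forall y, M y -> U y -> F y = G y].

Definition curve_at (M : set V) (x xi : V) (c : R -> V) : Prop :=
  [/\ c 0 = x, \forall t \near (0 : R), M (c t) & is_derive (0 : R) (1 : R) c xi].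

Definition tangent_space (M : set V) (x : V) : set V :=
  [set xi | exists c, curve_at M x xi c].

Definition is_dirD {W : normedModType R} (M : set V) (F : V -> W) (x xi : V)
    (dF : W) : Prop :=
  tangent_space M x xi /\
  forall c, curve_at M x xi c -> is_derive (0 : R) (1 : R) (F \o c) dF.

(* The directional derivative D_xi F at x of a map F on M, along xi tangent
   to M at x; it is 0 when there is no such derivative. *)
Definition dirD {W : normedModType R} (M : set V) (F : V -> W) (x xi : V) : W :=
  xget 0 [set dF | is_dirD M F x xi dF].

Definition vector_field (M : set V) : set (V -> V) :=
  [set xi | smooth_on M xi /\ forall x, M x -> tangent_space M x (xi x)].

Definition inner_product (T : set V) (b : V -> V -> R) : Prop :=
  [/\ forall a x y z, T x -> T y -> T z -> b (a *: x + y) z = a * b x z + b y z,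
      forall x y, T x -> T y -> b x y = b y x &
      forall x, T x -> x != 0 -> 0 < b x x].

Definition riemannian_metric (M : set V) (h : V -> V -> V -> R) : Prop :=
  (forall x, M x -> inner_product (tangent_space M x) (h x)) /\
  (forall xi eta, vector_field M xi -> vector_field M eta ->
    smooth_on M (fun x => h x (xi x) (eta x))).

(* The axioms of the Levi-Civita connection of the metric h, over an algebra Fn
   of functions and an Fn-module Vf of vector fields on M.  For a manifold M
   they are all smooth functions and all smooth tangent fields; for a quotient
   of M they are the lifts to M of the functions, resp. the horizontal lifts of
   the vector fields, of the quotient. *)
Definition levi_civita (M : set V) (Fn : set (V -> R)) (Vf : set (V -> V))
    (h : V -> V -> V -> R) (nabla : (V -> V) -> (V -> V) -> V -> V) : Prop :=
  [/\ forall xi eta, Vf xi -> Vf eta -> Vf (nabla xi eta),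
      (forall phi xi xi' eta, Fn phi -> Vf xi -> Vf xi' -> Vf eta ->
        forall x, M x ->
        nabla (fun y => phi y *: xi y + xi' y) eta x =
          phi x *: nabla xi eta x + nabla xi' eta x),
      (forall phi xi eta eta', Fn phi -> Vf xi -> Vf eta -> Vf eta' ->
        forall x, M x ->
        nabla xi (fun y => phi y *: eta y + eta' y) x =
          dirD M phi x (xi x) *: eta x + phi x *: nabla xi eta x
          + nabla xi eta' x),
      (forall xi eta zeta, Vf xi -> Vf eta -> Vf zeta ->
        forall x, M x ->
        dirD M (fun y => h y (eta y) (zeta y)) x (xi x) =
          h x (nabla xi eta x) (zeta x) + h x (eta x) (nabla xi zeta x)) &
      (forall phi xi eta, Fn phi -> Vf xi -> Vf eta ->
        forall x, M x ->
        dirD M (fun y => dirD M phi y (eta y)) x (xi x)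
          - dirD M (fun y => dirD M phi y (xi y)) x (eta x) =
        dirD M phi x (nabla xi eta x - nabla eta xi x))].

Definition orth_projection (T : set V) (b : V -> V -> R) (w v : V) : Prop :=
  T v /\ forall u, T u -> b u (w - v) = 0.

End EmbeddedManifolds.

Definition opinv (T : zmodType) (A : T -> T) (y : T) : T :=
  xget 0 [set x | A x = y].

Section FixedRankPSD.
Context {R : realType} {k : scalars} {n p : nat}.
Local Notation K := (scal R k).
Local Notation E := (rmx R k n p * rmx R k p p)%type.
Implicit Types S w xi eta : E.

Definition Ypart (w : E) : 'M[K]_(n, p) := w.1.
Definition Ppart (w : E) : 'M[K]_p := w.2.
Definition mkE (A : 'M[K]_(n, p)) (B : 'M[K]_p) : E := (A, B).

Definition ipA w eta : R := ip (Ypart w) (Ypart eta) + ip (Ppart w) (Ppart eta).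

Definition stiefel m q : set 'M[K]_(m, q) := [set Y | Y^H *m Y = 1%:M].

Definition unitary m : set 'M[K]_m := @stiefel m m.

(* In R[i], 0 < z means that z is real and positive. *)
Definition posdef m : set 'M[K]_m :=
  [set P | P^H = P /\
    forall v : 'cV[K]_m, v != 0 -> 0 < (v^H *m P *m v) ord0 ord0].

(* The manifold of positive-semidefinite matrices of rank p. *)
Definition psd_rank : set (rmx R k n n) :=
  [set X : 'M[K]_n | [/\ X^H = X,
    forall v : 'cV[K]_n, 0 <= (v^H *m X *m v) ord0 ord0 & \rank X = p]].

Definition total_space : set E := [set S | stiefel (Ypart S) /\ posdef (Ppart S)].

(* The action is real-linear, so this is also its differential. *)
Definition Uact (w : E) (U : 'M[K]_p) : E :=
  mkE (Ypart w *m U) (U^H *m Ppart w *m U).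

Definition orbit_of S : set E := [set S' | exists2 U, unitary U & S' = Uact S U].

Definition quo_proj (S : E) : rmx R k n n := Ypart S *m Ppart S *m (Ypart S)^H.

Variables alpha0 alpha1 beta : R.

Definition metric_op S w : E :=
  let Y := Ypart S in let P := Ppart S in
  mkE (alpha0%:K *: Ypart w
         + (alpha1 - alpha0)%:K *: (Y *m Y^H *m Ypart w))
      (beta%:K *: (invmx P *m Ppart w *m invmx P)).

Definition metric_form S w eta : R := ipA w (metric_op S eta).

Definition horizontal_space S : set E :=
  [set eta | tangent_space total_space S eta /\
    forall zeta, tangent_space (orbit_of S) S zeta ->
      metric_form S eta zeta = 0].

Definition hproj S w : E :=
  xget 0 [set v | orth_projection (horizontal_space S) (metric_form S) w v].

(* The smooth functions and vector fields on the quotient, given by their lifts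
   to the total space; being smooth on the quotient means that the lift is. *)
Definition base_function : set (E -> R) :=
  [set phi | smooth_on total_space phi /\
    exists f : rmx R k n n -> R, forall S, total_space S -> phi S = f (quo_proj S)].

Definition horizontal_lift (X : rmx R k n n -> rmx R k n n) : set (E -> E) :=
  [set xi | smooth_on total_space xi /\ forall S, total_space S ->
    horizontal_space S (xi S) /\
    is_dirD total_space quo_proj S (xi S) (X (quo_proj S))].

Definition base_field : set (E -> E) :=
  [set xi | exists X, horizontal_lift X xi].

Definition hconn (nabla : (E -> E) -> (E -> E) -> E -> E)
    (xi eta : E -> E) (S : E) : E := hproj S (nabla xi eta S).

Definition ambient_gradient (f : E -> R) (fS : E -> E) : Prop :=
  smooth_on total_space fS /\
  forall eta : E -> E, vector_field total_space eta ->
  forall S, total_space S -> ipA (eta S) (fS S) = dirD total_space f S (eta S).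

Definition rhess (nabla : (E -> E) -> (E -> E) -> E -> E) (fS : E -> E)
    (xi : E -> E) (S : E) : E :=
  hconn nabla xi (fun S' => hproj S' (opinv (metric_op S') (fS S'))) S.

Definition Nop S (Yp : 'M[K]_(n, n - p)) (B : 'M[K]_(n - p, p)) (D : 'M[K]_p) : E :=
  let Y := Ypart S in let P := Ppart S in
  mkE (beta%:K *: (Y *m (invmx P *m D - D *m invmx P)) + Yp *m B)
      (alpha1%:K *: D).

Definition Lop (P X : 'M[K]_p) : 'M[K]_p :=
  (alpha1 - 2%:R * beta)%:K *: X
    + beta%:K *: (P *m X *m invmx P + invmx P *m X *m P).

Definition calD S w : 'M[K]_p :=
  let Y := Ypart S in let P := Ppart S in
  opinv (Lop P)
    (symt (Ppart w + Y^H *m Ypart w *m P - P *m Y^H *m Ypart w)).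

(* The closed form of (D_xi calD) w at S. *)
Definition calDring S xi w : 'M[K]_p :=
  let Y := Ypart S in let P := Ppart S in let Pi := invmx P in
  let xY := Ypart xi in let xP := Ppart xi in let wY := Ypart w in
  let D := calD S w in
  opinv (Lop P)
    (symt (xY^H *m wY *m P - P *m xY^H *m wY
             + Y^H *m wY *m xP - xP *m Y^H *m wY)
     - beta%:K *: (xP *m D *m Pi + Pi *m D *m xP
             - P *m D *m Pi *m xP *m Pi - Pi *m xP *m Pi *m D *m P)).

Definition Kop S xi eta : E :=
  let Y := Ypart S in let Pi := invmx (Ppart S) in
  let xY := Ypart xi in let xP := Ppart xi in
  let eY := Ypart eta in let eP := Ppart eta in
  mkE (((alpha1 - alpha0) / 2%:R)%:K *:
         (Y *m (eY^H *m xY + xY^H *m eY)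
            - 2%:R *: ((eY *m xY^H + xY *m eY^H) *m Y)))
      (- (beta / 2%:R)%:K *:
         (Pi *m eP *m Pi *m xP *m Pi + Pi *m xP *m Pi *m eP *m Pi)).

End FixedRankPSD.

Arguments psd_rank {R k n} p.

(* Main.v *)
Require Import Defs.
From HB Require Import structures.
From mathcomp Require Import all_boot all_order all_algebra.
From mathcomp Require Import all_classical all_reals all_analysis.
From mathcomp Require Import complex.
From mathcomp Require Import ring lra.

Set Implicit Arguments.
Unset Strict Implicit.
Unset Printing Implicit Defensive.

Import Order.TTheory GRing.Theory Num.Theory.
Import numFieldNormedType.Exports.

Local Open Scope classical_set_scope.
Local Open Scope ring_scope.

(** The total space M is the zero set of Y^H Y = 1 inside an open subset of the
    pairs with Hermitian P, so its tangent vectors are given by linear equations: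
    a Cayley transform and t |-> (1 + tA)^H P (1 + tA) produce curves with
    prescribed velocity.  Differentiating along orbits gives the vertical vectors
    (Y a, P a - a P), a skew, and pairing with them gives the horizontality
    equation.  The operator L(P) is injective because, with A = P X P^-1, the
    inner product of A and L(P) X is alpha1 <A, X> + beta |A - X|^2; the formula
    for the projection is then checked by orthogonality.

    A velocity v of a curve X(t) of semidefinite matrices of rank p satisfies
    Q v Q = 0 for Q = 1 - Y Y^H, since u^H Q X(t) Q u has a minimum at t = 0; hence
    v lifts to M, and uniquely to a horizontal vector.

    The Levi-Civita axioms give the Koszul formula.  The metric being
    <. , g(S) .> in the ambient space, it says
    h(nabla_xi eta, zeta) = h(D_xi eta, zeta) + <K(xi, eta), zeta>,
    and testing with the fields zeta = Pi_H w determines Pi_H nabla_xi eta.  All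
    the operators involved are equivariant under U_{K,p}, so that this projection
    is again the horizontal lift of a field on the quotient. *)

(** * Scalars and conjugate transposes *)

(** Derivatives of maps on M are taken along curves, while [smooth_on] only provides local ambient
    extensions with continuous iterated directional derivatives. [C1_chain] bridges the two: it
    yields a differential that is linear in the direction and common to all curves, so that
    directional derivatives of smooth maps exist.

    [hproj], [opinv] and [dirD] are selected by choice, so every closed formula is reached through a
    uniqueness statement. The derivative formulas for D and for g^-1 f_S do not come from
    differentiating L(P)^-1 or g^-1: smoothness gives some derivative, and differentiating the
    equations L(P) D = sym(...) and g F = f_S determines it.

    K-matrices carry two scalar actions, over K for the algebra and over R for the analysis. The
    typed operations [rmul], [rctr], [rinv] on the alias [rmx] select the real normed structure;
    rewriting them away returns to matrix algebra, where [mxring] applies.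

    The ambient derivative D_xi eta need not be tangent to M, and K is determined only against
    tangent vectors; this is harmless because both enter only through products with tangent vectors
    or through Pi_H. *)

Section ScalarTheory.
Context {R : realType} {k : scalars}.
Local Notation K := (scal R k).
Implicit Types (x y : K) (a b : R).

Lemma conjK_is_additive : zmod_morphism (@conjK R k).
Proof. by move=> x y; rewrite /conjK; move: x y; case: k => //= x y; rewrite rmorphB. Qed.

Lemma conjK_is_multiplicative : monoid_morphism (@conjK R k).
Proof.
rewrite /conjK; split; first by case: k => //=; exact: conjc1.
by move=> x y; move: x y; case: k => //= x y; rewrite rmorphM.
Qed.

HB.instance Definition _ :=
  GRing.isZmodMorphism.Build K K (@conjK R k) conjK_is_additive.
HB.instance Definition _ :=
  GRing.isMonoidMorphism.Build K K (@conjK R k) conjK_is_multiplicative.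

Lemma inK_is_multiplicative : monoid_morphism (@inK R k).
Proof. by split; [exact: inK1|exact: inKM]. Qed.

HB.instance Definition _ :=
  GRing.isZmodMorphism.Build R K (@inK R k) inK_is_additive.
HB.instance Definition _ :=
  GRing.isMonoidMorphism.Build R K (@inK R k) inK_is_multiplicative.

Lemma conjKK : involutive (@conjK R k).
Proof. by rewrite /conjK; case: k => //= x; rewrite conjcK. Qed.

Lemma conjK_in a : conjK (@inK R k a) = a%:K.
Proof. by rewrite /conjK /inK; case: k => //=; rewrite oppr0. Qed.

Lemma reK_in a : reK (@inK R k a) = a.
Proof. by rewrite /reK /inK; case: k. Qed.

Lemma reK_is_additive : zmod_morphism (@reK R k).
Proof. by rewrite /reK; case: k => // -[x1 x2] [y1 y2]. Qed.

HB.instance Definition _ :=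
  GRing.isZmodMorphism.Build K R (@reK R k) reK_is_additive.

Lemma inK_gt0 a : (0 < @inK R k a) = (0 < a).
Proof. by rewrite /inK; case: k => //=; rewrite ltcE /= eqxx. Qed.

Lemma inK_ge0 a : (0 <= @inK R k a) = (0 <= a).
Proof. by rewrite /inK; case: k => //=; rewrite lecE /= eqxx. Qed.

Lemma ge0_inK x : 0 <= x -> x = (reK x)%:K.
Proof.
by rewrite /inK /reK; move: x; case: k => //= -[a b]; rewrite lecE /= => /andP[/eqP -> _].
Qed.

Lemma mul_conjK x : x * conjK x = (reK (x * conjK x))%:K.
Proof.
rewrite /conjK /inK /reK; move: x; case: k => //= -[a b] /=.
by congr Complex; ring.
Qed.

(* The imaginary unit, or 0 over the reals, so that [z = re z + im z * i] in
   both cases. *)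
Definition iK : K :=
  match k return scal R k with RealScalars => 0 | ComplexScalars => Complex 0 1 end.

Definition imK : K -> R :=
  match k return scal R k -> R with
  | RealScalars => fun=> 0
  | ComplexScalars => @complex.Im R
  end.

Lemma reimK x : x = (reK x)%:K + (imK x)%:K * iK.
Proof.
rewrite /inK /reK /imK /iK; move: x; case: k => //= [x|[a b]]; first by rewrite mul0r addr0.
by simpc.
Qed.

Lemma imK_is_additive : zmod_morphism imK.
Proof.
by rewrite /imK; case: k => //= [x y|[x1 x2] [y1 y2]] //; rewrite subr0.
Qed.

HB.instance Definition _ := GRing.isZmodMorphism.Build K R imK imK_is_additive.

Lemma imKZ a x : imK (a%:K * x) = a * imK x.
Proof.
rewrite /imK /inK; move: x; case: k => //= [x|[b c] /=]; first by rewrite mulr0.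
by rewrite mul0r addr0.
Qed.

Lemma norm2_reim x : reK (x * conjK x) = reK x ^+ 2 + imK x ^+ 2.
Proof.
rewrite /conjK /imK /reK; move: x; case: k => //= [x|[a b] /=].
  by rewrite expr0n addr0.
by rewrite mulrN opprK !expr2.
Qed.

End ScalarTheory.

Section CtrTheory.
Context {R : realType} {k : scalars}.
Local Notation K := (scal R k).

Lemma ctrmxD m n (A B : 'M[K]_(m, n)) : (A + B)^H = A^H + B^H.
Proof. by rewrite /ctrmx raddfD /= map_mxD. Qed.

Lemma ctrmxN m n (A : 'M[K]_(m, n)) : (- A)^H = - A^H.
Proof. by rewrite /ctrmx raddfN /= map_mxN. Qed.

Lemma ctrmxB m n (A B : 'M[K]_(m, n)) : (A - B)^H = A^H - B^H.
Proof. by rewrite ctrmxD ctrmxN. Qed.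

Lemma ctrmx0 m n : (0 : 'M[K]_(m, n))^H = 0.
Proof. by rewrite /ctrmx raddf0 /= map_mx0. Qed.

Lemma ctrmxZ m n (a : K) (A : 'M[K]_(m, n)) : (a *: A)^H = conjK a *: A^H.
Proof. by rewrite /ctrmx linearZ /= map_mxZ. Qed.

Lemma ctrmxZr m n (a : R) (A : 'M[K]_(m, n)) : (a%:K *: A)^H = a%:K *: A^H.
Proof. by rewrite ctrmxZ conjK_in. Qed.

Lemma ctrmxM m n p (A : 'M[K]_(m, n)) (B : 'M[K]_(n, p)) : (A *m B)^H = B^H *m A^H.
Proof. by rewrite /ctrmx trmx_mul map_mxM. Qed.

Lemma ctrmxK m n (A : 'M[K]_(m, n)) : A^H^H = A.
Proof. by apply/matrixP => i j; rewrite !mxE conjKK. Qed.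

Lemma ctrmx1 n : (1%:M : 'M[K]_n)^H = 1%:M.
Proof. by rewrite /ctrmx trmx1 map_mx1. Qed.

Lemma ctrmx_unit n (A : 'M[K]_n) : (A^H \in unitmx) = (A \in unitmx).
Proof. by rewrite /ctrmx map_unitmx unitmx_tr. Qed.

Lemma ctrmx_inv n (A : 'M[K]_n) : (invmx A)^H = invmx A^H.
Proof. by rewrite /ctrmx trmx_inv map_invmx. Qed.

Lemma ctrmx_block m1 m2 n1 n2 (A : 'M[K]_(m1, n1)) B C (D : 'M[K]_(m2, n2)) :
  (block_mx A B C D)^H = block_mx A^H C^H B^H D^H.
Proof. by rewrite /ctrmx tr_block_mx map_block_mx. Qed.

Lemma ctrmx_row m n1 n2 (A : 'M[K]_(m, n1)) (B : 'M[K]_(m, n2)) :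
  (row_mx A B)^H = col_mx A^H B^H.
Proof. by rewrite /ctrmx tr_row_mx map_col_mx. Qed.

Lemma ctrmx_col m n1 n2 (A : 'M[K]_(n1, m)) (B : 'M[K]_(n2, m)) :
  (col_mx A B)^H = row_mx A^H B^H.
Proof. by rewrite /ctrmx tr_col_mx map_row_mx. Qed.

(* Unlike [mxE], these leave the entries of products untouched. *)
Lemma mxDE m n (A B : 'M[K]_(m, n)) i j : (A + B) i j = A i j + B i j.
Proof. by rewrite mxE. Qed.
Lemma mxNE m n (A : 'M[K]_(m, n)) i j : (- A) i j = - A i j.
Proof. by rewrite mxE. Qed.
Lemma mxZE m n a (A : 'M[K]_(m, n)) i j : (a *: A) i j = a * A i j.
Proof. by rewrite mxE. Qed.
Lemma mx0E m n i j : (0 : 'M[K]_(m, n)) i j = 0.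
Proof. by rewrite mxE. Qed.

Lemma symt_herm n (A : 'M[K]_n) : (symt A)^H = symt A.
Proof.
by rewrite /symt ctrmxZ ctrmxD ctrmxK addrC fmorphV /= rmorph_nat.
Qed.

Lemma herm_symt n (A : 'M[K]_n) : A^H = A -> symt A = A.
Proof.
by move=> hA; rewrite /symt hA -mulr2n -[A *+ 2]scaler_nat scalerA mulVf ?scale1r //.
Qed.

Lemma trR_is_additive n : zmod_morphism (@trR R k n).
Proof. by move=> A B; rewrite /trR !raddfB. Qed.

HB.instance Definition _ n :=
  GRing.isZmodMorphism.Build 'M[K]_n R (@trR R k n) (@trR_is_additive n).

Lemma trR_mulC m n (A : 'M[K]_(m, n)) B : trR (A *m B) = trR (B *m A).
Proof. by rewrite /trR mxtrace_mulC. Qed.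

Lemma trRZ n (a : R) (A : 'M[K]_n) : trR (a%:K *: A) = a * trR A.
Proof. by rewrite /trR mxtraceZ reKZ. Qed.

Lemma ip_adjl m n p (A : 'M[K]_(m, n)) (B : 'M[K]_(n, p)) C :
  ip (A *m B) C = ip B (A^H *m C).
Proof. by rewrite /ip ctrmxM ctrmxK -mulmxA trR_mulC mulmxA. Qed.

Lemma ip_adjr m n p (A : 'M[K]_(m, n)) (B : 'M[K]_(n, p)) C :
  ip (A *m B) C = ip A (C *m B^H).
Proof. by rewrite /ip ctrmxM ctrmxK mulmxA. Qed.

Lemma ip_ctr m n (A B : 'M[K]_(m, n)) : ip A^H B^H = ip A B.
Proof. by rewrite /ip ctrmxK trR_mulC -/(ip B A) ipC. Qed.

Lemma ipDr m n (A B C : 'M[K]_(m, n)) : ip C (A + B) = ip C A + ip C B.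
Proof. by rewrite ipC ipDl !(ipC C). Qed.

Lemma ipZr m n a (A B : 'M[K]_(m, n)) : ip A (a%:K *: B) = a * ip A B.
Proof. by rewrite ipC ipZl ipC. Qed.

Lemma ipNl m n (A B : 'M[K]_(m, n)) : ip (- A) B = - ip A B.
Proof. by rewrite /ip mulNmx raddfN. Qed.

Lemma ipNr m n (A B : 'M[K]_(m, n)) : ip A (- B) = - ip A B.
Proof. by rewrite ipC ipNl ipC. Qed.

Lemma ipBl m n (A B C : 'M[K]_(m, n)) : ip (A - B) C = ip A C - ip B C.
Proof. by rewrite ipDl ipNl. Qed.

Lemma ipBr m n (A B C : 'M[K]_(m, n)) : ip C (A - B) = ip C A - ip C B.
Proof. by rewrite ipDr ipNr. Qed.

Lemma ip0l m n (A : 'M[K]_(m, n)) : ip 0 A = 0.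
Proof. by rewrite /ip mul0mx raddf0. Qed.

Lemma ip0r m n (A : 'M[K]_(m, n)) : ip A 0 = 0.
Proof. by rewrite ipC ip0l. Qed.

Lemma ip_gt0 m n (A : 'M[K]_(m, n)) : A != 0 -> 0 < ip A A.
Proof.
by move=> A0; rewrite lt_def ip_ge0 andbT; apply: contra_neq A0; exact: ip_eq0.
Qed.

(** The skew part of [B] is orthogonal to every Hermitian matrix. *)
Lemma ip_herm_symt n (A B : 'M[K]_n) : A^H = A -> ip A (symt B) = ip A B.
Proof.
move=> hA; have -> : symt B = (2%:R^-1)%:K *: (B + B^H).
  by rewrite /symt fmorphV /= rmorph_nat.
rewrite ipZr ipDr -{2}hA ip_ctr; lra.
Qed.

Lemma form_ip m (v : 'cV[K]_m) : (v^H *m v) ord0 ord0 = (ip v v)%:K.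
Proof.
rewrite ipE raddf_sum mxE; apply: eq_bigr => i _.
by rewrite big_ord1 !mxE mulrC; exact: mul_conjK.
Qed.

End CtrTheory.

(** * Positive-definite matrices and the operator L(P) *)

(* [mxnorm; mxring] proves identities between linear combinations of matrix
   products: [ring] works entrywise, each monomial being an atom. *)
Ltac mxnorm := rewrite ?(mulmxDl, mulmxDr, mulNmx, mulmxN, scalerDr, scalerN,
  opprD, opprK, mulmxA) -?(scalemxAl, scalemxAr) ?(mulmxDl, mulmxDr, mulNmx,
  mulmxN, scalerDr, scalerN, opprD, opprK, mulmxA).
Ltac mxring := apply/matrixP => ? ?; rewrite !(mxDE, mxNE, mxZE, mx0E); ring.

Lemma invmx_mul (F : comUnitRingType) n (A B : 'M[F]_n) :
  A \in unitmx -> B \in unitmx -> invmx (A *m B) = invmx B *m invmx A.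
Proof.
move=> uA uB; have uAB : A *m B \in unitmx by rewrite unitmx_mul uA.
apply: (can_inj (mulKmx uAB)).
by rewrite mulmxV // -mulmxA mulKVmx // mulmxV.
Qed.

Section PosDef.
Context {R : realType} {k : scalars}.
Local Notation K := (scal R k).

Lemma unit_gram_posdef m (T : 'M[K]_m) : T \in unitmx -> posdef (T^H *m T).
Proof.
move=> uT; split=> [|v v0]; first by rewrite ctrmxM ctrmxK.
rewrite mulmxA -ctrmxM -mulmxA form_ip inK_gt0 ip_gt0 //.
by apply: contra_neq v0 => Tv; rewrite -(mulKmx uT v) Tv mulmx0.
Qed.

Lemma mul_col_row_mx_block m (a : 'M[K]_1) (b : 'cV[K]_m) (v : 'M[K]_1) (w : 'cV[K]_m) C :
  (col_mx v w)^H *m block_mx a b^H b C *m col_mx v w =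
  v^H *m a *m v + w^H *m b *m v + v^H *m b^H *m w + w^H *m C *m w.
Proof.
rewrite ctrmx_col mul_row_block mul_row_col !mulmxDl.
by rewrite -!addrA; congr (_ + (_ + _)).
Qed.

(** Cholesky factorization by induction on the size: the corner entry a is positive, the Schur
    complement C - a^-1 b b^H is again positive definite, and its factor T is bordered by the row
    (s, s^-1 b^H) with s^2 = a. Invertibility of P and positivity of the forms below are deduced
    from it without any spectral theorem. *)
Lemma posdef_gram m (P : 'M[K]_m) :
  posdef P -> exists2 T : 'M[K]_m, T \in unitmx & P = T^H *m T.
Proof.
elim: m P => [|m IH] P [hP pP].
  exists 1%:M; first exact: unitmx1.
  by apply/matrixP => -[].
pose P' : 'M[K]_(1 + m) := P.
pose a := ulsubmx P' ord0 ord0; pose b := dlsubmx P'; pose C := drsubmx P'.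
have [_ eb _ hC] : [/\ (ulsubmx P')^H = ulsubmx P', (dlsubmx P')^H = ursubmx P',
    (ursubmx P')^H = dlsubmx P' & (drsubmx P')^H = drsubmx P'].
  by apply: eq_block_mx; rewrite -ctrmx_block !submxK.
have PE : P' = block_mx a%:M b^H b C.
  by rewrite eb -[LHS]submxK -mx11_scalar.
have a_gt0 : 0 < a.
  have := pP (col_mx (1%:M : 'M[K]_1) 0).
  rewrite -[P]/P' PE mul_col_row_mx_block.
  rewrite ctrmx0 ctrmx1 !(mul0mx, mulmx0) !addr0 mulmx1 mul1mx mxE eqxx mulr1n.
  apply; apply/eqP => /matrixP/(_ ord0 ord0); rewrite !mxE.
  case: splitP => // j _; rewrite !mxE (ord1 j) eqxx => /eqP.
  by rewrite oner_eq0.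
pose r : R := Num.sqrt (reK a); pose s : K := r%:K.
have r_gt0 : 0 < r.
  by rewrite sqrtr_gt0 -(@inK_gt0 _ k) -ge0_inK // ltW.
have sa : s * s = a.
  rewrite -inKM -expr2 sqr_sqrtr -?ge0_inK ?ltW //.
  by rewrite -(@inK_gt0 _ k) -ge0_inK ?ltW.
have s0 : s != 0 by rewrite fmorph_eq0 gt_eqF.
have a0 : a != 0 by rewrite gt_eqF.
have ca : conjK a = a by rewrite -sa rmorphM /= conjK_in.
have pC : posdef (C - a^-1 *: (b *m b^H)).
  split=> [|w w0].
    by rewrite ctrmxB hC ctrmxZ ctrmxM ctrmxK fmorphV /= ca.
  (* For fixed w the form is minimal in its first coordinate at -a^-1 b^H w; what is left there is
     the Schur complement at w. *)
  have := pP (col_mx (- a^-1 *: (b^H *m w)) w).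
  rewrite -[P]/P' PE mul_col_row_mx_block.
  have -> : (- a^-1 *: (b^H *m w))^H *m a%:M *m (- a^-1 *: (b^H *m w))
     + w^H *m b *m (- a^-1 *: (b^H *m w)) + (- a^-1 *: (b^H *m w))^H *m b^H *m w
     + w^H *m C *m w = w^H *m (C - a^-1 *: (b *m b^H)) *m w.
    rewrite ctrmxZ rmorphN /= fmorphV /= ca ctrmxM ctrmxK mul_mx_scalar !scalerA.
    rewrite mulrN divff // !(scaleNr, scale1r).
    mxnorm; rewrite ?scaleNr; mxnorm.
    apply/matrixP => i j; rewrite !(mxDE, mxNE, mxZE, mx0E); ring.
  apply; apply: contra_neq w0 => h.
  have := congr1 (@dsubmx _ 1 m 1) (h : _ = (0 : 'M[K]_(1 + m, 1))).
  by rewrite col_mxKd linear0.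
have [T uT TE] := IH _ pC.
pose T' : 'M[K]_(1 + m) := block_mx s%:M (s^-1 *: b^H) 0 T.
suff TE' : P' = T'^H *m T'.
  exists (T' : 'M[K]_m.+1) => //.
  rewrite unitmxE (@det_ublock _ 1 m) det_scalar expr1 unitrM -unitmxE uT.
  by rewrite unitfE s0.
rewrite PE ctrmx_block mulmx_block ctrmx0 !(mul0mx, mulmx0) !addr0.
have ss : conjK s = s by rewrite conjK_in.
have sM : (s%:M : 'M[K]_1)^H = s%:M by rewrite -scalemx1 ctrmxZ ctrmx1 ss.
rewrite sM -scalar_mxM sa ctrmxZ ctrmxK fmorphV /= ss.
congr block_mx.
- by rewrite mul_scalar_mx scalerA divff // scale1r.
- by rewrite mul_mx_scalar scalerA divff // scale1r.
- rewrite -TE -scalemxAl -scalemxAr scalerA -invfM sa.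
  by rewrite addrCA subrr addr0.
Qed.

Variables (p : nat) (P : 'M[K]_p).
Hypothesis pP : posdef P.

Lemma posdef_herm : P^H = P. Proof. by case: pP. Qed.

Lemma posdef_unit : P \in unitmx.
Proof.
by have [T uT ->] := posdef_gram pP; rewrite unitmx_mul ctrmx_unit uT.
Qed.

Lemma posdef_inv_herm : (invmx P)^H = invmx P.
Proof. by rewrite ctrmx_inv posdef_herm. Qed.

(** With P = T^H T the product equals |T w T^-1|^2. *)
Lemma ip_posdef_sandwich_gt0 (w : 'M[K]_p) : w != 0 ->
  0 < ip (P *m w *m invmx P) w.
Proof.
move=> w0; have [T uT PE] := posdef_gram pP.
have uH : T^H \in unitmx by rewrite ctrmx_unit.
have -> : P *m w *m invmx P = T^H *m (T *m w *m invmx T) *m (invmx T)^H.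
  by rewrite PE invmx_mul // ctrmx_inv !mulmxA.
rewrite ip_adjr ip_adjl !ctrmxK mulmxA ip_gt0 //; apply: contra_neq w0 => h.
by rewrite -(mulKmx uT w) -[T *m w](mulmxK (_ : invmx T \in unitmx)) ?unitmx_inv //
  h mul0mx mulmx0.
Qed.

(** With P^-1 = A^H A the product equals |A w A^H|^2. *)
Lemma ip_posdef_inv_gt0 (w : 'M[K]_p) : w != 0 ->
  0 < ip w (invmx P *m w *m invmx P).
Proof.
move=> w0; have [T uT PE] := posdef_gram pP.
have uH : T^H \in unitmx by rewrite ctrmx_unit.
have [A uA PiE] : exists2 A : 'M[K]_p, A \in unitmx & invmx P = A^H *m A.
  exists (invmx T)^H; first by rewrite ctrmx_unit unitmx_inv.
  by rewrite PE invmx_mul // ctrmxK ctrmx_inv.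
have uA' : A^H \in unitmx by rewrite ctrmx_unit.
have -> : invmx P *m w *m invmx P = A^H *m (A *m w *m A^H) *m A.
  by rewrite PiE !mulmxA.
rewrite ipC ip_adjr ip_adjl !ctrmxK mulmxA ip_gt0 //; apply: contra_neq w0 => h.
by rewrite -(mulKmx uA w) -[A *m w](mulmxK uA') h mul0mx mulmx0.
Qed.

Variables (alpha1 beta : R) (ha : 0 < alpha1) (hb : 0 < beta).
Local Notation L := (Lop alpha1 beta P).

Lemma LopD X Z : L (X + Z) = L X + L Z.
Proof. rewrite /Lop; mxnorm; mxring. Qed.

Lemma LopZ a X : L (a *: X) = a *: L X.
Proof. rewrite /Lop; mxnorm; mxring. Qed.

(* <A, L X> = alpha1 <A, X> + beta |A - X|^2 for A = P X P^-1, and <A, X> > 0. *)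
Lemma Lop_inj0 X : L X = 0 -> X = 0.
Proof.
move=> LX; apply/eqP; case: eqVneq => // X0.
pose A := P *m X *m invmx P.
suff : ip A (L X) = alpha1 * ip A X + beta * ip (A - X) (A - X).
  rewrite LX ip0r => /eqP; rewrite eq_sym gt_eqF // ltr_wpDr //.
    by rewrite mulr_ge0 ?ip_ge0 // ltW.
  by rewrite mulr_gt0 // ip_posdef_sandwich_gt0.
have AX : ip A (invmx P *m X *m P) = ip X X.
  rewrite /A ip_adjr ip_adjl posdef_inv_herm posdef_herm !mulmxA.
  by rewrite mulmxV ?posdef_unit // mul1mx mulmxK ?posdef_unit.
rewrite /Lop -/A ipDr !ipZr ipDr AX ipBl !ipBr (ipC X A); ring.
Qed.

End PosDef.

Lemma opinvP (T : zmodType) (A : T -> T) x y :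
  injective A -> A x = y -> opinv A y = x.
Proof.
move=> iA Ax; apply: iA; rewrite /opinv.
by case: xgetP => [z _ /= ->|/(_ x)] //; rewrite Ax.
Qed.

(** One entry of L(P) X = B in an eigenbasis of P, with eigenvalues l and m. The divisor is positive
    because l^-1 m + l m^-1 - 2 = (l - m)^2 / (l m). *)
Lemma eig_divisor_identity (F : numFieldType) (a b l m c : F) :
  0 < a -> 0 <= b -> 0 < l -> 0 < m ->
  let d := c / (a + b * (l^-1 * m + l * m^-1 - 2%:R)) in
  (a - 2 * b) * d + b * (l * d * m^-1 + l^-1 * d * m) = c.
Proof.
move=> a0 b0 l0 m0.
have E : l^-1 * m + l * m^-1 - 2%:R = (l - m) ^+ 2 / (l * m).
  by field; rewrite !gt_eqF.
have M0 : a + b * (l^-1 * m + l * m^-1 - 2%:R) != 0.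
  have S : 0 <= (l - m) ^+ 2 by rewrite real_exprn_even_ge0 // rpredB ?gtr0_real.
  rewrite E gt_eqF // ltr_pwDl // mulr_ge0 //.
  by apply: divr_ge0 => //; apply: mulr_ge0; apply: ltW.
set M := a + _ in M0 * => /=; rewrite -[RHS](divfK M0) [RHS]mulrC.
by rewrite /M; move: (c / _) => d; ring.
Qed.

Section LopTheory.
Context {R : realType} {k : scalars} (p : nat).
Local Notation K := (scal R k).
Variables (alpha1 beta : R).

(* The matrix of L(P) is polynomial in P and Q = P^-1, which makes L(P)^-1 smooth in
   P. *)
Definition Lop_mx (P Q : 'M[K]_p) : 'M[K]_(p * p) :=
  (alpha1 - 2%:R * beta)%:K *: 1%:M
    + beta%:K *: (lin_mulmx P *m lin_mulmxr Q + lin_mulmx Q *m lin_mulmxr P).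

Lemma mxvec_Lop P X :
  mxvec X *m Lop_mx P (invmx P) = mxvec (Lop alpha1 beta P X).
Proof.
rewrite /Lop_mx /Lop /lin_mulmx /lin_mulmxr !mulmxDr -!scalemxAr mulmxDr mulmx1 !mulmxA.
have vD (A B : 'M[K]_p) : mxvec (A + B) = mxvec A + mxvec B by exact: linearD.
have vZ a (A : 'M[K]_p) : mxvec (a *: A) = a *: mxvec A by exact: linearZ.
by rewrite !mul_vec_lin /= vD !vZ vD.
Qed.

Variable P : 'M[K]_p.
Hypotheses (pP : posdef P) (ha : 0 < alpha1) (hb : 0 < beta).
Local Notation L := (Lop alpha1 beta P).

Lemma Lop_inj : injective L.
Proof.
move=> X Z XZ; apply/eqP; rewrite -subr_eq0; apply/eqP.
apply: (Lop_inj0 pP ha hb).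
by rewrite LopD -(scaleN1r Z) LopZ scaleN1r XZ subrr.
Qed.

Lemma Lop_mx_unit : Lop_mx P (invmx P) \in unitmx.
Proof.
rewrite -row_free_unit; apply: inj_row_free => v.
rewrite -[v]vec_mxK mxvec_Lop => /(canRL mxvecK); rewrite linear0.
by move=> /(Lop_inj0 pP ha hb) ->; rewrite linear0.
Qed.

Lemma Lop_surj A : L (opinv L A) = A.
Proof.
pose X := vec_mx (mxvec A *m invmx (Lop_mx P (invmx P))).
have LX : L X = A.
  apply: (can_inj mxvecK); rewrite -mxvec_Lop vec_mxK.
  by rewrite mulmxKV // Lop_mx_unit.
by rewrite (opinvP Lop_inj LX).
Qed.

Lemma opinv_Lop A :
  opinv L A = vec_mx (mxvec A *m invmx (Lop_mx P (invmx P))).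
Proof.
apply: (opinvP Lop_inj); apply: (can_inj mxvecK); rewrite -mxvec_Lop vec_mxK.
by rewrite mulmxKV // Lop_mx_unit.
Qed.

Lemma opinv_LopK X : opinv L (L X) = X.
Proof. exact: (opinvP Lop_inj). Qed.

Lemma Lop_bij : bijective L.
Proof. exists (opinv L); [exact: opinv_LopK|exact: Lop_surj]. Qed.

Lemma Lop_ctr X : (L X)^H = L X^H.
Proof.
rewrite /Lop ctrmxD !ctrmxZr ctrmxD !ctrmxM (posdef_inv_herm pP) (posdef_herm pP).
by rewrite !mulmxA; congr (_ + _ *: _); rewrite addrC.
Qed.

Lemma opinv_Lop_herm A : A^H = A -> (opinv L A)^H = opinv L A.
Proof. by move=> hA; apply: Lop_inj; rewrite -Lop_ctr Lop_surj. Qed.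

(** In the eigenbasis P and P^-1 are diagonal, so L(P) multiplies the (i, j) entry by a scalar and
    inverting it is an entrywise division. *)
Lemma opinv_Lop_eig (U : 'M[K]_p) (Lam : 'rV[K]_p) :
  unitary U -> P = U *m diag_mx Lam *m U^H ->
  forall A : 'M[K]_p,
    opinv L A =
    U *m (\matrix_(i, j)
       ((U^H *m A *m U) i j
        / (alpha1%:K + beta%:K * ((Lam ord0 i)^-1 * Lam ord0 j
                                   + Lam ord0 i * (Lam ord0 j)^-1 - 2%:R))))
      *m U^H.
Proof.
move=> uU PE A; have {}uU : U^H *m U = 1%:M by [].
have uU' : U *m U^H = 1%:M by rewrite mulmx1C.
have DE : diag_mx Lam = U^H *m P *m U.
  by rewrite PE !mulmxA uU mul1mx -mulmxA uU mulmx1.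
(* The i-th eigenvalue is the value of the form of [P] at the i-th column of [U]. *)
have Lam_gt0 i : 0 < Lam ord0 i.
  have dH : (delta_mx i 0 : 'cV[K]_p)^H = delta_mx 0 i.
    by apply/matrixP => a b; rewrite !mxE rmorph_nat andbC.
  have := (pP).2 (U *m delta_mx i 0).
  rewrite ctrmxM -!mulmxA (mulmxA P) (mulmxA U^H) (mulmxA U^H P) -DE.
  rewrite dH mulmxA -rowE -(colE _ (row _ _)) !mxE eqxx mulr1n; apply.
  apply/eqP => /(congr1 (mulmx U^H)); rewrite mulmxA uU mul1mx mulmx0.
  by move/matrixP/(_ i 0); rewrite !mxE !eqxx => /eqP; rewrite oner_eq0.
have Lam0 i : Lam ord0 i != 0 by rewrite gt_eqF.
pose Lami := \row_i (Lam ord0 i)^-1.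
have DDi : diag_mx Lam *m diag_mx Lami = 1%:M.
  rewrite mulmx_diag -diag_const_mx; congr diag_mx; apply/rowP => i.
  by rewrite !mxE divff.
have PiE : invmx P = U *m diag_mx Lami *m U^H.
  apply: (can_inj (mulKmx (posdef_unit pP))); rewrite mulmxV ?posdef_unit //.
  rewrite PE !mulmxA -(mulmxA _ U^H U) uU mulmx1 -(mulmxA U) DDi mulmx1.
  by rewrite uU'.
apply: (opinvP Lop_inj); set X := (\matrix_(i, j) _).
have PXPi (a b : 'rV[K]_p) : U *m diag_mx a *m U^H *m (U *m X *m U^H) *m
    (U *m diag_mx b *m U^H) = U *m (diag_mx a *m X *m diag_mx b) *m U^H.
  by rewrite !mulmxA -2!(mulmxA _ U^H U) uU !mulmx1.
rewrite /Lop PiE PE !PXPi.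
have UXU (a b c : 'M[K]_p) (x y : K) : x *: (U *m a *m U^H) +
    y *: (U *m b *m U^H + U *m c *m U^H) = U *m (x *: a + y *: (b + c)) *m U^H.
  mxnorm; mxring.
rewrite UXU.
have -> : (alpha1 - 2 * beta)%:K *: X + beta%:K *: (diag_mx Lam *m X *m diag_mx Lami
   + diag_mx Lami *m X *m diag_mx Lam) = U^H *m A *m U.
  apply/matrixP => i j; rewrite mxDE !mxZE mxDE.
  have dXd (a b : 'rV[K]_p) : (diag_mx a *m X *m diag_mx b) i j =
      a ord0 i * X i j * b ord0 j.
    by rewrite mul_mx_diag mxE mul_diag_mx mxE.
  rewrite !dXd.
  have -> : (alpha1 - 2 * beta)%:K = alpha1%:K - 2 * beta%:K :> K.
    by rewrite raddfB /= rmorphM /= rmorph_nat.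
  have -> : Lami ord0 i = (Lam ord0 i)^-1 by rewrite mxE.
  have -> : Lami ord0 j = (Lam ord0 j)^-1 by rewrite mxE.
  have -> : X i j = (U^H *m A *m U) i j / (alpha1%:K + beta%:K * ((Lam ord0 i)^-1 * Lam ord0 j
                                   + Lam ord0 i * (Lam ord0 j)^-1 - 2%:R)).
    by rewrite mxE.
  apply: eig_divisor_identity; first by rewrite inK_gt0.
  - by rewrite inK_ge0 ltW.
  - exact: Lam_gt0.
  - exact: Lam_gt0.
by rewrite !mulmxA uU' mul1mx -mulmxA uU' mulmx1.
Qed.

End LopTheory.

(** * Bounded linear and bilinear maps *)

Section BoundedMaps.
Context {R : realType}.
Implicit Types U V W : normedModType R.

(** A plain predicate with an explicit bound, so that maps linear only over R, such as the conjugate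
    transpose, are covered as well. *)
Definition bdd_linear U W (f : U -> W) : Prop :=
  [/\ forall u v, f (u + v) = f u + f v, forall a u, f (a *: u) = a *: f u &
      exists2 C, 0 <= C & forall u, `|f u| <= C * `|u| ].

Definition bdd_bilinear U V W (B : U -> V -> W) : Prop :=
  [/\ forall u u' v, B (u + u') v = B u v + B u' v,
      forall u v v', B u (v + v') = B u v + B u v',
      forall a u v, B (a *: u) v = a *: B u v,
      forall a u v, B u (a *: v) = a *: B u v &
      exists2 C, 0 <= C & forall u v, `|B u v| <= C * `|u| * `|v| ].

Section Linear.
Variables (U W : normedModType R) (f : U -> W).
Hypothesis hf : bdd_linear f.

Lemma bdd_linearB u v : f (u - v) = f u - f v.
Proof. by case: hf => fD fZ _; rewrite fD -(scaleN1r v) fZ scaleN1r. Qed.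

Lemma bdd_linear_cvg T (F : set_system T) {FF : Filter F} (u : T -> U) a :
  u @ F --> a -> (f \o u) @ F --> f a.
Proof.
case: (hf) => _ _ [C C0 hC] /subr_cvg0/norm_cvg0P ua.
apply/subr_cvg0/norm_cvg0P.
apply: (@squeeze_cvgr _ _ _ _ (cst 0) (fun t => C * `|u t - a|)).
- by apply: nearW => t /=; rewrite normr_ge0 /= -bdd_linearB hC.
- exact: cvg_cst.
- by rewrite -[X in _ --> X](mulr0 C); apply: cvgMl_tmp.
Qed.

End Linear.

Section Bilinear.
Variables (U V W : normedModType R) (B : U -> V -> W).
Hypothesis hB : bdd_bilinear B.

Lemma bdd_bilinearBl u u' v : B (u - u') v = B u v - B u' v.
Proof. by case: hB => BD _ BZ _ _; rewrite BD -(scaleN1r u') BZ scaleN1r. Qed.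

Lemma bdd_bilinearBr u v v' : B u (v - v') = B u v - B u v'.
Proof. by case: hB => _ BD _ BZ _; rewrite BD -(scaleN1r v') BZ scaleN1r. Qed.

Lemma bdd_bilinear_cvg T (F : set_system T) {FF : Filter F}
    (u : T -> U) (v : T -> V) a b :
  u @ F --> a -> v @ F --> b -> (fun t => B (u t) (v t)) @ F --> B a b.
Proof.
case: (hB) => _ _ _ _ [C C0 hC] ua vb.
have ua0 := ua; have vb0 := vb.
move/subr_cvg0/norm_cvg0P : ua0 => ua0; move/subr_cvg0/norm_cvg0P : vb0 => vb0.
apply/subr_cvg0/norm_cvg0P.
apply: (@squeeze_cvgr _ _ _ _ (cst 0)
  (fun t => C * `|u t - a| * `|v t| + C * `|a| * `|v t - b|)).
- apply: nearW => t /=; rewrite normr_ge0 /=.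
  have -> : B (u t) (v t) - B a b = B (u t - a) (v t) + B a (v t - b).
    by rewrite bdd_bilinearBl bdd_bilinearBr addrA subrK.
  by rewrite (le_trans (ler_normD _ _)) // lerD // hC.
- exact: cvg_cst.
- have -> : 0 = C * 0 * `|b| + C * `|a| * 0 by rewrite !mulr0 mul0r addr0.
  apply: cvgD; last exact: cvgMl_tmp.
  by apply: cvgM; [exact: cvgMl_tmp|exact: cvg_norm].
Qed.

End Bilinear.
End BoundedMaps.

Section DeriveRules.
Context {R : realType}.
Implicit Types V : normedModType R.

Lemma is_deriveP V (W : normedModType R) (f : V -> W) x v df :
  is_derive x v f df <->
  (fun h : R => h^-1 *: (f (h *: v + x) - f x)) @ 0^' --> df.
Proof.
split=> [[fd <-] //|fd].
by apply: DeriveDef; [apply/cvg_ex; exists df|exact: cvg_lim].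
Qed.

(** The increment is h times the difference quotient, hence tends to 0. This continuity along the
    line is what the product rule consumes. *)
Lemma derive_line_cvg V (W : normedModType R) (f : V -> W) x v df :
  is_derive x v f df -> (fun h : R => f (h *: v + x)) @ 0^' --> f x.
Proof.
move=> /is_deriveP fd; apply/subr_cvg0.
have h0 : (fun h : R => h) @ 0^' --> (0 : R) by move=> A; exact: cvg_within.
have := cvgZ h0 fd; rewrite scale0r => /(_ _) c0; apply: (cvg_trans _ c0); apply: near_eq_cvg.
near=> h; rewrite /= scalerA divff ?scale1r //.
by near: h; exact: nbhs_dnbhs_neq.
Unshelve. all: by end_near. Qed.

Lemma is_derive_bdd_linear V (U W : normedModType R) (f : U -> W) (F : V -> U) x v dF :
  bdd_linear f -> is_derive x v F dF -> is_derive x v (f \o F) (f dF).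
Proof.
move=> hf /is_deriveP hF; apply/is_deriveP.
apply: (cvg_trans _ (bdd_linear_cvg hf hF)); apply: near_eq_cvg.
apply: nearW => h /=; case: (hf) => _ fZ _.
by rewrite fZ (bdd_linearB hf).
Qed.

Lemma is_derive_bdd_bilinear V (U1 U2 W : normedModType R) (B : U1 -> U2 -> W)
    (F : V -> U1) (G : V -> U2) x v dF dG :
  bdd_bilinear B -> is_derive x v F dF -> is_derive x v G dG ->
  is_derive x v (fun y => B (F y) (G y)) (B dF (G x) + B (F x) dG).
Proof.
move=> hB hF hG; have cG := derive_line_cvg hG.
move/is_deriveP: hF => hF; move/is_deriveP: hG => hG; apply/is_deriveP.
have /(_ _) c1 := bdd_bilinear_cvg hB hF cG.
have /(_ _ _) c2 := bdd_bilinear_cvg hB (cvg_cst (F x)) hG.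
have /(_ _) c12 := cvgD c1 c2.
apply: (cvg_trans _ c12); apply: near_eq_cvg.
apply: nearW => h /=; case: (hB) => BDl BDr BZl BZr _.
rewrite [X in X = _]/GRing.add /= BZl BZr -scalerDr (bdd_bilinearBl hB) (bdd_bilinearBr hB).
by rewrite addrA subrK.
Qed.

End DeriveRules.

Lemma near_dist_lt (R : realType) (V : normedModType R) (A : V) (e : R) :
  0 < e -> \forall X \near A, `|A - X| < e.
Proof. by move=> e0; have := nbhsx_ballx A e e0; rewrite -ball_normE. Qed.

(** * The norm of K-matrices, boundedness of matrix operations, continuity of inversion *)

Section RmxNorm.
Context {R : realType} {k : scalars}.
Local Notation K := (scal R k).
Local Notation rM m n := (rmx R k m n).

Lemma rmx_normE m n (A : rM m n) : `|A| = Num.sqrt (ip (A : 'M[K]_(m, n)) A).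
Proof. by []. Qed.

Lemma rmx_norm2 m n (A : rM m n) : `|A| ^+ 2 = ip (A : 'M[K]_(m, n)) A.
Proof. by rewrite rmx_normE sqr_sqrtr ?ip_ge0. Qed.

Lemma ip_le_norm m n (A B : rM m n) : `|ip (A : 'M[K]_(m, n)) B| <= `|A| * `|B|.
Proof. by rewrite !rmx_normE -sqrtrM ?ip_ge0 // -sqrtr_sqr ler_wsqrtr // ip_CS. Qed.

(** The modulus as an element of R; the norm that K carries as a number field takes its values in
    K. *)
Definition absK (x : K) : R := Num.sqrt (reK (x * conjK x)).

Lemma rmx_normZ m n (x : K) (A : 'M[K]_(m, n)) :
  `|(x *: A : rM m n)| = absK x * `|(A : rM m n)|.
Proof.
rewrite !rmx_normE /absK -sqrtrM ?reK_ge0 //; congr Num.sqrt.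
by rewrite {1}/ip ctrmxZ -scalemxAl -scalemxAr scalerA mul_conjK trRZ reK_in.
Qed.

Lemma absK_entry m n (A : rM m n) i j : absK (A i j) <= `|A|.
Proof.
rewrite rmx_normE ler_wsqrtr // ipE (bigD1 i) //= (bigD1 j) //=.
rewrite -addrA lerDl addr_ge0 //; first by apply: sumr_ge0 => ? _; exact: reK_ge0.
by apply: sumr_ge0 => ? _; apply: sumr_ge0 => ? _; exact: reK_ge0.
Qed.

Lemma absK_ge0 x : 0 <= absK x. Proof. exact: sqrtr_ge0. Qed.

(** Expand [A] in the matrix units: each entry is at most the norm of [A] in modulus, so the norms
    of the images of the units add up to a bound. *)
Lemma Klinear_bdd m n q r (f : 'M[K]_(m, n) -> 'M[K]_(q, r)) :
  (forall A B, f (A + B) = f A + f B) -> (forall a A, f (a *: A) = a *: f A) ->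
  bdd_linear (f : rM m n -> rM q r).
Proof.
move=> fD fZ; split=> [u v|a u|]; [exact: fD|exact: fZ|].
have f0 : f 0 = 0 by rewrite -(scale0r 0) fZ scale0r.
exists (\sum_i \sum_j `|(f (delta_mx i j) : rM q r)|).
  by do 2!apply: sumr_ge0 => ? _.
move=> A; rewrite [A in f A]matrix_sum_delta (big_morph f fD f0).
apply: le_trans (ler_norm_sum _ _ _) _; rewrite mulr_suml ler_sum // => i _.
rewrite (big_morph f fD f0).
apply: le_trans (ler_norm_sum _ _ _) _; rewrite mulr_suml ler_sum // => j _.
by rewrite fZ rmx_normZ mulrC ler_wpM2l // absK_entry.
Qed.

(** Expand the first argument in matrix units and bound each partial map B(delta_ij, .) by the
    linear case. *)
Lemma Kbilinear_bdd m n q r s t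
    (B : 'M[K]_(m, n) -> 'M[K]_(q, r) -> 'M[K]_(s, t)) :
  (forall A A' C, B (A + A') C = B A C + B A' C) ->
  (forall A C C', B A (C + C') = B A C + B A C') ->
  (forall a A C, B (a *: A) C = a *: B A C) ->
  (forall a A C, B A (a *: C) = a *: B A C) ->
  bdd_bilinear (B : rM m n -> rM q r -> rM s t).
Proof.
move=> BDl BDr BZl BZr; split=> [u u' v|u v v'|a u v|a u v|];
  [exact: BDl|exact: BDr|exact: BZl|exact: BZr|].
have h i j := Klinear_bdd (BDr (delta_mx i j)) (BZr^~ (delta_mx i j)).
have {h}/choice[c hc] : forall ij : 'I_m * 'I_n, exists c, 0 <= c /\
    forall C : rM q r, `|(B (delta_mx ij.1 ij.2) C : rM s t)| <= c * `|C|.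
  by move=> [i j]; have [_ _ [c c0 hc]] := h i j; exists c.
exists (\sum_i \sum_j c (i, j)).
  by apply: sumr_ge0 => i _; apply: sumr_ge0 => j _; case: (hc (i, j)).
move=> A C; have B0 : B 0 C = 0 by rewrite -(scale0r 0) BZl scale0r.
rewrite [A in B A]matrix_sum_delta (big_morph (B^~ C) (fun a b => BDl a b C) B0).
apply: le_trans (ler_norm_sum _ _ _) _; rewrite !mulr_suml ler_sum // => i _.
rewrite (big_morph (B^~ C) (fun a b => BDl a b C) B0).
apply: le_trans (ler_norm_sum _ _ _) _; rewrite !mulr_suml ler_sum // => j _.
have [c0 cC] := hc (i, j).
rewrite BZl rmx_normZ -mulrA mulrCA ler_pM ?absK_ge0 ?absK_entry //.
Qed.

Lemma mulmx_bdd m n q :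
  bdd_bilinear (mulmx : rM m n -> rM n q -> rM m q).
Proof.
apply: (@Kbilinear_bdd _ _ _ _ _ _ mulmx) => *.
- exact: mulmxDl.
- exact: mulmxDr.
- by rewrite scalemxAl.
- by rewrite scalemxAr.
Qed.

Lemma ctrmx_bdd m n : bdd_linear (@ctrmx R k m n : rM m n -> rM n m).
Proof.
split=> [u v|a u|]; [exact: ctrmxD|exact: ctrmxZr|].
by exists 1 => // u; rewrite mul1r !rmx_normE ip_ctr.
Qed.

Lemma ip_bdd m n : bdd_bilinear (@ip R k m n : rM m n -> rM m n -> R).
Proof.
split=> [u u' v|u v v'|a u v|a u v|];
  [exact: ipDl|exact: ipDr|exact: ipZl|exact: ipZr|].
by exists 1 => // u v; rewrite mul1r ip_le_norm.
Qed.

(** If v X = 0 then v = v (A - X) A^-1, hence |v| <= c |A - X| |v|, which forces v = 0 as soon as c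
    |A - X| < 1. The radius 1 / (c + 1) is meaningful also for c = 0. *)
Lemma unitmx_near p (A : rM p p) : (A : 'M[K]_p) \in unitmx ->
  \forall X \near A, (X : 'M[K]_p) \in unitmx.
Proof.
move=> uA; have [_ _ _ _ [C1 C10 h1]] := mulmx_bdd 1 p p.
have [_ _ _ _ [C2 C20 h2]] := mulmx_bdd p p p.
pose c := C1 * C2 * `|(invmx A : rM p p)|.
have c0 : 0 <= c by rewrite !mulr_ge0.
have e0 : 0 < (c + 1)^-1 by rewrite invr_gt0 ltr_wpDl.
near=> X; rewrite -row_free_unit; apply: inj_row_free => v vX.
have AX : `|A - X| < (c + 1)^-1 by near: X; exact: near_dist_lt.
have vE : v = v *m ((A - X) *m invmx A).
  by rewrite mulmxA mulmxDr mulmxN vX subr0 mulmxK.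
have vle : `|(v : rM 1 p)| <= c * `|A - X| * `|(v : rM 1 p)|.
  rewrite {1}vE (le_trans (h1 _ _)) // mulrAC ler_wpM2r //.
  by rewrite /c -!mulrA ler_wpM2l // [X in _ * X]mulrC mulrA h2.
have t1 : c * `|A - X| < 1.
  apply: (@le_lt_trans _ _ ((c + 1) * `|A - X|)).
    by rewrite ler_wpM2r // lerDl.
  by rewrite -ltr_pdivlMl ?mulr1 // ltr_wpDl.
apply/eqP; apply: contraTT vle => v0.
by rewrite -ltNge gtr_pMl // normr_gt0.
Unshelve. all: by end_near. Qed.

(* Typing the inverse in the real normed space [rmx] fixes the canonical
   structures of the limits and derivatives below. *)
Definition rinv p (A : rM p p) : rM p p := invmx A.

(** For Z = X^-1 - A^-1 = X^-1 (A - X) A^-1 one gets |Z| <= c |A - X| (|Z| + |A^-1|). Once c |A - X|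
    <= 1/2 the term in |Z| is absorbed on the left, which leaves a bound linear in |A - X|. *)
Lemma rinv_cvg p T (F : set_system T) {FF : Filter F} (u : T -> rM p p) (A : rM p p) :
  (A : 'M[K]_p) \in unitmx -> u @ F --> A -> (@rinv p \o u) @ F --> rinv A.
Proof.
move=> uA uFA; have [_ _ _ _ [C C0 hC]] := mulmx_bdd p p p.
pose a := `|rinv A|; pose c := C * C * a.
have a0 : 0 <= a by exact: normr_ge0.
have c0 : 0 <= c by rewrite !mulr_ge0.
have e0 : 0 < (2 * (c + 1))^-1 by rewrite invr_gt0 mulr_gt0 // ltr_wpDl.
apply/subr_cvg0/norm_cvg0P.
apply: (@squeeze_cvgr _ _ _ _ (cst 0) (fun t => 2 * c * a * `|u t - A|)).
- near=> t; rewrite /= normr_ge0 /=.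
  have uX : (u t : 'M[K]_p) \in unitmx.
    by near: t; exact: uFA (unitmx_near uA).
  have AX : `|A - u t| < (2 * (c + 1))^-1 by near: t; exact: cvgr_dist_lt.
  move: (u t) uX AX => X uX AX.
  pose Z := rinv X - rinv A.
  have ZE : Z = invmx X *m ((A - X) *m invmx A).
    by rewrite mulmxA mulmxDr mulmxN mulVmx // mulmxDl mulNmx mul1mx mulmxK.
  have Zle : `|Z| <= c * `|A - X| * (`|Z| + a).
    have hW : `|((A - X) *m invmx A : rM p p)| <= C * `|A - X| * a by exact: hC.
    have hX : `|rinv X| <= `|Z| + a by rewrite -[rinv X](subrK (rinv A)) ler_normD.
    rewrite {1}ZE; apply: le_trans (hC _ _) _.
    rewrite [leRHS](_ : _ = C * (`|Z| + a) * (C * `|A - X| * a)); last by rewrite /c; ring.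
    by apply: ler_pM => //; [rewrite mulr_ge0|rewrite ler_wpM2l].
  have t1 : c * `|A - X| <= 2^-1.
    apply: (@le_trans _ _ ((c + 1) * `|A - X|)).
      by rewrite ler_wpM2r // lerDl.
    by rewrite -ler_pdivlMl ?ltr_wpDl // -invfM mulrC ltW.
  have : `|Z| <= 2^-1 * `|Z| + c * `|A - X| * a.
    by rewrite (le_trans Zle) // mulrDr lerD2r ler_wpM2r.
  rewrite -/Z (distrC X A); move: (`|Z|) (`|A - X|) => z x; nra.
- exact: cvg_cst.
- have -> : 0 = 2 * c * a * 0 by rewrite mulr0.
  apply: cvgMl_tmp.
  by apply/norm_cvg0P/subr_cvg0.
Unshelve. all: by end_near. Qed.

End RmxNorm.

Section TypedOps.
Context {R : realType} {k : scalars}.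
Local Notation K := (scal R k).
Local Notation rM m n := (rmx R k m n).

Definition rmul m n q (A : rM m n) (B : rM n q) : rM m q := A *m B.
Definition rctr m n (A : rM m n) : rM n m := A^H.
Definition rip m n (A B : rM m n) : R := ip (A : 'M[K]_(m, n)) B.

Lemma rmul_bdd m n q : bdd_bilinear (@rmul m n q).
Proof. exact: mulmx_bdd. Qed.

Lemma rctr_bdd m n : bdd_linear (@rctr m n).
Proof. exact: ctrmx_bdd. Qed.

Lemma rip_bdd m n : bdd_bilinear (@rip m n).
Proof. exact: ip_bdd. Qed.

(** The identity X^-1 - A^-1 = - X^-1 (X - A) A^-1 turns the difference quotient of the inverse into
    a product containing that of [F]; the moving factor X^-1 converges by [rinv_cvg]. *)
Lemma is_derive_rinv (V : normedModType R) p (F : V -> rM p p) x v dF :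
  (F x : 'M[K]_p) \in unitmx -> is_derive x v F dF ->
  is_derive x v (@rinv R k p \o F) (- rmul (rmul (rinv (F x)) dF) (rinv (F x))).
Proof.
move=> uF hF; have cF := derive_line_cvg hF.
have /(_ _) cI := rinv_cvg uF cF.
move/is_deriveP: hF => hF; apply/is_deriveP.
have /(_ _) c1 := bdd_bilinear_cvg (@rmul_bdd _ _ _) cI hF.
have /(_ _ _) c2 := bdd_bilinear_cvg (@rmul_bdd _ _ _) c1 (cvg_cst (rinv (F x))).
apply: (cvg_trans _ (cvgN c2)); apply: near_eq_cvg.
have nu : \forall h \near 0^', (F (h *: v + x) : 'M[K]_p) \in unitmx.
  exact: cF (unitmx_near uF).
near=> h; have uh : (F (h *: v + x) : 'M[K]_p) \in unitmx by near: h.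
rewrite [LHS]/GRing.opp /=.
move: (F _) (F x) uF uh => A B uB uA.
case: (@rmul_bdd p p p) => _ _ mZl mZr _.
rewrite mZr mZl -scalerN; congr (_ *: _).
have -> : rmul (rmul (rinv A) (A - B)) (rinv B) = (rinv B - rinv A).
  rewrite /rmul /rinv.
  by rewrite mulmxDr mulmxN mulVmx // mulmxDl mulNmx mul1mx mulmxK.
by rewrite opprB.
Unshelve. all: by end_near. Qed.

End TypedOps.

(** * Smooth maps *)

Section CkTheory.
Context {R : realType} {V : normedModType R}.
Implicit Types (W : normedModType R) (U : set V).

Lemma Ck_ext W j U (F G : V -> W) : open U -> (forall x, U x -> F x = G x) ->
  Ck j U F -> Ck j U G.
Proof.
move=> oU; elim: j F G => [|j IH] F G FG [cF dF]; split.
- move=> x Ux; rewrite /prop_for /continuous_at -(FG _ Ux); apply: (cvg_trans _ (cF x Ux)).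
  apply: near_eq_cvg; near=> y; apply: FG; near: y; exact: open_nbhs_nbhs.
- by [].
- move=> x Ux; rewrite /prop_for /continuous_at -(FG _ Ux); apply: (cvg_trans _ (cF x Ux)).
  apply: near_eq_cvg; near=> y; apply: FG; near: y; exact: open_nbhs_nbhs.
- move=> v; have [dv cv] := dF v.
  have FGn x : U x -> {near x, F =1 G}.
    by move=> Ux; near=> y; apply: FG; near: y; exact: open_nbhs_nbhs.
  split=> [x Ux|]; first exact: near_eq_derivable (FGn x Ux) (dv x Ux).
  by apply: IH cv => x Ux; exact: near_eq_derive (FGn x Ux).
Unshelve. all: by end_near. Qed.

Lemma Ck_sub W j U U' (F : V -> W) : U' `<=` U -> Ck j U F -> Ck j U' F.
Proof.
move=> sU; elim: j F => [|j IH] F [cF dF]; split=> //; try by move=> x /sU; exact: cF.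
by move=> v; have [dv cv] := dF v; split=> [x /sU|]; [exact: dv|exact: IH].
Qed.

Lemma CkS W j U (F : V -> W) : Ck j.+1 U F -> Ck j U F.
Proof.
elim: j F => [|j IH] F [cF dF]; split=> // v; have [dv cv] := dF v.
by split=> //; exact: IH.
Qed.

Lemma Ck_cst W j U (a : W) : Ck j U (cst a : V -> W).
Proof.
elim: j a => [|j IH] a; split=> //; try by move=> x _; exact: cvg_cst.
move=> v; split=> [x _|]; first exact: derivable_cst.
by rewrite (_ : 'D_v _ = cst 0) //; apply/funext => x; rewrite derive_cst.
Qed.

Lemma CkD W j U (F G : V -> W) : open U -> Ck j U F -> Ck j U G ->
  Ck j U (fun x => F x + G x).
Proof.
move=> oU; elim: j F G => [|j IH] F G [cF dF] [cG dG]; split=> //.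
- by move=> x Ux; apply: cvgD; [exact: cF|exact: cG].
- by move=> x Ux; apply: cvgD; [exact: cF|exact: cG].
- move=> v; have [dv cv] := dF v; have [dv' cv'] := dG v; split=> [x Ux|].
    by apply: derivableD; [exact: dv|exact: dv'].
  apply: (Ck_ext oU _ (IH _ _ cv cv')) => x Ux /=.
  by rewrite -deriveD //; [exact: dv|exact: dv'].
Qed.

Lemma Ck_bdd_linear W W' j U (f : W -> W') (F : V -> W) : open U ->
  bdd_linear f -> Ck j U F -> Ck j U (f \o F).
Proof.
move=> oU hf; elim: j F => [|j IH] F [cF dF]; split=> //.
- by move=> x Ux; apply: bdd_linear_cvg => //; exact: cF.
- by move=> x Ux; apply: bdd_linear_cvg => //; exact: cF.
- move=> v; have [dv cv] := dF v.
  have D x : U x -> is_derive x v (f \o F) (f ('D_v F x)).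
    by move=> Ux; apply: is_derive_bdd_linear => //; apply: derivableP; exact: dv.
  split=> [x /D[] //|]; apply: (Ck_ext oU _ (IH _ cv)); by move=> x /D[_ ->].
Qed.

Lemma Ck_bdd_bilinear W1 W2 W j U (B : W1 -> W2 -> W) (F : V -> W1) (G : V -> W2) :
  open U -> bdd_bilinear B -> Ck j U F -> Ck j U G -> Ck j U (fun x => B (F x) (G x)).
Proof.
move=> oU hB; elim: j F G => [|j IH] F G hF hG; have [cF dF] := hF; have [cG dG] := hG;
  split=> //.
- by move=> x Ux; apply: bdd_bilinear_cvg => //; [exact: cF|exact: cG].
- by move=> x Ux; apply: bdd_bilinear_cvg => //; [exact: cF|exact: cG].
- move=> v; have [dv cv] := dF v; have [dv' cv'] := dG v.
  have D x : U x -> is_derive x v (fun x => B (F x) (G x))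
      (B ('D_v F x) (G x) + B (F x) ('D_v G x)).
    move=> Ux; apply: is_derive_bdd_bilinear => //; apply: derivableP;
      [exact: dv|exact: dv'].
  split=> [x /D[] //|].
  (* Each summand of the derivative keeps one factor undifferentiated; [CkS] lowers it to the order
     of the induction hypothesis. *)
  apply: (Ck_ext oU _ (CkD oU (IH _ _ cv (CkS hG)) (IH _ _ (CkS hF) cv'))).
  by move=> x /D[_ ->].
Qed.

Lemma Ck_id j U : Ck j U (id : V -> V).
Proof.
case: j => [|j]; split=> //; try by move=> x _; exact: cvg_id.
move=> v; split=> [x _|]; first exact: derivable_id.
rewrite (_ : 'D_v _ = cst v); first exact: Ck_cst.
by apply/funext => x; rewrite derive_id.
Qed.

(** The derivative - F^-1 F' F^-1 contains F^-1 again, with one order of differentiability less to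
    prove, so induction on the order closes. *)
Lemma Ck_rinv k p j U (F : V -> rmx R k p p) : open U ->
  (forall x, U x -> (F x : 'M[scal R k]_p) \in unitmx) ->
  Ck j U F -> Ck j U (@rinv R k p \o F).
Proof.
move=> oU uF; elim: j F uF => [|j IH] F uF hF; have [cF dF] := hF; split=> //.
- by move=> x Ux; apply: rinv_cvg; [exact: uF|exact: cF].
- by move=> x Ux; apply: rinv_cvg; [exact: uF|exact: cF].
- move=> v; have [dv cv] := dF v.
  have D x : U x -> is_derive x v (@rinv R k p \o F)
      (- rmul (rmul (rinv (F x)) ('D_v F x)) (rinv (F x))).
    by move=> Ux; apply: is_derive_rinv; [exact: uF|apply: derivableP; exact: dv].
  split=> [x /D[] //|].
  have CI := IH _ uF (CkS hF).
  have hN : bdd_linear (fun A : rmx R k p p => - A).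
    split=> [u u'|a u|]; [exact: opprD|by rewrite scalerN|].
    by exists 1 => // u; rewrite normrN mul1r.
  apply: (Ck_ext oU _ (Ck_bdd_linear oU hN (Ck_bdd_bilinear oU (@rmul_bdd _ _ _ _ _)
    (Ck_bdd_bilinear oU (@rmul_bdd _ _ _ _ _) CI cv) CI))).
  by move=> x /D[_ ->].
Qed.

End CkTheory.

(** * The chain rule along curves *)

Section C1Chain.
Context {R : realType}.
Implicit Types V W : normedModType R.

(** Finite dimension, as a finite spanning family with bounded coordinates. It need not be a basis,
    so that one family (real and imaginary parts of the entries) serves both fields: over the reals
    its imaginary half is zero. *)
Definition has_coords V : Prop :=
  exists (I : finType) (l : I -> V -> R) (e : I -> V),
    (forall i, bdd_linear (l i)) /\ forall h, h = \sum_i l i h *: e i.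

(* Norming functionals reduce the mean value inequality to real-valued maps. *)
Definition normed_by_dual W : Prop := forall w : W,
  exists l : W -> R, [/\ bdd_linear l, forall u, `|l u| <= `|u| & l w = `|w|].

Lemma mean_value_dual W (f df : R -> W) (L : W) (eps : R) : normed_by_dual W ->
  (forall t : R, 0 <= t <= 1 -> is_derive t 1 f (df t)) ->
  (forall t : R, 0 <= t <= 1 -> `|df t - L| <= eps) ->
  `|f 1 - f 0 - L| <= eps.
Proof.
move=> nW hf hL; have [l [hl l1 lw]] := nW (f 1 - f 0 - L).
have D (t : R) : 0 <= t <= 1 -> is_derive t (1 : R) (l \o f) (l (df t)).
  by move=> /hf ht; exact: is_derive_bdd_linear.
have [||c /andP[c0 c1] cE] := @MVT R (l \o f) (l \o df) 0 1 ltr01.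
- move=> t; rewrite in_itv /= => /andP[t0 t1]; apply: D.
  by rewrite !ltW.
- apply: derivable_within_continuous => t; rewrite in_itv /= => tI.
  by have [] := D _ tI.
rewrite -lw !(bdd_linearB hl); move: cE; rewrite /= subr0 mulr1 => ->.
rewrite -(bdd_linearB hl); apply: le_trans (ler_norm _) _.
apply: le_trans (l1 _) _; apply: hL.
by move: c0 c1; rewrite !bnd_simp => /ltW -> /ltW ->.
Qed.

Lemma is_derive_scale_dir V W (f : V -> W) x v d (a : R) :
  is_derive x v f d -> is_derive x (a *: v) f (a *: d).
Proof.
have [->|a0] := eqVneq a 0; first by rewrite !scale0r => _; exact: is_derive0.
move=> /is_deriveP fd; apply/is_deriveP.
have ha : (fun h : R => h * a) @ 0^' --> 0^'.
  move=> A /nbhs_ballP[e /= e0 eA]; apply/nbhs_ballP.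
  exists (e / `|a|); first by rewrite /= divr_gt0 // normr_gt0.
  move=> h; rewrite /ball /= !sub0r !normrN => he h0; apply: eA.
    by rewrite /ball /= sub0r normrN normrM -ltr_pdivlMr ?normr_gt0.
  by rewrite mulf_neq0.
have c1 := cvg_comp _ _ ha fd.
have hZ : bdd_linear (fun w : W => a *: w).
  split=> [u w|b u|]; [exact: scalerDr|by rewrite !scalerA mulrC|].
  by exists `|a| => // u; rewrite normrZ.
have /(_ _) c2 := bdd_linear_cvg hZ c1.
apply: (cvg_trans _ c2); apply: near_eq_cvg; apply: nearW => h /=.
by rewrite !scalerA invfM mulrCA mulfV // mulr1.
Qed.

Lemma is_derive_line V W (G : V -> W) y v (t : R) d :
  is_derive (y + t *: v) v G d -> is_derive t (1 : R) (fun s => G (y + s *: v)) d.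
Proof.
move=> /is_deriveP hG; apply/is_deriveP; apply: (cvg_trans _ hG).
apply: near_eq_cvg; apply: nearW => h /=; congr (_ *: (G _ - _)).
by rewrite [h *: 1]mulr1 scalerDl addrCA.
Qed.

Section Chain.
Variables (V W : normedModType R) (G : V -> W) (x : V).
Variables (I : finType) (l : I -> V -> R) (e : I -> V).
Hypothesis nW : normed_by_dual W.
Hypothesis decomp : forall h, h = \sum_i l i h *: e i.
Variables (del eps : R).
Hypothesis near_x : forall i z, `|z - x| < del ->
  derivable G z (e i) /\ `|'D_(e i) G z - 'D_(e i) G x| <= eps.

(** The mean value inequality on the segment from y to y + a e_i, which stays in the ball around x
    where the partial derivatives are within eps of their values at x. *)
Lemma increment_dir i y (a : R) : `|y - x| + `|a| * `|e i| < del ->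
  `|G (y + a *: e i) - G y - a *: 'D_(e i) G x| <= `|a| * eps.
Proof.
move=> ya; pose f t := G (y + t *: (a *: e i)).
have near_y t : 0 <= t <= 1 -> `|y + t *: (a *: e i) - x| < del.
  move=> /andP[t0 t1]; apply: le_lt_trans ya; rewrite addrAC.
  apply: le_trans (ler_normD _ _) _; rewrite lerD2l !normrZ (ger0_norm t0).
  by rewrite ler_piMl // mulr_ge0.
have := @mean_value_dual W f (fun t => a *: 'D_(e i) G (y + t *: (a *: e i)))
  (a *: 'D_(e i) G x) (`|a| * eps) nW.
rewrite /f scale1r scale0r addr0; apply=> t t01.
  apply: is_derive_line; apply: is_derive_scale_dir; apply: derivableP.
  by have [] := near_x i (near_y _ t01).
rewrite -scalerBr normrZ ler_wpM2l //.
by have [] := near_x i (near_y _ t01).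
Qed.

(** The path moves along the directions [e i] one after the other. The sum of the lengths of all
    steps bounds its distance from y, so every corner stays in the ball and the errors of the steps
    add up. *)
Lemma increment_sum (r : seq I) (h y : V) :
  `|y - x| + \sum_(i <- r) `|l i h| * `|e i| < del ->
  `|G (y + \sum_(i <- r) l i h *: e i) - G y - \sum_(i <- r) l i h *: 'D_(e i) G x|
  <= (\sum_(i <- r) `|l i h|) * eps.
Proof.
elim: r y => [|i r IH] y.
  by move=> _; rewrite !big_nil addr0 subrr subr0 normr0 mul0r.
rewrite !big_cons => hy.
have s0 : 0 <= \sum_(j <- r) `|l j h| * `|e j|.
  by apply: sumr_ge0 => j _; rewrite mulr_ge0.
have h1 : `|y - x| + `|l i h| * `|e i| < del.
  by apply: le_lt_trans hy; rewrite addrA lerDl.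
have h2 : `|y + l i h *: e i - x| + \sum_(j <- r) `|l j h| * `|e j| < del.
  apply: le_lt_trans hy; rewrite addrA lerD2r addrAC.
  by apply: le_trans (ler_normD _ _) _; rewrite normrZ.
have e1 := increment_dir h1; have e2 := IH _ h2.
rewrite mulrDl; apply: le_trans (lerD e1 e2).
apply: le_trans _ (ler_normD _ _).
rewrite le_eqVlt; apply/orP; left; apply/eqP; congr (`| _ |).
by rewrite [RHS]addrACA [X in _ = X + _]addrC subrKA -opprD addrA.
Qed.

Lemma increment_total h : \sum_i `|l i h| * `|e i| < del ->
  `|G (x + h) - G x - \sum_i l i h *: 'D_(e i) G x| <= (\sum_i `|l i h|) * eps.
Proof.
move=> hd; rewrite [h in G (x + h)]decomp; apply: increment_sum.
by rewrite subrr normr0 add0r.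
Qed.

End Chain.

(** Continuous partial derivatives give a total differential, namely the sum of the l_i(xi) D_(e_i)
    G(x). Along a curve the increment is u = c(h) - c(0) = h q(h) with q(h) tending to xi, and
    [increment_total] shows that the remainder at u is o(h). *)
Lemma C1_chain V W (U : set V) (G : V -> W) x :
  has_coords V -> normed_by_dual W -> open U -> U x -> Ck 1 U G ->
  exists dG : V -> W, bdd_linear dG /\
    forall c xi, c 0 = x -> is_derive (0 : R) (1 : R) c xi ->
      is_derive (0 : R) (1 : R) (G \o c) (dG xi).
Proof.
move=> [I [l [e [hl decomp]]]] nW oU Ux [cG dG].
have /choice[C hC] : forall i, exists C, 0 <= C /\ forall u, `|l i u| <= C * `|u|.
  by move=> i; have [_ _ [C C0 hC]] := hl i; exists C.
pose D xi := \sum_i l i xi *: 'D_(e i) G x.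
have bD : bdd_linear D.
  split=> [u v|a u|].
  - rewrite /D -big_split; apply: eq_bigr => i _ /=.
    by have [-> _ _] := hl i; rewrite scalerDl.
  - rewrite /D scaler_sumr; apply: eq_bigr => i _ /=.
    by have [_ -> _] := hl i; rewrite scalerA.
  - exists (\sum_i C i * `|'D_(e i) G x|).
      by apply: sumr_ge0 => i _; rewrite mulr_ge0 // (hC i).1.
    move=> u; apply: le_trans (ler_norm_sum _ _ _) _.
    rewrite mulr_suml ler_sum // => i _; rewrite normrZ mulrAC ler_wpM2r //.
    exact: (hC i).2.
exists D; split=> // c xi c0 hc.
pose q h := h^-1 *: (c (h *: 1 + 0) - c 0) : V.
have hq : q @ 0^' --> xi by move/is_deriveP: hc.
have cc := derive_line_cvg hc.
apply/is_deriveP.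
have /(_ _) hDq := bdd_linear_cvg bD hq.
suff rem : (fun h => h^-1 *: ((G \o c) (h *: 1 + 0) - (G \o c) 0) - D (q h)) @ 0^' --> (0 : W).
  have /(_ _) := cvgD rem hDq; rewrite add0r => s; apply: (cvg_trans _ s); apply: near_eq_cvg.
  by apply: nearW => h /=; rewrite [LHS]/GRing.add /= subrK.
pose Cl := \sum_i C i; pose Ce := \sum_i C i * `|e i|.
have Cl0 : 0 <= Cl by apply: sumr_ge0 => i _; exact: (hC i).1.
have Ce0 : 0 <= Ce by apply: sumr_ge0 => i _; rewrite mulr_ge0 // (hC i).1.
apply/cvgr0Pnorm_le => eps eps0.
(* Near 0 the quotient q(h) has norm at most |xi| + 1, so the error Cl |h q(h)| eps' is at most |h|
   eps. The added 1 keeps the divisor positive. *)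
pose eps' := eps / (Cl * (`|xi| + 1) + 1).
have d0 : 0 < Cl * (`|xi| + 1) + 1 by rewrite ltr_wpDl // mulr_ge0 // addr_ge0.
have eps'0 : 0 < eps' by rewrite divr_gt0.
have : \forall z \near x, forall i, derivable G z (e i) /\ `|'D_(e i) G z - 'D_(e i) G x| <= eps'.
  apply: filter_forall => i; have [di ci] := dG (e i).
  near=> z; have Uz : U z by near: z; exact: open_nbhs_nbhs.
  split; first exact: di.
  rewrite distrC; near: z; apply: cvgr_dist_le => //.
  by case: ci => ci _; exact: ci.
move=> /nbhs_ballP[del /= del0 hdel].
have near_x i z : `|z - x| < del ->
    derivable G z (e i) /\ `|'D_(e i) G z - 'D_(e i) G x| <= eps'.
  by move=> zx; apply: hdel; rewrite -ball_normE /= distrC.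
have e0 : 0 < (Ce + 1)^-1 * del by rewrite mulr_gt0 // invr_gt0 ltr_wpDl.
near=> h.
have h0 : h != 0 by near: h; exact: nbhs_dnbhs_neq.
have cd : `|c 0 - c (h *: 1 + 0)| < (Ce + 1)^-1 * del by near: h; exact: cvgr_dist_lt.
have qd : `|xi - q h| < 1 by near: h; exact: cvgr_dist_lt.
set u := c (h *: 1 + 0) - c 0.
have uq : u = h *: q h by rewrite /q scalerA divff // scale1r.
have sl : \sum_i `|l i u| <= Cl * `|u|.
  by rewrite /Cl mulr_suml ler_sum // => i _; exact: (hC i).2.
have se : \sum_i `|l i u| * `|e i| < del.
  apply: (@le_lt_trans _ _ (Ce * `|u|)).
    rewrite /Ce mulr_suml ler_sum // => i _; rewrite mulrAC ler_wpM2r //.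
    exact: (hC i).2.
  apply: (@le_lt_trans _ _ ((Ce + 1) * `|u|)); first by rewrite ler_wpM2r // lerDl.
  by rewrite -ltr_pdivlMl ?ltr_wpDl // /u distrC.
have xu : x + u = c (h *: 1 + 0) by rewrite /u c0 addrC subrK.
have := increment_total nW decomp near_x se.
rewrite -/(D u) xu -c0 => inc.
have -> : h^-1 *: ((G \o c) (h *: 1 + 0) - (G \o c) 0) - D (q h) =
    h^-1 *: (G (c (h *: 1 + 0)) - G (c 0) - D u).
  by rewrite [in RHS]scalerBr; congr (_ - _); case: bD => _ <- _; congr D.
rewrite normrZ normfV ler_pdivrMl ?normr_gt0 //; apply: le_trans inc _.
apply: (@le_trans _ _ (Cl * `|u| * eps')); first by rewrite ler_wpM2r // ltW.
rewrite uq normrZ [leLHS](_ : _ = `|h| * (Cl * `|q h| * eps')); last by ring.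
rewrite ler_wpM2l //.
have qx : `|q h| <= `|xi| + 1.
  rewrite -[q h](subrK xi) addrC (le_trans (ler_normD _ _)) // lerD2l distrC ltW //.
rewrite /eps' mulrA ler_pdivrMr // [leRHS]mulrC ler_wpM2r ?ltW //.
apply: (@le_lt_trans _ _ (Cl * (`|xi| + 1))); first by rewrite ler_wpM2l.
by rewrite ltrDl.
Unshelve. all: by end_near. Qed.
End C1Chain.

Section Coordinates.
Context {R : realType}.

Lemma bdd_linear_comp (U V W : normedModType R) (f : U -> V) (g : V -> W) :
  bdd_linear f -> bdd_linear g -> bdd_linear (g \o f).
Proof.
move=> [fD fZ [C C0 hC]] [gD gZ [C' C'0 hC']]; split=> [u v|a u|] /=.
- by rewrite fD gD.
- by rewrite fZ gZ.
- exists (C' * C) => [|u]; first by rewrite mulr_ge0.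
  by rewrite (le_trans (hC' _)) // -mulrA ler_wpM2l.
Qed.

Lemma fst_bdd (U V : normedModType R) : bdd_linear (fst : (U * V)%type -> U).
Proof.
by split=> //; exists 1 => // u; rewrite mul1r prod_normE /= le_max lexx.
Qed.

Lemma snd_bdd (U V : normedModType R) : bdd_linear (snd : (U * V)%type -> V).
Proof.
by split=> //; exists 1 => // u; rewrite mul1r prod_normE /= le_max lexx orbT.
Qed.

Lemma inl_bdd (U V : normedModType R) : bdd_linear (fun u : U => (u, 0) : (U * V)%type).
Proof.
split=> [u v|a u|].
- by congr pair; rewrite /= ?addr0.
- by congr pair; rewrite /= ?scaler0.
- by exists 1 => // u; rewrite mul1r prod_normE /= normr0 ge_max lexx normr_ge0.
Qed.

Lemma inr_bdd (U V : normedModType R) : bdd_linear (fun v : V => (0, v) : (U * V)%type).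
Proof.
split=> [u v|a u|].
- by congr pair; rewrite /= ?addr0.
- by congr pair; rewrite /= ?scaler0.
- by exists 1 => // u; rewrite mul1r prod_normE /= normr0 ge_max lexx normr_ge0.
Qed.

Lemma has_coords_prod (U V : normedModType R) :
  has_coords U -> has_coords V -> has_coords (U * V)%type.
Proof.
move=> [I [l [e [hl el]]]] [J [l' [e' [hl' el']]]].
exists (I + J)%type, (fun ij => match ij with inl i => l i \o fst | inr j => l' j \o snd end),
  (fun ij => match ij with inl i => (e i, 0) | inr j => (0, e' j) end); split.
  by case=> i; apply: bdd_linear_comp => //; [exact: fst_bdd|exact: snd_bdd].
move=> [u v]; rewrite big_sumType /=.
have e1 : \sum_i l i u *: ((e i, 0) : (U * V)%type) = (u, 0).
  rewrite {2}[u]el; have [_ _ _] := inl_bdd U V.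
  rewrite (big_morph (fun u : U => (u, 0) : (U * V)%type) (id1 := 0) (op1 := +%R)) //.
    apply: eq_bigr => i _; by have [_ -> _] := inl_bdd U V.
  by have [] := inl_bdd U V.
have e2 : \sum_i l' i v *: ((0, e' i) : (U * V)%type) = (0, v).
  rewrite {2}[v]el'.
  rewrite (big_morph (fun u : V => (0, u) : (U * V)%type) (id1 := 0) (op1 := +%R)) //.
    apply: eq_bigr => i _; by have [_ -> _] := inr_bdd U V.
  by have [] := inr_bdd U V.
by rewrite e1 e2; congr pair; rewrite /= ?addr0 ?add0r.
Qed.

Lemma normed_by_dual_real : normed_by_dual R.
Proof.
move=> w; exists (fun u => Num.sg w * u); split.
- split=> [u v|a u|]; [exact: mulrDr|by rewrite /= mulrCA|].
  exists 1 => // u; rewrite mul1r normrM normr_sg.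
  by case: (w != 0); rewrite ?mul1r // mul0r.
- by move=> u; rewrite normrM normr_sg; case: (w != 0); rewrite ?mul1r // mul0r.
- by rewrite normrEsg.
Qed.

(** The product carries the maximum norm, so a norming functional of the larger component does. *)
Lemma normed_by_dual_prod (U V : normedModType R) :
  normed_by_dual U -> normed_by_dual V -> normed_by_dual (U * V)%type.
Proof.
move=> nU nV [u v].
have [uv|vu] := leP `|u| `|v|.
  have [l [hl l1 lv]] := nV v; exists (l \o snd); split=> //.
  - by apply: bdd_linear_comp => //; exact: snd_bdd.
  - by move=> w; rewrite (le_trans (l1 _)) // prod_normE /= le_max lexx orbT.
  - by rewrite /= lv prod_normE /=; apply/esym/max_idPr.
have [l [hl l1 lv]] := nU u; exists (l \o fst); split=> //.
- by apply: bdd_linear_comp => //; exact: fst_bdd.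
- by move=> w; rewrite (le_trans (l1 _)) // prod_normE /= le_max lexx.
- by rewrite /= lv prod_normE /=; apply/esym/max_idPl/ltW.
Qed.

Context {k : scalars}.
Local Notation K := (scal R k).
Local Notation rM m n := (rmx R k m n).

Lemma normed_by_dual_rmx m n : normed_by_dual (rM m n).
Proof.
move=> w; have [->|w0] := eqVneq w 0.
  exists (fun=> 0); split=> [|u|]; rewrite ?normr0 //.
  split=> [u v|a u|]; [by rewrite addr0|by rewrite scaler0|].
  by exists 0 => // u; rewrite normr0 mul0r.
have nw : 0 < `|w| by rewrite normr_gt0.
have [rDl _ rZl _ _] := @rip_bdd R k m n.
have lle (u : rM m n) : `|rip u w / `|w| | <= `|u|.
  rewrite normrM normfV normr_id ler_pdivrMr //; exact: ip_le_norm.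
exists (fun u => rip u w / `|w|); split=> //.
- split=> [u v|a u|]; first by rewrite rDl mulrDl.
    by rewrite rZl -scalerAl.
  by exists 1 => // u; rewrite mul1r.
- by rewrite /rip -rmx_norm2 expr2 mulfK // gt_eqF.
Qed.

Lemma has_coords_rmx m n : has_coords (rM m n).
Proof.
have reb i j : bdd_linear (fun A : rM m n => reK (A i j)).
  split=> [u v|a u|]; first by rewrite mxE raddfD.
    by rewrite mxE reKZ.
  exists 1 => // u; rewrite mul1r (le_trans _ (absK_entry u i j)) // /absK norm2_reim.
  by rewrite -sqrtr_sqr ler_wsqrtr // lerDl sqr_ge0.
have imb i j : bdd_linear (fun A : rM m n => imK (A i j)).
  split=> [u v|a u|].
  - by rewrite mxE raddfD.
  - by rewrite mxE imKZ.
  exists 1 => // u; rewrite mul1r (le_trans _ (absK_entry u i j)) // /absK norm2_reim.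
  by rewrite -sqrtr_sqr ler_wsqrtr // lerDr sqr_ge0.
exists ('I_m * 'I_n * bool)%type,
  (fun q (A : rM m n) => if q.2 then imK (A q.1.1 q.1.2) else reK (A q.1.1 q.1.2)),
  (fun q => (if q.2 then iK *: delta_mx q.1.1 q.1.2 else delta_mx q.1.1 q.1.2) : rM m n).
split; [by case=> [[i j] []]; [exact: imb|exact: reb]|move=> A].
rewrite -(pair_bigA _ (fun q b => (if b then imK (A q.1 q.2) else reK (A q.1 q.2)) *:
  ((if b then iK *: delta_mx q.1 q.2 else delta_mx q.1 q.2) : rM m n))) /=.
rewrite -(pair_bigA _ (fun i j => \sum_b (if b then imK (A i j) else reK (A i j)) *:
  ((if b then iK *: delta_mx i j else delta_mx i j) : rM m n))) /=.
rewrite [LHS]matrix_sum_delta; apply: eq_bigr => i _; apply: eq_bigr => j _.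
rewrite big_bool /= addrC {1}[A i j]reimK scalerDl -scalerA.
by [].
Qed.

End Coordinates.

(** * Directional derivatives and smooth maps on a subset of a normed space *)

Section DirectionalDerivative.
Context {R : realType} {V : normedModType R} (M : set V).
Implicit Types W : normedModType R.

Lemma curve_at_in x xi c : curve_at M x xi c -> M x.
Proof. by case=> <- /nbhs_singleton. Qed.

Lemma curve_at_cvg x xi c : curve_at M x xi c -> c @ (0 : R) --> x.
Proof.
case=> c0 _ [cd _]; rewrite -c0.
by apply: differentiable_continuous; apply/derivable1_diffP.
Qed.

Lemma tangent_in x xi : tangent_space M x xi -> M x.
Proof. by case=> c /curve_at_in. Qed.

(** Tangency, which is part of [is_dirD], supplies a curve along which both values are the
    derivative. *)
Lemma is_dirD_unique W (F : V -> W) x xi d d' :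
  is_dirD M F x xi d -> is_dirD M F x xi d' -> d = d'.
Proof. by move=> [[c hc] h] [_ h']; have [_ <-] := h _ hc; have [_ <-] := h' _ hc. Qed.

Lemma dirD_eq W (F : V -> W) x xi d : is_dirD M F x xi d -> dirD M F x xi = d.
Proof.
move=> h; rewrite /dirD; case: xgetP => [y -> h'|/(_ d)//].
exact: is_dirD_unique h' h.
Qed.

Lemma is_dirD_ext W (F G : V -> W) x xi d : (forall y, M y -> F y = G y) ->
  is_dirD M F x xi d -> is_dirD M G x xi d.
Proof.
move=> FG [xiT h]; split=> // c hc; apply: near_eq_is_derive (h c hc).
by case: hc => _ cM _; apply: filterS cM => t /FG.
Qed.

Lemma dirD_ext W (F G : V -> W) x xi : (forall y, M y -> F y = G y) ->
  dirD M F x xi = dirD M G x xi.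
Proof.
move=> FG; rewrite /dirD; congr xget; apply/seteqP; split=> d /=.
  exact: is_dirD_ext.
by apply: is_dirD_ext => y /FG.
Qed.

Lemma is_dirD_id x xi : tangent_space M x xi -> is_dirD M id x xi xi.
Proof. by move=> xiT; split=> // c []. Qed.

Lemma is_dirD_cst W (a : W) x xi : tangent_space M x xi -> is_dirD M (cst a) x xi 0.
Proof. by move=> xiT; split=> // c _; exact: is_derive_cst. Qed.

Lemma is_dirDD W (F G : V -> W) x xi d d' :
  is_dirD M F x xi d -> is_dirD M G x xi d' ->
  is_dirD M (fun y => F y + G y) x xi (d + d').
Proof. by move=> [xiT h] [_ h']; split=> // c hc; exact: (is_deriveD (h c hc) (h' c hc)). Qed.

Lemma is_dirD_linear W W' (f : W -> W') (F : V -> W) x xi d : bdd_linear f ->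
  is_dirD M F x xi d -> is_dirD M (f \o F) x xi (f d).
Proof.
move=> hf [xiT h]; split=> // c hc.
exact: (is_derive_bdd_linear hf (h c hc)).
Qed.

Lemma is_dirD_bilinear W1 W2 W (B : W1 -> W2 -> W) (F : V -> W1) (G : V -> W2) x xi d d' :
  bdd_bilinear B -> is_dirD M F x xi d -> is_dirD M G x xi d' ->
  is_dirD M (fun y => B (F y) (G y)) x xi (B d (G x) + B (F x) d').
Proof.
move=> hB [xiT h] [_ h']; split=> // c hc.
have := is_derive_bdd_bilinear hB (h c hc) (h' c hc).
by case: hc => /= ->.
Qed.

Lemma is_dirD_rinv k p (F : V -> rmx R k p p) x xi d :
  (F x : 'M[scal R k]_p) \in unitmx -> is_dirD M F x xi d ->
  is_dirD M (fun y => rinv (F y)) x xi (- rmul (rmul (rinv (F x)) d) (rinv (F x))).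
Proof.
move=> uF [xiT h]; split=> // c hc.
have := @is_derive_rinv _ _ _ _ _ _ _ _ _ (h c hc).
by case: hc => /= -> _ _; apply.
Qed.

Lemma smooth_ext W (F G : V -> W) : (forall y, M y -> F y = G y) ->
  smooth_on M F -> smooth_on M G.
Proof.
move=> FG hF x Mx; have [U [F' [oU Ux cF FF']]] := hF x Mx.
by exists U, F'; split=> // y My Uy; rewrite -FG // FF'.
Qed.

Lemma smooth_cst W (a : W) : smooth_on M (cst a).
Proof.
by move=> x Mx; exists setT, (cst a); split=> //; [exact: openT|move=> j; exact: Ck_cst].
Qed.

Lemma smooth_id : smooth_on M id.
Proof.
by move=> x Mx; exists setT, id; split=> //; [exact: openT|move=> j; exact: Ck_id].
Qed.

Lemma smooth_linear W W' (f : W -> W') (F : V -> W) : bdd_linear f ->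
  smooth_on M F -> smooth_on M (fun y => f (F y)).
Proof.
move=> hf hF x Mx; have [U [F' [oU Ux cF FF']]] := hF x Mx.
exists U, (f \o F'); split=> // [j|y My Uy]; first exact: Ck_bdd_linear.
by rewrite /= FF'.
Qed.

Lemma smooth_bilinear W1 W2 W (B : W1 -> W2 -> W) (F : V -> W1) (G : V -> W2) :
  bdd_bilinear B -> smooth_on M F -> smooth_on M G ->
  smooth_on M (fun y => B (F y) (G y)).
Proof.
move=> hB hF hG x Mx; have [U [F' [oU Ux cF FF']]] := hF x Mx.
have [U' [G' [oU' U'x cG GG']]] := hG x Mx.
exists (U `&` U'), (fun y => B (F' y) (G' y)).
have oI := openI oU oU'; split=> // [j|y My [Uy U'y]]; last by rewrite FF' ?GG'.
apply: Ck_bdd_bilinear => //; first by apply: Ck_sub (cF j) => ? [].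
by apply: Ck_sub (cG j) => ? [].
Qed.

Lemma smoothD W (F G : V -> W) : smooth_on M F -> smooth_on M G ->
  smooth_on M (fun y => F y + G y).
Proof.
move=> hF hG x Mx; have [U [F' [oU Ux cF FF']]] := hF x Mx.
have [U' [G' [oU' U'x cG GG']]] := hG x Mx.
exists (U `&` U'), (fun y => F' y + G' y).
have oI := openI oU oU'; split=> // [j|y My [Uy U'y]]; last by rewrite FF' ?GG'.
apply: CkD => //; first by apply: Ck_sub (cF j) => ? [].
by apply: Ck_sub (cG j) => ? [].
Qed.

Lemma smooth_rinv k p (F : V -> rmx R k p p) :
  (forall x, M x -> (F x : 'M[scal R k]_p) \in unitmx) ->
  smooth_on M F -> smooth_on M (fun y => rinv (F y)).
Proof.
move=> uF hF x Mx; have [U [F' [oU Ux cF FF']]] := hF x Mx.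
(* The extension F' may be singular off M, so its domain is cut down to the open set where it is
   invertible. *)
pose U' := [set y | U y /\ (F' y : 'M[scal R k]_p) \in unitmx].
have oU' : open U'.
  rewrite openE => y [Uy uy]; rewrite /interior.
  have [cy _] := cF 0%N.
  near=> z; split; first by near: z; exact: open_nbhs_nbhs.
  by near: z; exact: (cy y Uy) (unitmx_near uy).
exists U', (@rinv R k p \o F'); split=> //.
- by split=> //; rewrite -FF' //; exact: uF.
- move=> j; apply: Ck_rinv => // [y [] //|].
  by apply: Ck_sub (cF j) => ? [].
- by move=> y My [Uy _]; rewrite /= FF'.
Unshelve. all: by end_near. Qed.

(** Curves in M stay in the domain of a local extension for small t and see there only the values of
    [F], so the chain rule for the extension applies. *)
Lemma smooth_dirD W (F : V -> W) x : has_coords V -> normed_by_dual W ->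
  smooth_on M F -> M x -> exists dF : V -> W, bdd_linear dF /\
    forall xi, tangent_space M x xi -> is_dirD M F x xi (dF xi).
Proof.
move=> cV nW hF Mx; have [U [F' [oU Ux cF FF']]] := hF x Mx.
have [dF [bF hdF]] := C1_chain cV nW oU Ux (cF 1%N).
exists dF; split=> // xi xiT; split=> // c hc.
have [c0 cM cd] := hc; apply: near_eq_is_derive (hdF c xi c0 cd).
near=> t; rewrite /= FF' //; first by near: t.
by near: t; apply: (curve_at_cvg hc); exact: open_nbhs_nbhs.
Unshelve. all: by end_near. Qed.

End DirectionalDerivative.

(** * Tangent, vertical and horizontal vectors *)

Section Curves.
Context {R : realType} {k : scalars}.
Local Notation K := (scal R k).
Local Notation rM m n := (rmx R k m n).

Lemma is_derive_scalel (m n : nat) (A : rM m n) :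
  is_derive (0 : R) (1 : R) (fun t : R => t *: A) A.
Proof.
have bA : bdd_linear (fun t : R => t *: A).
  split=> [u v|a u|]; [exact: scalerDl|by rewrite scalerA|].
  by exists `|A| => // u; rewrite normrZ mulrC.
have := is_derive_bdd_linear bA (is_derive_id (0 : R) (1 : R)).
by rewrite scale1r.
Qed.

Lemma is_derive_pair (U V : normedModType R) (f : R -> U) (g : R -> V) df dg :
  is_derive (0 : R) (1 : R) f df -> is_derive (0 : R) (1 : R) g dg ->
  is_derive (0 : R) (1 : R) (fun t => (f t, g t) : (U * V)%type) (df, dg).
Proof.
move=> hf hg.
have := is_deriveD (is_derive_bdd_linear (inl_bdd U V) hf)
                   (is_derive_bdd_linear (inr_bdd U V) hg).
set F := (F in is_derive _ _ F _); have -> : F = (fun t => (f t, g t)).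
  by apply/funext => t; rewrite /F /=; congr pair; rewrite /= ?addr0 ?add0r.
by have -> : ((df, 0) + (0, dg))%R = (df, dg) :> (U * V)%type
  by congr pair; rewrite /= ?addr0 ?add0r.
Qed.

Lemma curve_cvg (V : normedModType R) (c : R -> V) d :
  is_derive (0 : R) (1 : R) c d -> c @ (0 : R) --> c 0.
Proof. by case=> cd _; apply: differentiable_continuous; apply/derivable1_diffP. Qed.

(* The Cayley transform of [t W / 2]. *)
Lemma unitary_curve m (W : 'M[K]_m) : W^H = - W ->
  exists c : R -> rM m m, [/\ c 0 = 1%:M :> 'M[K]_m,
    \forall t \near (0 : R), unitary (c t) & is_derive (0 : R) (1 : R) c W].
Proof.
move=> hW; pose A : rM m m := (2^-1)%:K *: W.
have hA : (A : 'M[K]_m)^H = - (A : 'M[K]_m) by rewrite /A ctrmxZr hW scalerN.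
pose I : rM m m := 1%:M.
pose c1 (t : R) : rM m m := I + t *: (- A).
pose c2 (t : R) : rM m m := I + t *: A.
have d1 : is_derive (0 : R) (1 : R) c1 (- A).
  have := is_deriveD (is_derive_cst I (0 : R) (1 : R)) (is_derive_scalel (- A)).
  by rewrite add0r.
have d2 : is_derive (0 : R) (1 : R) c2 A.
  have := is_deriveD (is_derive_cst I (0 : R) (1 : R)) (is_derive_scalel A).
  by rewrite add0r.
have c10 : c1 0 = I by rewrite /c1 scale0r addr0.
have c20 : c2 0 = I by rewrite /c2 scale0r addr0.
have u1 : (c1 0 : 'M[K]_m) \in unitmx by rewrite c10 unitmx1.
exists (fun t => rmul (rinv (c1 t)) (c2 t)); split.
- by rewrite c10 c20 /rmul /rinv invmx1 mulmx1.
- have nu : \forall t \near (0 : R), (c1 t : 'M[K]_m) \in unitmx.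
    exact: (curve_cvg d1 (unitmx_near u1)).
  near=> t; have ut : (c1 t : 'M[K]_m) \in unitmx by near: t.
  have e1 : (c1 t : 'M[K]_m) = 1%:M - t%:K *: (A : 'M[K]_m).
    by rewrite /c1 -[in RHS]scalerN.
  have e2 : (c2 t : 'M[K]_m) = 1%:M + t%:K *: (A : 'M[K]_m) by [].
  (* The factors 1 - tA and 1 + tA are adjoint to each other because A is skew, and they commute;
     hence their quotient is unitary. *)
  have h1 : (c1 t : 'M[K]_m)^H = c2 t.
    by rewrite e1 e2 ctrmxB ctrmx1 ctrmxZr hA scalerN opprK.
  have u2 : (c2 t : 'M[K]_m) \in unitmx by rewrite -h1 ctrmx_unit.
  have h2 : (c2 t : 'M[K]_m)^H = c1 t by rewrite -h1 ctrmxK.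
  have cc : (c1 t : 'M[K]_m) *m c2 t = (c2 t : 'M[K]_m) *m c1 t.
    by rewrite e1 e2; mxnorm; rewrite !mulmx1 !mul1mx; mxring.
  rewrite /unitary /stiefel /= /rmul /rinv ctrmxM ctrmx_inv h1 h2.
  rewrite -mulmxA (mulmxA (invmx (c2 t))) -invmx_mul // cc invmx_mul //.
  by rewrite -mulmxA mulVmx // mulmx1 mulmxV.
- have := is_derive_bdd_bilinear (@rmul_bdd R k m m m) (is_derive_rinv u1 d1) d2.
  rewrite /= c10 c20; suff -> : rmul (- rmul (rmul (rinv I) (- A)) (rinv I)) I + rmul (rinv I) A = W by [].
  rewrite /rmul /rinv invmx1 !mulmx1 !mul1mx opprK.
  have -> : A + A = (2^-1 + 2^-1)%:K *: W :> 'M[K]_m by rewrite raddfD scalerDl.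
  by rewrite (_ : 2^-1 + 2^-1 = 1) ?inK1 ?scale1r //; lra.
Unshelve. all: by end_near. Qed.

End Curves.

Section TotalSpace.
Context {R : realType} {k : scalars} {n p : nat}.
Local Notation K := (scal R k).
Local Notation rM m n := (rmx R k m n).
Local Notation E := (rmx R k n p * rmx R k p p)%type.
Local Notation M := (@total_space R k n p).
Implicit Types S w xi eta : E.

Lemma E_ext (a b : E) : Ypart a = Ypart b -> Ppart a = Ppart b -> a = b.
Proof. by case: a b => [a1 a2] [b1 b2] /= -> ->. Qed.

Lemma is_dirD_fst (N : set E) S xi : tangent_space N S xi ->
  is_dirD N (fun S => S.1 : rM n p) S xi xi.1.
Proof. by move=> /is_dirD_id/(is_dirD_linear (fst_bdd _ _)). Qed.

Lemma is_dirD_snd (N : set E) S xi : tangent_space N S xi ->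
  is_dirD N (fun S => S.2 : rM p p) S xi xi.2.
Proof. by move=> /is_dirD_id/(is_dirD_linear (snd_bdd _ _)). Qed.

(** Differentiate Y^H Y = 1. The set [N] is arbitrary so that both M and the orbits inside it are
    covered. *)
Lemma tangent_stiefel (N : set E) S xi : (forall S', N S' -> stiefel (Ypart S')) ->
  tangent_space N S xi -> (Ypart xi)^H *m Ypart S + (Ypart S)^H *m Ypart xi = 0.
Proof.
move=> NS xiT; have dY := is_dirD_fst xiT.
have := is_dirD_bilinear (@rmul_bdd _ _ _ _ _) (is_dirD_linear (@rctr_bdd _ _ _ _) dY) dY.
have I0 := is_dirD_cst (1%:M : rM p p) xiT.
by move=> /(is_dirD_ext (G := cst (1%:M : rM p p)) NS)/is_dirD_unique/(_ I0).
Qed.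

Lemma tangent_herm (N : set E) S xi : (forall S', N S' -> posdef (Ppart S')) ->
  tangent_space N S xi -> (Ppart xi)^H = Ppart xi.
Proof.
move=> NS xiT; have dP := is_dirD_snd xiT.
have := is_dirD_linear (@rctr_bdd _ _ _ _) dP.
move=> /(is_dirD_ext (G := fun S => S.2 : rM p p) (fun S' h => posdef_herm (NS S' h))).
by move/is_dirD_unique/(_ dP).
Qed.

Lemma tangentP S xi : M S -> tangent_space M S xi <->
  (Ypart xi)^H *m Ypart S + (Ypart S)^H *m Ypart xi = 0 /\ (Ppart xi)^H = Ppart xi.
Proof.
move=> MS; have [YS pS] := MS; split=> [xiT|[hY hP]].
  split; [apply: tangent_stiefel xiT => S' []//|apply: tangent_herm xiT => S' []//].
pose Y := Ypart S; pose P := Ppart S; pose xY := Ypart xi; pose xP := Ppart xi.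
have YY : Y^H *m Y = 1%:M by [].
pose Om := Y^H *m xY.
have hOm : xY^H *m Y = - Om by apply/eqP; rewrite -addr_eq0; apply/eqP.
(* A skew matrix with W Y = xY, so that the unitary curve with velocity W moves Y in the direction
   xY. The first two terms applied to Y give xY + Y Om; the third removes the excess. *)
pose W := xY *m Y^H - Y *m xY^H - Y *m Om *m Y^H.
have hW : W^H = - W.
  rewrite /W !ctrmxB !ctrmxM !ctrmxK hOm; mxnorm; mxring.
have WY : W *m Y = xY.
  rewrite /W !mulmxBl -!mulmxA YY hOm !mulmx1 mulmxN opprK.
  by rewrite addrK.
have [cU [cU0 cUn cUd]] := unitary_curve hW.
(* [A] solves A^H P + P A = xP, where the left side is the velocity of the congruence curve at 0. *)
pose A : rM p p := (2^-1)%:K *: (invmx P *m xP).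
pose cA (t : R) : rM p p := (1%:M : rM p p) + t *: A.
have dA : is_derive (0 : R) (1 : R) cA A.
  have := is_deriveD (is_derive_cst (1%:M : rM p p) (0 : R) (1 : R)) (is_derive_scalel A).
  by rewrite add0r.
have cA0 : cA 0 = 1%:M by rewrite /cA scale0r addr0.
exists (fun t => (rmul (cU t) Y : rM n p, rmul (rmul (rctr (cA t)) P) (cA t) : rM p p)).
split.
- rewrite cU0 cA0; apply: E_ext; rewrite /Ypart /Ppart /rmul /rctr /= ?mul1mx //.
  by rewrite ctrmx1 mul1mx mulmx1.
- have uA : (cA 0 : 'M[K]_p) \in unitmx by rewrite cA0 unitmx1.
  have nA : \forall t \near (0 : R), (cA t : 'M[K]_p) \in unitmx.
    exact: (curve_cvg dA (unitmx_near uA)).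
  near=> t; split.
    have uU : unitary (cU t) by near: t.
    have {}uU : (cU t : 'M[K]_n)^H *m cU t = 1%:M by [].
    rewrite /stiefel /Ypart /= /rmul ctrmxM -mulmxA (mulmxA (_^H) _ Y).
    by rewrite uU mul1mx.
  have uAt : (cA t : 'M[K]_p) \in unitmx by near: t.
  have [T uT PE] := posdef_gram pS.
  have -> : rmul (rmul (rctr (cA t)) P) (cA t) = (T *m cA t)^H *m (T *m cA t).
    by rewrite /rmul /rctr /P PE ctrmxM !mulmxA.
  by apply: unit_gram_posdef; rewrite unitmx_mul uT.
- have dc1 := is_derive_bdd_bilinear (@rmul_bdd _ _ _ _ _) cUd (is_derive_cst (Y : rM n p) (0 : R) (1 : R)).
  have dc2 := is_derive_bdd_bilinear (@rmul_bdd _ _ _ _ _) (is_derive_bdd_bilinear (@rmul_bdd _ _ _ _ _)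
    (is_derive_bdd_linear (@rctr_bdd _ _ _ _) dA) (is_derive_cst (P : rM p p) (0 : R) (1 : R))) dA.
  have := is_derive_pair dc1 dc2.
  rewrite /= cA0 cU0; set z := (z in is_derive _ _ _ z).
  suff -> : z = xi by [].
  have uP := posdef_unit pS.
  apply: E_ext; rewrite /z /Ypart /Ppart /= /rmul /rctr /cst ?mulmx0 ?addr0 //.
  rewrite !mulmx1 ctrmx1 mul1mx /A ctrmxZr ctrmxM hP (posdef_inv_herm pS).
  rewrite -scalemxAl mulmxKV // -scalemxAr mulKVmx //.
  rewrite -scalerDl (_ : 2^-1 + 2^-1 = 1) ?scale1r //; lra.
Unshelve. all: by end_near. Qed.

End TotalSpace.

Section Horizontal.
Context {R : realType} {k : scalars} {n p : nat}.
Local Notation K := (scal R k).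
Local Notation rM m n := (rmx R k m n).
Local Notation E := (rmx R k n p * rmx R k p p)%type.
Local Notation M := (@total_space R k n p).
Implicit Types S w xi eta : E.

Lemma YpartD (a b : E) : Ypart (a + b) = Ypart a + Ypart b. Proof. by []. Qed.
Lemma PpartD (a b : E) : Ppart (a + b) = Ppart a + Ppart b. Proof. by []. Qed.
Lemma YpartN (a : E) : Ypart (- a) = - Ypart a. Proof. by []. Qed.
Lemma PpartN (a : E) : Ppart (- a) = - Ppart a. Proof. by []. Qed.
Lemma YpartZ (x : R) (a : E) : Ypart (x *: a) = x%:K *: Ypart a. Proof. by []. Qed.
Lemma PpartZ (x : R) (a : E) : Ppart (x *: a) = x%:K *: Ppart a. Proof. by []. Qed.
Lemma Ypart_mk A B : Ypart (@mkE R k n p A B) = A. Proof. by []. Qed.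
Lemma Ppart_mk A B : Ppart (@mkE R k n p A B) = B. Proof. by []. Qed.

Definition partE := (YpartD, PpartD, YpartN, PpartN, YpartZ, PpartZ, Ypart_mk, Ppart_mk).

Definition vert S (a : 'M[K]_p) : E :=
  mkE (Ypart S *m a) (Ppart S *m a - a *m Ppart S).

Lemma vert_tangent S a : M S -> a^H = - a -> tangent_space (orbit_of S) S (vert S a).
Proof.
move=> [YS pS] ha; have [c [c0 cU cd]] := @unitary_curve R k p a ha.
have YY : (Ypart S)^H *m Ypart S = 1%:M by [].
exists (fun t => (rmul (Ypart S) (c t) : rM n p,
  rmul (rmul (rctr (c t)) (Ppart S)) (c t) : rM p p)); split.
- rewrite c0; apply: E_ext; rewrite /Ypart /Ppart /rmul /rctr /= ?mulmx1 //.
  by rewrite ctrmx1 mul1mx.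
- by apply: filterS cU => t ut; exists (c t).
- have dc1 := is_derive_bdd_bilinear (@rmul_bdd _ _ _ _ _)
    (is_derive_cst (Ypart S : rM n p) (0 : R) (1 : R)) cd.
  have dc2 := is_derive_bdd_bilinear (@rmul_bdd _ _ _ _ _) (is_derive_bdd_bilinear (@rmul_bdd _ _ _ _ _)
    (is_derive_bdd_linear (@rctr_bdd _ _ _ _) cd) (is_derive_cst (Ppart S : rM p p) (0 : R) (1 : R))) cd.
  have := is_derive_pair dc1 dc2.
  rewrite /= c0; set z := (z in is_derive _ _ _ z).
  suff -> : z = vert S a by [].
  apply: E_ext; rewrite /z /Ypart /Ppart /= /rmul /rctr /cst ?mul0mx ?add0r //.
  by rewrite !mulmx0 addr0 mulmx1 ctrmx1 mul1mx ha mulNmx addrC.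
Qed.

Lemma orbit_in S : M S -> forall S', orbit_of S S' -> M S'.
Proof.
move=> [YS pS] S' [U uU ->]; have YY : (Ypart S)^H *m Ypart S = 1%:M by [].
have {}uU : U^H *m U = 1%:M by []; split.
  by rewrite /stiefel /= /Uact /Ypart /= ctrmxM -mulmxA (mulmxA _ _ U) YY mul1mx.
have [T uT PE] := posdef_gram pS.
have -> : Ppart (Uact S U) = (T *m U)^H *m (T *m U).
  by rewrite /Uact /Ppart /= -/(Ppart S) PE ctrmxM !mulmxA.
by apply: unit_gram_posdef; rewrite unitmx_mul uT; have [_ ->] := mulmx1_unit uU.
Qed.

(** On the orbit of S the group element is recovered linearly from the moving point as U = Y^H Y'.
    Differentiating Y' = Y U and P' = U^H P U yields the two components of [vert]. *)
Lemma tangent_orbitP S zeta : M S ->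
  tangent_space (orbit_of S) S zeta <-> exists2 a, a^H = - a & zeta = vert S a.
Proof.
move=> MS; split=> [zT|[a ha ->]]; last exact: vert_tangent.
have [YS pS] := MS; have YY : (Ypart S)^H *m Ypart S = 1%:M by [].
pose a := (Ypart S)^H *m Ypart zeta; exists a.
  have := tangent_stiefel (fun S' h => (orbit_in MS h).1) zT.
  by move/eqP; rewrite addr_eq0 => /eqP h; rewrite /a ctrmxM ctrmxK h.
have dY := is_dirD_fst zT; have dP := is_dirD_snd zT.
have cY := is_dirD_cst (Ypart S : rM n p) zT.
have cP := is_dirD_cst (Ppart S : rM p p) zT.
pose cst' (A : rM p n) := is_dirD_cst A zT.
have dU := is_dirD_bilinear (@rmul_bdd _ _ _ _ _) (cst' ((Ypart S)^H)) dY.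
have dU' := is_dirD_linear (@rctr_bdd _ _ _ _) dU.
have := is_dirD_bilinear (@rmul_bdd _ _ _ _ _) (is_dirD_bilinear (@rmul_bdd _ _ _ _ _) dU' cP) dU.
have := is_dirD_bilinear (@rmul_bdd _ _ _ _ _) cY dU.
move=> /(is_dirD_ext (G := fun S => S.1 : rM n p)) h1.
move=> /(is_dirD_ext (G := fun S => S.2 : rM p p)) h2.
apply: E_ext.
  have /h1 h : forall y, orbit_of S y ->
    rmul (cst (Ypart S : rM n p) y) (rmul (cst ((Ypart S)^H : rM p n) y) y.1) = y.1.
    move=> _ [U uU ->]; rewrite /rmul /cst /Uact /= -/(Ypart S).
    by rewrite !mulmxA -(mulmxA _ _ (Ypart S)) YY mulmx1.
  rewrite -[LHS](is_dirD_unique h dY) /rmul /cst !mul0mx !add0r //.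
have /h2 h : forall y, orbit_of S y ->
    rmul (rmul (rctr (rmul (cst ((Ypart S)^H : rM p n) y) y.1)) (cst (Ppart S : rM p p) y))
      (rmul (cst ((Ypart S)^H : rM p n) y) y.1) = y.2.
  move=> _ [U uU ->]; rewrite /rmul /rctr /cst /Uact /= -/(Ypart S) -/(Ppart S).
  by rewrite !(mulmxA (Ypart S)^H) YY mul1mx.
rewrite -[LHS](is_dirD_unique h dP) /rmul /rctr /cst /= mul0mx add0r mulmx0 addr0.
rewrite -/(Ypart S) -/(Ypart zeta) YY ctrmx1 mul1mx mulmx1 -/a.
have -> : a^H = - a.
  have := tangent_stiefel (fun S' h => (orbit_in MS h).1) zT.
  by move/eqP; rewrite addr_eq0 => /eqP h'; rewrite /a ctrmxM ctrmxK h'.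
by rewrite mulNmx addrC.
Qed.

Variables alpha0 alpha1 beta : R.
Hypotheses (ha0 : 0 < alpha0) (ha1 : 0 < alpha1) (hb : 0 < beta).
Local Notation g := (@metric_op R k n p alpha0 alpha1 beta).
Local Notation h := (@metric_form R k n p alpha0 alpha1 beta).
Local Notation H := (@horizontal_space R k n p alpha0 alpha1 beta).
Local Notation D := (@calD R k n p alpha1 beta).
Local Notation L := (@Lop R k p alpha1 beta).

Lemma ipAC w eta : ipA w eta = ipA eta w.
Proof. by rewrite /ipA; congr (_ + _); exact: ipC. Qed.

Lemma ipADl (a b c : E) : ipA (a + b) c = ipA a c + ipA b c.
Proof. by rewrite /ipA !ipDl addrACA. Qed.

Lemma ipAZl (x : R) (a b : E) : ipA (x *: a) b = x * ipA a b.
Proof. by rewrite /ipA !ipZl mulrDr. Qed.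

Lemma ipADr (a b c : E) : ipA c (a + b) = ipA c a + ipA c b.
Proof. by rewrite ipAC ipADl !(ipAC c). Qed.

Lemma ipAZr (x : R) (a b : E) : ipA a (x *: b) = x * ipA a b.
Proof. by rewrite ipAC ipAZl ipAC. Qed.

Lemma ipANl (a b : E) : ipA (- a) b = - ipA a b.
Proof. by rewrite -scaleN1r ipAZl mulN1r. Qed.

Lemma ipABl (a b c : E) : ipA (a - b) c = ipA a c - ipA b c.
Proof. by rewrite ipADl ipANl. Qed.

Lemma metric_opD S (a b : E) : g S (a + b) = g S a + g S b.
Proof.
apply: E_ext; rewrite /metric_op !(YpartD, PpartD, Ypart_mk, Ppart_mk); mxnorm; mxring.
Qed.

Lemma metric_opZ S (x : R) (a : E) : g S (x *: a) = x *: g S a.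
Proof.
apply: E_ext; rewrite /metric_op !(YpartZ, PpartZ, Ypart_mk, Ppart_mk); mxnorm; mxring.
Qed.

Lemma metric_op_adj S w eta : M S -> ipA (g S w) eta = ipA w (g S eta).
Proof.
move=> [_ pS]; rewrite /ipA /metric_op /Ypart /Ppart /= -/(Ypart S) -/(Ppart S).
rewrite !ipDl !ipDr !ipZl !ipZr; congr (_ + _ + _ * _).
  by rewrite -mulmxA ip_adjl ip_adjl ctrmxK -mulmxA.
by rewrite ip_adjr ip_adjl (posdef_inv_herm pS) !mulmxA.
Qed.

Lemma metric_formE S w eta : M S -> h S w eta =
  alpha0 * ip (Ypart w) (Ypart eta)
  + (alpha1 - alpha0) * ip ((Ypart S)^H *m Ypart w) ((Ypart S)^H *m Ypart eta)
  + beta * ip (invmx (Ppart S) *m Ppart w *m invmx (Ppart S)) (Ppart eta).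
Proof.
move=> MS; rewrite /metric_form -metric_op_adj // /ipA /metric_op /Ypart /Ppart /=.
by rewrite ipDl !ipZl -mulmxA ip_adjl.
Qed.

Lemma metric_formDZr S (x : R) (a b c : E) :
  h S c (x *: a + b) = x * h S c a + h S c b.
Proof. by rewrite /metric_form metric_opD metric_opZ ipADr ipAZr. Qed.

Lemma metric_formC S (a b : E) : M S -> h S a b = h S b a.
Proof. by move=> MS; rewrite /metric_form ipAC metric_op_adj. Qed.

Lemma metric_formDZl S (x : R) (a b c : E) :
  h S (x *: a + b) c = x * h S a c + h S b c.
Proof. by rewrite /metric_form ipADl ipAZl. Qed.

(** The Y terms regroup as alpha0 (A - B) + alpha1 B, where A - B is the square norm of (1 - Y Y^H)
    w_Y and B that of Y^H w_Y; so the sign of alpha1 - alpha0 is irrelevant. *)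
Lemma metric_form_gt0 S w : M S -> w != 0 -> 0 < h S w w.
Proof.
move=> MS w0; have [YS pS] := MS; have YY : (Ypart S)^H *m Ypart S = 1%:M by [].
rewrite metric_formE //.
set A := ip (Ypart w) _; set B := ip (_ *m _) _; set C := ip _ (Ppart w).
have AB : 0 <= A - B.
  have := ip_ge0 (Ypart w - Ypart S *m ((Ypart S)^H *m Ypart w)).
  rewrite ipBl !ipBr (ipC (Ypart w) (_ *m _)) !ip_adjl (mulmxA _ (Ypart S)) YY mul1mx.
  by rewrite subrr subr0 -(ip_adjl (Ypart S)^H).
have B0 : 0 <= B by exact: ip_ge0.
have [wP|wP] := eqVneq (Ppart w) 0.
  have A0 : 0 < A.
    apply: ip_gt0; apply: contra_neq w0 => wY; exact: E_ext.
  have C0 : C = 0 by rewrite /C wP ip0r.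
  rewrite C0 mulr0 addr0 (_ : _ + _ = alpha0 * (A - B) + alpha1 * B); last by ring.
  have [B1|B1] := eqVneq B 0; first by rewrite B1 mulr0 subr0 addr0 mulr_gt0.
  by rewrite ltr_wpDl ?mulr_ge0 ?(ltW ha0) // mulr_gt0 // lt_def B1.
have C0 : 0 < C by rewrite /C ipC; exact: ip_posdef_inv_gt0.
rewrite (_ : _ + _ = (alpha0 * (A - B) + alpha1 * B) + beta * C); last by ring.
by rewrite ltr_wpDl ?mulr_gt0 // addr_ge0 // mulr_ge0 // ltW.
Qed.

Lemma metric_inner S : M S -> inner_product [set: E] (h S).
Proof.
move=> MS; split=> [a x y z _ _ _|x y _ _|x _].
- exact: metric_formDZl.
- exact: metric_formC.
- exact: metric_form_gt0.
Qed.

Definition hor_eq S eta : 'M[K]_p :=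
  alpha1%:K *: ((Ypart S)^H *m Ypart eta) + beta%:K *: (Ppart eta *m invmx (Ppart S))
  - beta%:K *: (invmx (Ppart S) *m Ppart eta).

(** Moving all factors off [a] by adjunction shows that [hor_eq S eta] represents the functional
    that pairs [eta] with vertical vectors. *)
Lemma metric_vert S eta a : M S -> h S eta (vert S a) = ip (hor_eq S eta) a.
Proof.
move=> MS; have [YS pS] := MS; have YY : (Ypart S)^H *m Ypart S = 1%:M by [].
have uP := posdef_unit pS.
rewrite metric_formE // /vert !partE mulmxA YY mul1mx /hor_eq.
rewrite [ip (Ypart eta) _]ipC ip_adjl ipBr !(ipC (invmx (Ppart S) *m _ *m _)).
rewrite (ip_adjl (Ppart S)) (ip_adjr a) (posdef_herm pS) !mulmxA mulmxV // mul1mx mulmxKV //.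
rewrite ipBl ipDl !ipZl !(ipC _ a); ring.
Qed.

Lemma hor_eqD S (x : R) (a b : E) : hor_eq S (x *: a + b) = x%:K *: hor_eq S a + hor_eq S b.
Proof. rewrite /hor_eq !partE; mxnorm; mxring. Qed.

Lemma horizontalP S eta : M S -> tangent_space M S eta ->
  H S eta <-> hor_eq S eta = 0.
Proof.
move=> MS eT; have [YS pS] := MS; have [hY hP] := (tangentP _ MS).1 eT.
split=> [[_ he]|he]; last first.
  by split=> // z /(tangent_orbitP _ MS)[a ha ->]; rewrite metric_vert // he ip0l.
(* For a tangent [eta] the matrix [hor_eq S eta] is skew, so it may itself serve as the test
   direction, and its square norm vanishes. *)
apply: ip_eq0; rewrite -metric_vert //; apply: he.
apply: vert_tangent => //; rewrite /hor_eq ctrmxB ctrmxD !ctrmxZr !ctrmxM ctrmxK hP.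
rewrite (posdef_inv_herm pS).
move/eqP: hY; rewrite addr_eq0 => /eqP ->; mxring.
Qed.

(** The equation makes alpha1 Y^H eta_Y a multiple of P^-1 eta_P minus its adjoint, hence skew:
    tangency of the Y component is automatic, and horizontality becomes a pair of linear
    conditions. *)
Lemma horizontalE S eta : M S ->
  H S eta <-> hor_eq S eta = 0 /\ (Ppart eta)^H = Ppart eta.
Proof.
move=> MS; have [YS pS] := MS; split=> [he|[he hP]].
  have eT := he.1; split; first exact/(horizontalP MS eT).
  by have [] := (tangentP _ MS).1 eT.
suff eT : tangent_space M S eta by apply/horizontalP.
apply/tangentP => //; split=> //.
have a1 : alpha1%:K != 0 :> K by rewrite fmorph_eq0 gt_eqF.
pose X := (Ypart S)^H *m Ypart eta.
have XE : alpha1%:K *: X =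
    beta%:K *: (invmx (Ppart S) *m Ppart eta) - beta%:K *: (Ppart eta *m invmx (Ppart S)).
  by move/eqP: he; rewrite /hor_eq subr_eq0 => /eqP <-; rewrite addrK.
have -> : (Ypart eta)^H *m Ypart S = X^H by rewrite /X ctrmxM ctrmxK.
apply: (scalerI a1); rewrite scalerDr -ctrmxZr XE ctrmxB !ctrmxZr !ctrmxM hP.
by rewrite (posdef_inv_herm pS) scaler0; mxring.
Qed.

Lemma horizontal_lin S (x : R) (a b : E) : M S -> H S a -> H S b -> H S (x *: a + b).
Proof.
move=> MS /(horizontalE _ MS)[ha hPa] /(horizontalE _ MS)[hb' hPb]; apply/horizontalE => //.
by rewrite hor_eqD ha hb' scaler0 addr0 !partE ctrmxD ctrmxZr hPa hPb.
Qed.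

Definition projH S w : E :=
  let Y := Ypart S in let Pi := invmx (Ppart S) in let D := D S w in
  mkE (beta%:K *: (Y *m (Pi *m D - D *m Pi)) + Ypart w - Y *m Y^H *m Ypart w)
      (alpha1%:K *: D).

Lemma calD_herm S w : M S -> (D S w)^H = D S w.
Proof. by move=> [_ pS]; apply: opinv_Lop_herm => //; exact: symt_herm. Qed.

Lemma projH_tangential S w : M S -> (Ypart S)^H *m Ypart (projH S w) =
  beta%:K *: (invmx (Ppart S) *m D S w - D S w *m invmx (Ppart S)).
Proof.
move=> MS; have [YS pS] := MS; have YY : (Ypart S)^H *m Ypart S = 1%:M by [].
rewrite /projH !partE mulmxBr mulmxDr -scalemxAr !mulmxA YY !mul1mx.
by rewrite addrK.
Qed.

Lemma projH_horizontal S w : M S -> H S (projH S w).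
Proof.
move=> MS; apply/horizontalE => //; rewrite !partE ctrmxZr calD_herm //; split=> //.
rewrite /hor_eq projH_tangential // !partE; mxnorm; mxring.
Qed.

(** For horizontal u and X = P^-1 u_P P^-1, horizontality reads alpha1 Y^H u_Y = beta (X P - P X),
    so the whole pairing collapses to beta <X, Z>. As X is Hermitian only sym(Z) counts, and sym(Z)
    = 0 is the equation that defines D: this is where L(P) and D come from. *)
Lemma projH_orth S u w : M S -> H S u -> h S u (w - projH S w) = 0.
Proof.
move=> MS Hu; have [YS pS] := MS; have YY : (Ypart S)^H *m Ypart S = 1%:M by [].
have [hu uP] := (horizontalE _ MS).1 Hu; have uPs := posdef_unit pS.
have Pih := posdef_inv_herm pS.
set Y := Ypart S in YY *; set P := Ppart S in uPs Pih *; pose Pi := invmx P.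
pose a := Y^H *m Ypart w - beta%:K *: (Pi *m D S w - D S w *m Pi).
have wE : Ypart (w - projH S w) = Y *m a.
  by rewrite /projH !partE /a /Pi -/Y -/P; mxnorm; mxring.
pose X := invmx P *m Ppart u *m invmx P.
have hX : X^H = X by rewrite /X !ctrmxM uP Pih mulmxA.
rewrite metric_formE // wE mulmxA YY mul1mx (ipC _ (Y *m a)) ip_adjl -/X.
rewrite (ipC a) -mulrDl (addrC alpha0) subrK -ipZl.
have -> : alpha1%:K *: (Y^H *m Ypart u) = beta%:K *: (X *m P - P *m X).
  move/eqP: hu; rewrite /hor_eq subr_eq0 => /eqP/(canRL (addrK _)) ->.
  rewrite /X !mulmxA mulmxV // mul1mx mulmxKV // scalerBr addrC.
  by [].
rewrite ipZl -mulrDr; apply/eqP; rewrite mulf_eq0 gt_eqF //=; apply/eqP.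
have PH : P^H = P by exact: posdef_herm.
rewrite ipBl (ip_adjr X P) (ip_adjl P X) PH -ipBr -ipDr.
rewrite -(ip_herm_symt _ hX).
set Z := (Z in symt Z).
have ZE : Z = (Ppart w + Y^H *m Ypart w *m P - P *m Y^H *m Ypart w) - L P (D S w).
  rewrite /Z -[w.2]/(Ppart w) /a /Lop -/Pi; mxnorm.
  rewrite !mulmxKV // mulmxV // mul1mx.
  have -> : (alpha1 - 2 * beta)%:K = alpha1%:K - 2 * beta%:K :> K.
    by rewrite raddfB /= rmorphM /= rmorph_nat.
  by mxring.
by rewrite ZE Lop_surj // ip_herm_symt // ipBr ip_herm_symt // subrr.
Qed.

(** The difference of two solutions is horizontal and orthogonal to itself. The closed form, the
    linearity and the equivariance of [hproj] all pass through this characterization. *)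
Lemma hproj_unique S w v : M S -> H S v -> (forall u, H S u -> h S u (w - v) = 0) ->
  hproj alpha0 alpha1 beta S w = v.
Proof.
move=> MS Hv ov; rewrite /hproj; case: xgetP => [v' _ [Hv' ov']|/(_ v) []]; last by split.
apply/eqP; rewrite -subr_eq0; apply: contraT => d0.
have Hd : H S (v' - v).
  by rewrite -[- v]scaleN1r addrC; exact: (horizontal_lin (-1) MS Hv Hv').
have := metric_form_gt0 MS d0.
have -> : h S (v' - v) (v' - v) = h S (v' - v) ((-1) *: (w - v') + (w - v)).
  by rewrite scaleN1r opprB addrA subrK.
by rewrite metric_formDZr ov // ov' // mulr0 addr0 ltxx.
Qed.

Lemma hprojE S w : M S -> hproj alpha0 alpha1 beta S w = projH S w.
Proof.
move=> MS; apply: hproj_unique => //; first exact: projH_horizontal.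
by move=> u Hu; exact: projH_orth.
Qed.

Lemma hproj_hor S w : M S -> H S (hproj alpha0 alpha1 beta S w).
Proof. by move=> MS; rewrite hprojE //; exact: projH_horizontal. Qed.

Lemma hproj_orth S u w : M S -> H S u -> h S u (w - hproj alpha0 alpha1 beta S w) = 0.
Proof. by move=> MS Hu; rewrite hprojE //; exact: projH_orth. Qed.

Lemma hproj_id S w : M S -> H S w -> hproj alpha0 alpha1 beta S w = w.
Proof.
move=> MS Hw; apply: hproj_unique => // u _.
by rewrite subrr -(subrr 0) -(scaleN1r 0) addrC metric_formDZr mulN1r addrC subrr.
Qed.

Lemma hproj_lin S (x : R) a b : M S -> hproj alpha0 alpha1 beta S (x *: a + b) =
  x *: hproj alpha0 alpha1 beta S a + hproj alpha0 alpha1 beta S b.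
Proof.
move=> MS; apply: hproj_unique => //.
  by apply: horizontal_lin => //; exact: hproj_hor.
move=> u Hu; have := hproj_orth b MS Hu; have := hproj_orth a MS Hu.
move: (hproj _ _ _ _ a) (hproj _ _ _ _ b) => pa pb ea eb.
have -> : x *: a + b - (x *: pa + pb) = x *: (a - pa) + (b - pb).
  by rewrite opprD addrACA scalerBr.
rewrite metric_formDZr. rewrite ea. rewrite eb.
by rewrite mulr0 addr0.
Qed.

(** The Y component dictates [a]: it is the difference of Y^H w_Y and its analogue for the
    projection. The P component then amounts to the equation for D, whose right-hand side is already
    Hermitian because w is tangent. *)
Lemma tangent_split S w : M S -> tangent_space M S w ->
  exists2 a, a^H = - a & w = hproj alpha0 alpha1 beta S w + vert S a.
Proof.
move=> MS wT; have [YS pS] := MS; have YY : (Ypart S)^H *m Ypart S = 1%:M by [].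
have [hY hP] := (tangentP _ MS).1 wT; have uP := posdef_unit pS.
have Pih := posdef_inv_herm pS; have Ph := posdef_herm pS.
have Dh := calD_herm w MS.
have hO : ((Ypart S)^H *m Ypart w)^H = - ((Ypart S)^H *m Ypart w).
  by apply/eqP; rewrite -addr_eq0 ctrmxM ctrmxK; apply/eqP.
exists ((Ypart S)^H *m Ypart w
  - beta%:K *: (invmx (Ppart S) *m D S w - D S w *m invmx (Ppart S))).
  rewrite ctrmxB hO ctrmxZr ctrmxB !ctrmxM Dh Pih; mxring.
rewrite hprojE //; apply: E_ext; rewrite /projH /vert !partE; first by mxnorm; mxring.
have LD : L (Ppart S) (D S w) = Ppart w + (Ypart S)^H *m Ypart w *m Ppart S
    - Ppart S *m (Ypart S)^H *m Ypart w.
  rewrite Lop_surj // herm_symt // -(mulmxA (Ppart S)) !(ctrmxD, ctrmxN) hP.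
  by rewrite (ctrmxM _ (Ppart S)) (ctrmxM (Ppart S)) hO Ph; mxnorm; mxring.
have PL : alpha1%:K *: D S w = L (Ppart S) (D S w) + 2 *: (beta%:K *: D S w)
    - beta%:K *: (Ppart S *m D S w *m invmx (Ppart S) + invmx (Ppart S) *m D S w *m Ppart S).
  have aE : (alpha1 - 2 * beta)%:K = alpha1%:K - 2 * beta%:K :> K.
    by rewrite raddfB /= rmorphM /= rmorph_nat.
  by rewrite /Lop aE; mxring.
rewrite PL LD; mxnorm; rewrite !mulmxKV // !mulmxV // mul1mx.
by mxring.
Qed.

End Horizontal.

(** * Smoothness and derivative of the projection *)

Section SmoothCombinators.
Context {R : realType} {k : scalars} {V : normedModType R} (M : set V).
Local Notation K := (scal R k).
Local Notation rM m n := (rmx R k m n).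

Lemma smooth_rmul m n q (F : V -> rM m n) (G : V -> rM n q) :
  smooth_on M F -> smooth_on M G -> smooth_on M (fun x => rmul (F x) (G x)).
Proof. exact: (smooth_bilinear (@rmul_bdd _ _ _ _ _)). Qed.

Lemma smooth_rctr m n (F : V -> rM m n) :
  smooth_on M F -> smooth_on M (fun x => rctr (F x)).
Proof. exact: (smooth_linear (@rctr_bdd _ _ _ _)). Qed.

Lemma scaler_bdd (W : normedModType R) (a : R) : bdd_linear (fun w : W => a *: w).
Proof.
split=> [u v|b u|]; [exact: scalerDr|by rewrite !scalerA mulrC|].
by exists `|a| => // u; rewrite normrZ.
Qed.

Lemma smoothZ (W : normedModType R) (a : R) (F : V -> W) :
  smooth_on M F -> smooth_on M (fun x => a *: F x).
Proof. exact: (smooth_linear (scaler_bdd W a)). Qed.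

Lemma smoothB (W : normedModType R) (F G : V -> W) :
  smooth_on M F -> smooth_on M G -> smooth_on M (fun x => F x - G x).
Proof.
move=> hF hG; apply: (smooth_ext _ (smoothD hF (smoothZ (-1) hG))) => y _.
by rewrite scaleN1r.
Qed.

Lemma smooth_pair (U W : normedModType R) (F : V -> U) (G : V -> W) :
  smooth_on M F -> smooth_on M G -> smooth_on M (fun x => (F x, G x) : (U * W)%type).
Proof.
move=> hF hG.
apply: (smooth_ext _ (smoothD (smooth_linear (inl_bdd U W) hF) (smooth_linear (inr_bdd U W) hG))).
by move=> y _; congr pair; rewrite /= ?addr0 ?add0r.
Qed.

Lemma symt_bdd m : bdd_linear (@symt R k m : rM m m -> rM m m).
Proof.
have e (A : rM m m) : (symt A : rM m m) = 2^-1 *: (A + rctr A).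
  have -> : 2^-1 *: (A + rctr A) = (2^-1)%:K *: ((A : 'M[K]_m) + A^H) :> 'M[K]_m by [].
  by rewrite fmorphV /= rmorph_nat.
have [cD cZ [C C0 hC]] := @rctr_bdd R k m m.
split=> [u v|a u|].
- by rewrite !e cD addrACA scalerDr.
- by rewrite !e cZ -scalerDr !scalerA mulrC.
- exists (2^-1 * (1 + C)) => [|u]; first by rewrite mulr_ge0 // addr_ge0.
  rewrite e normrZ ger0_norm // -mulrA ler_wpM2l //.
  by rewrite (le_trans (ler_normD _ _)) // mulrDl mul1r lerD2l.
Qed.

Definition rLop (p : nat) (alpha1 beta : R) (P Q : rM p p) : rM (p * p) (p * p) :=
  Lop_mx alpha1 beta P Q.

Lemma smooth_rLop p alpha1 beta (F G : V -> rM p p) : smooth_on M F -> smooth_on M G ->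
  smooth_on M (fun x => rLop alpha1 beta (F x) (G x)).
Proof.
move=> hF hG.
have l1 : bdd_linear (@lin_mulmx K p p p : rM p p -> rM (p * p) (p * p)).
  by apply: Klinear_bdd => *; [exact: linearD|exact: linearZ].
have l2 : bdd_linear (@lin_mulmxr K p p p : rM p p -> rM (p * p) (p * p)).
  by apply: Klinear_bdd => *; [exact: linearD|exact: linearZ].
have s1 := smooth_rmul (smooth_linear l1 hF) (smooth_linear l2 hG).
have s2 := smooth_rmul (smooth_linear l1 hG) (smooth_linear l2 hF).
have s0 : smooth_on M (cst ((alpha1 - 2%:R * beta)%:K *: 1%:M : rM (p * p) (p * p))).
  exact: smooth_cst.
exact: (smooth_ext _ (smoothD s0 (smoothZ beta (smoothD s1 s2)))).
Qed.

End SmoothCombinators.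

Section SmoothProjection.
Context {R : realType} {k : scalars} {n p : nat}.
Local Notation K := (scal R k).
Local Notation rM m n := (rmx R k m n).
Local Notation E := (rmx R k n p * rmx R k p p)%type.
Local Notation M := (@total_space R k n p).
Implicit Types S w xi eta : E.
Variables alpha0 alpha1 beta : R.
Hypotheses (ha0 : 0 < alpha0) (ha1 : 0 < alpha1) (hb : 0 < beta).

Lemma smooth_Y (F : E -> E) : smooth_on M F -> smooth_on M (fun S => (F S).1).
Proof. exact: (smooth_linear (fst_bdd _ _)). Qed.

Lemma smooth_P (F : E -> E) : smooth_on M F -> smooth_on M (fun S => (F S).2).
Proof. exact: (smooth_linear (snd_bdd _ _)). Qed.

Lemma smooth_Pinv : smooth_on M (fun S => rinv S.2).
Proof.
have sP := smooth_P (@smooth_id _ _ M).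
by apply: smooth_rinv => [S [_ pS]|] //; exact: posdef_unit.
Qed.

(** After vectorization D is a product with the inverse of the matrix of L(P), so smoothness of
    inversion in size p^2 suffices. *)
Lemma smooth_calD (F : E -> E) : smooth_on M F ->
  smooth_on M (fun S => calD alpha1 beta S (F S) : rM p p).
Proof.
move=> hF; have sY := smooth_Y (@smooth_id _ _ M); have sP := smooth_P (@smooth_id _ _ M).
have fY := smooth_Y hF; have fP := smooth_P hF.
pose A S : rM p p := symt ((F S).2 + rmul (rmul (rctr S.1) (F S).1) S.2
  - rmul (rmul S.2 (rctr S.1)) (F S).1).
have sA : smooth_on M A.
  apply: (smooth_linear (@symt_bdd R k p)); apply: smoothB.
    by apply: smoothD => //; apply: smooth_rmul => //; apply: smooth_rmul => //; exact: smooth_rctr.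
  by apply: smooth_rmul => //; apply: smooth_rmul => //; exact: smooth_rctr.
have sL : smooth_on M (fun S => rinv (rLop alpha1 beta S.2 (rinv S.2))).
  apply: smooth_rinv => [S [_ pS]|]; first exact: Lop_mx_unit.
  by apply: smooth_rLop => //; exact: smooth_Pinv.
have l1 : bdd_linear (@mxvec K p p : rM p p -> rM 1 (p * p)).
  by apply: Klinear_bdd => *; [exact: linearD|exact: linearZ].
have l2 : bdd_linear (@vec_mx K p p : rM 1 (p * p) -> rM p p).
  by apply: Klinear_bdd => *; [exact: linearD|exact: linearZ].
apply: (smooth_ext _ (smooth_linear l2 (smooth_rmul (smooth_linear l1 sA) sL))).
by move=> S [_ pS]; rewrite /calD opinv_Lop.
Qed.

Lemma smooth_hproj (F : E -> E) : smooth_on M F ->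
  smooth_on M (fun S => hproj alpha0 alpha1 beta S (F S)).
Proof.
move=> hF; have sY := smooth_Y (@smooth_id _ _ M); have sP := smooth_P (@smooth_id _ _ M).
have fY := smooth_Y hF; have fP := smooth_P hF; have sD := smooth_calD hF.
have sPi := smooth_Pinv.
have h1 : smooth_on M (fun S => beta *: rmul S.1 (rmul (rinv S.2) (calD alpha1 beta S (F S)) -
    rmul (calD alpha1 beta S (F S)) (rinv S.2)) + (F S).1 - rmul (rmul S.1 (rctr S.1)) (F S).1).
  apply: smoothB; last first.
    by apply: smooth_rmul => //; apply: smooth_rmul => //; exact: smooth_rctr.
  apply: smoothD => //; apply: smoothZ; apply: smooth_rmul => //.
  by apply: smoothB; exact: smooth_rmul.
apply: (smooth_ext _ (smooth_pair h1 (smoothZ alpha1 sD))) => S MS.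
by rewrite hprojE.
Qed.

Lemma has_coords_E : has_coords E.
Proof. by apply: has_coords_prod; exact: has_coords_rmx. Qed.

Lemma normed_by_dual_E : normed_by_dual E.
Proof. by apply: normed_by_dual_prod; exact: normed_by_dual_rmx. Qed.

End SmoothProjection.

Section DirDCombinators.
Context {R : realType} {k : scalars} {V : normedModType R} (M : set V).
Local Notation K := (scal R k).
Local Notation rM m n := (rmx R k m n).

Lemma is_dirD_rmul m n q (F : V -> rM m n) (G : V -> rM n q) x xi d d' :
  is_dirD M F x xi d -> is_dirD M G x xi d' ->
  is_dirD M (fun y => rmul (F y) (G y)) x xi (rmul d (G x) + rmul (F x) d').
Proof. exact: (is_dirD_bilinear (@rmul_bdd _ _ _ _ _)). Qed.

Lemma is_dirD_rctr m n (F : V -> rM m n) x xi d :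
  is_dirD M F x xi d -> is_dirD M (fun y => rctr (F y)) x xi (rctr d).
Proof. exact: (is_dirD_linear (@rctr_bdd _ _ _ _)). Qed.

Lemma is_dirDZ (W : normedModType R) (a : R) (F : V -> W) x xi d :
  is_dirD M F x xi d -> is_dirD M (fun y => a *: F y) x xi (a *: d).
Proof. exact: (is_dirD_linear (scaler_bdd W a)). Qed.

Lemma is_dirDB (W : normedModType R) (F G : V -> W) x xi d d' :
  is_dirD M F x xi d -> is_dirD M G x xi d' ->
  is_dirD M (fun y => F y - G y) x xi (d - d').
Proof.
move=> hF hG; have := is_dirDD hF (is_dirDZ (-1) hG); rewrite scaleN1r.
by apply: is_dirD_ext => y _; rewrite scaleN1r.
Qed.

Lemma is_dirD_pair (U W : normedModType R) (F : V -> U) (G : V -> W) x xi d d' :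
  is_dirD M F x xi d -> is_dirD M G x xi d' ->
  is_dirD M (fun y => (F y, G y) : (U * W)%type) x xi (d, d').
Proof.
move=> [T hF] [_ hG]; split=> // c hc.
exact: (is_derive_pair (hF c hc) (hG c hc)).
Qed.

End DirDCombinators.

Section DerivativeProjection.
Context {R : realType} {k : scalars} {n p : nat}.
Local Notation K := (scal R k).
Local Notation rM m n := (rmx R k m n).
Local Notation E := (rmx R k n p * rmx R k p p)%type.
Local Notation M := (@total_space R k n p).
Implicit Types S w xi eta : E.
Variables alpha0 alpha1 beta : R.
Hypotheses (ha0 : 0 < alpha0) (ha1 : 0 < alpha1) (hb : 0 < beta).
Local Notation D := (@calD R k n p alpha1 beta).
Local Notation L := (@Lop R k p alpha1 beta).

Lemma is_dirD_Pinv S xi : tangent_space M S xi ->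
  is_dirD M (fun S => rinv S.2) S xi (- rmul (rmul (rinv S.2) xi.2) (rinv S.2)).
Proof.
move=> xiT; have [_ pS] := tangent_in xiT.
by apply: is_dirD_rinv; [exact: posdef_unit|exact: is_dirD_snd].
Qed.

(** Implicit differentiation: smoothness provides some derivative d; differentiating both sides of
    L(P) D = sym(...) along M isolates L(P) d, and injectivity of L(P) identifies d with the closed
    form. *)
Lemma is_dirD_calD S xi w : M S -> tangent_space M S xi ->
  is_dirD M (fun S' => D S' w : rM p p) S xi (calDring alpha1 beta S xi w).
Proof.
move=> MS xiT; have [YS pS] := MS; have uP := posdef_unit pS.
have dY := is_dirD_fst xiT; have dP := is_dirD_snd xiT; have dPi := is_dirD_Pinv xiT.
have sD : smooth_on M (fun S' => D S' w : rM p p).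
  by apply: (smooth_calD ha1 hb (F := cst w)); exact: smooth_cst.
have [dF [_ hdF]] := smooth_dirD (@has_coords_E R k n p) (@normed_by_dual_rmx R k p p) sD MS.
have dD := hdF xi xiT; set d := dF xi in dD *.
have dwY := is_dirD_cst (w.1 : rM n p) xiT; have dwP := is_dirD_cst (w.2 : rM p p) xiT.
have dYwY := is_dirD_rmul (is_dirD_rctr dY) dwY.
have rhs := is_dirD_linear (@symt_bdd R k p)
  (is_dirDB (is_dirDD dwP (is_dirD_rmul dYwY dP)) (is_dirD_rmul dP dYwY)).
have lhs := is_dirDD (is_dirDZ (alpha1 - 2 * beta) dD) (is_dirDZ beta
  (is_dirDD (is_dirD_rmul (is_dirD_rmul dP dD) dPi) (is_dirD_rmul (is_dirD_rmul dPi dD) dP))).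
have lr : forall y, M y -> symt (w.2 + rmul (rmul (rctr y.1) w.1) y.2
     - rmul y.2 (rmul (rctr y.1) w.1)) = (alpha1 - 2 * beta) *: (D y w : rM p p)
   + beta *: (rmul (rmul y.2 (D y w)) (rinv y.2) + rmul (rmul (rinv y.2) (D y w)) y.2) :> rM p p.
  move=> y [_ py]; rewrite -[RHS]/(L (Ppart y) (D y w)) Lop_surj //.
  by congr symt; rewrite /rmul /rctr (mulmxA y.2).
have {lhs rhs lr} := is_dirD_unique (is_dirD_ext lr rhs) lhs.
rewrite /rmul /rctr /rinv /cst -[w.1]/(Ypart w) -[xi.1]/(Ypart xi)
  -[xi.2]/(Ppart xi) -[S.1]/(Ypart S) -[S.2]/(Ppart S) => e.
suff -> : calDring alpha1 beta S xi w = d by [].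
set Y := Ypart S in e *; set P := Ppart S in e *; set Dw := D S w in e *.
set wY := Ypart w in e *; set xY := Ypart xi in e *; set xP := Ppart xi in e *.
have e' : symt (xY^H *m wY *m P - P *m xY^H *m wY + Y^H *m wY *m xP - xP *m Y^H *m wY) =
    (alpha1 - 2 * beta)%:K *: d + beta%:K *: ((xP *m Dw + P *m d) *m invmx P
      + P *m Dw *m (- (invmx P *m xP *m invmx P))
      + ((- (invmx P *m xP *m invmx P) *m Dw + invmx P *m d) *m P + invmx P *m Dw *m xP))
    :> 'M[K]_p.
  apply: etrans e; congr symt.
  by rewrite mulmx0 addr0 add0r; mxnorm; mxring.
apply: (opinvP (Lop_inj pS ha1 hb)); rewrite -/Y -/P -/Dw -/wY -/xY -/xP e' /Lop.
by mxnorm; mxring.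
Qed.

Lemma is_dirD_hproj S xi w : M S -> tangent_space M S xi ->
  let Y := Ypart S in let P := Ppart S in let Pi := invmx P in
  let xY := Ypart xi in let xP := Ppart xi in
  let Dw := D S w in let Dr := calDring alpha1 beta S xi w in
  is_dirD M (fun S' => hproj alpha0 alpha1 beta S' w) S xi
    (mkE (beta%:K *: (xY *m (Pi *m Dw - Dw *m Pi))
          + beta%:K *: (Y *m (Pi *m Dr - Dr *m Pi
                              + Dw *m Pi *m xP *m Pi - Pi *m xP *m Pi *m Dw))
          - (xY *m Y^H + Y *m xY^H) *m Ypart w)
         (alpha1%:K *: Dr)).
Proof.
move=> MS xiT Y P Pi xY xP Dw Dr.
have dY := is_dirD_fst xiT; have dPi := is_dirD_Pinv xiT; have dD := is_dirD_calD w MS xiT.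
have dwY := is_dirD_cst (w.1 : rM n p) xiT.
have d1 := is_dirDZ beta (is_dirD_rmul dY (is_dirDB (is_dirD_rmul dPi dD) (is_dirD_rmul dD dPi))).
have d2 := is_dirD_rmul (is_dirD_rmul dY (is_dirD_rctr dY)) dwY.
have dd := is_dirD_pair (is_dirDB (is_dirDD d1 dwY) d2) (is_dirDZ alpha1 dD).
set v := mkE _ _; move: dd; set v' := (v' in is_dirD _ _ _ _ v').
have -> : v' = v.
  apply: E_ext; rewrite /v /v' !partE //.
  rewrite /Ypart /= /rmul /rctr /rinv /cst -[w.1]/(Ypart w) -[xi.1]/(Ypart xi)
    -[xi.2]/(Ppart xi) -[S.1]/(Ypart S) -[S.2]/(Ppart S) -/Dw -/Dr -/Y -/P -/Pi -/xY -/xP.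
  rewrite mulmx0 !addr0 /GRing.scale /=; mxnorm; mxring.
apply: is_dirD_ext => y My; rewrite (hprojE ha0 ha1 hb) //.
Qed.

End DerivativeProjection.

(** * The quotient *)

Section PSD.
Context {R : realType} {k : scalars}.
Local Notation K := (scal R k).

Lemma form_ipr m (A : 'M[K]_m) (v : 'cV[K]_m) :
  reK ((v^H *m A *m v) ord0 ord0) = ip (A *m v) v.
Proof. by rewrite /ip trR_mulC /trR /mxtrace big_ord1 mulmxA. Qed.

(** With w = A u and b = |w|^2, positivity at u + t w says 2 t b + t^2 c >= 0 for all real t, which
    fails for small negative t unless b = 0. *)
Lemma psd_ker m (A : 'M[K]_m) (u : 'cV[K]_m) : A^H = A ->
  (forall v : 'cV[K]_m, 0 <= ip (A *m v) v) -> ip (A *m u) u = 0 -> A *m u = 0.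
Proof.
move=> hA pA Au0; apply: ip_eq0; set b := ip _ _.
set w := A *m u; set c := ip (A *m w) w.
have c0 : 0 <= c by exact: pA.
have q (t : R) : 0 <= 2 * t * b + t ^+ 2 * c.
  have := pA (u + t%:K *: w).
  rewrite mulmxDr -scalemxAr ipDl !ipDr !ipZl !ipZr Au0.
  have -> : ip (A *m w) u = b by rewrite ip_adjl hA ipC.
  by rewrite -/c -/w -/b => h; apply: le_trans h _; lra.
apply/eqP; apply: contraT => b0.
have c1 : 0 < c + 1 by rewrite ltr_wpDl.
(* At this t the polynomial equals -(b / (c + 1))^2 (c + 2); dividing by c + 1 avoids the case c =
   0. *)
have := q (- b / (c + 1)).
have -> : 2 * (- b / (c + 1)) * b + (- b / (c + 1)) ^+ 2 * c =
    - (b / (c + 1)) ^+ 2 * (c + 2) by field; rewrite gt_eqF.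
rewrite mulNr oppr_ge0 leNgt mulr_gt0 //; last by rewrite ltr_wpDl.
by rewrite exprn_even_gt0 //= mulf_neq0 // invr_eq0 gt_eqF.
Qed.

Lemma psd_unit_posdef m (A : 'M[K]_m) : A^H = A -> A \in unitmx ->
  (forall v : 'cV[K]_m, 0 <= (v^H *m A *m v) ord0 ord0) -> posdef A.
Proof.
move=> hA uA pA; split=> // v v0; rewrite lt_def pA andbT.
apply: contra_neq v0 => e.
have h : A *m v = 0.
  apply: psd_ker => // [w|]; last by rewrite -form_ipr e raddf0.
  by rewrite -form_ipr -(@inK_ge0 _ k) -ge0_inK.
by rewrite -(mulKmx uA v) h mulmx0.
Qed.

Lemma herm_form0 m (A : 'M[K]_m) : A^H = A ->
  (forall v : 'cV[K]_m, ip (A *m v) v = 0) -> A = 0.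
Proof.
move=> hA A0; apply/matrixP => i j.
have /(congr1 (fun B : 'cV[K]_m => B i 0)) : A *m delta_mx j 0 = 0 :> 'cV[K]_m.
  by apply: psd_ker => // v; rewrite A0.
by rewrite -colE !mxE.
Qed.

End PSD.

Section Quotient.
Context {R : realType} {k : scalars}.
Local Notation K := (scal R k).
Local Notation rM m n := (rmx R k m n).

Lemma quo_proj_psd n p (S : (rmx R k n p * rmx R k p p)%type) :
  total_space S -> psd_rank p (quo_proj S).
Proof.
move=> [YS pS]; have YY : (Ypart S)^H *m Ypart S = 1%:M by [].
have uP := posdef_unit pS; have [T uT PE] := posdef_gram pS; split.
- by rewrite /quo_proj !ctrmxM ctrmxK (posdef_herm pS) mulmxA.
- move=> v; have -> : v^H *m quo_proj S *m v =
      (T *m ((Ypart S)^H *m v))^H *m (T *m ((Ypart S)^H *m v)).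
    by rewrite /quo_proj PE !ctrmxM ctrmxK !mulmxA.
  by rewrite form_ip inK_ge0 ip_ge0.
- apply/eqP; rewrite eqn_leq; apply/andP; split.
    by rewrite /quo_proj -mulmxA (leq_trans (mxrankM_maxl _ _)) // rank_leq_col.
  rewrite -{1}(mxrank_unit uP).
  have -> : Ppart S = (Ypart S)^H *m (quo_proj S *m Ypart S).
    by rewrite /quo_proj -!mulmxA YY mulmx1 mulmxA YY mul1mx.
  by rewrite (leq_trans (mxrankM_maxr _ _)) // mxrankM_maxl.
Qed.

(** Orthonormalization through the Gram matrix: a column basis C of X has full rank, so C^H C is
    positive definite and equals T^H T, and C T^-1 is orthonormal with the same range. *)
Lemma orthonormal_range n (X : 'M[K]_n) :
  exists Y : 'M[K]_(n, \rank X), Y^H *m Y = 1%:M /\ Y *m (Y^H *m X) = X.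
Proof.
pose C := col_base X; have XB : C *m row_base X = X by exact: mulmx_base.
have [C' C'C] : exists C', C' *m C = 1%:M by apply/row_fullP; exact: col_base_full.
have pG : posdef (C^H *m C).
  split=> [|v v0]; first by rewrite ctrmxM ctrmxK.
  rewrite mulmxA -ctrmxM -mulmxA form_ip inK_gt0 ip_gt0 //.
  by apply: contra_neq v0 => Cv; rewrite -[v]mul1mx -C'C -mulmxA Cv mulmx0.
have [T uT GE] := posdef_gram pG.
pose Y := C *m invmx T.
have uTH : T^H \in unitmx by rewrite ctrmx_unit.
have YY : Y^H *m Y = 1%:M.
  rewrite /Y ctrmxM ctrmx_inv mulmxA -(mulmxA _ C^H) GE.
  by rewrite mulKmx // mulmxV.
have YC : Y *m (Y^H *m C) = C.
  rewrite /Y ctrmxM ctrmx_inv -(mulmxA _ C^H) GE mulKmx //.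
  by rewrite mulmxKV.
exists Y; split=> //.
have -> : Y *m (Y^H *m X) = Y *m (Y^H *m C) *m row_base X.
  by rewrite -(mulmxA Y) -(mulmxA Y^H) XB.
by rewrite YC.
Qed.

(** For an orthonormal basis Y of the range, take the compression P = Y^H X Y. Since X is Hermitian,
    Y Y^H fixes it from both sides; rank p makes P invertible, and an invertible semidefinite matrix
    is definite. *)
Lemma quo_proj_surj n p (X : rM n n) : psd_rank p X ->
  exists2 S : (rmx R k n p * rmx R k p p)%type, total_space S & quo_proj S = X.
Proof.
move=> [hX pX rX]; have := orthonormal_range (X : 'M[K]_n); rewrite rX => -[Y [YY YX]].
have XY : X *m Y *m Y^H = X :> 'M[K]_n.
  by have := congr1 (@ctrmx R k n n) YX; rewrite !ctrmxM ctrmxK hX.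
pose P := Y^H *m X *m Y.
have XE : X = Y *m P *m Y^H by rewrite /P !mulmxA -(mulmxA Y) YX XY.
have uP : P \in unitmx.
  rewrite -row_full_unit /row_full eqn_leq rank_leq_col /= -{1}rX.
  by rewrite {1}XE -mulmxA (leq_trans (mxrankM_maxr _ _)) // mxrankM_maxl.
exists (mkE Y P); last by rewrite XE.
split=> //; apply: psd_unit_posdef => // [|v].
  by rewrite /P !ctrmxM ctrmxK hX mulmxA.
have := pX (Y *m v); rewrite ctrmxM /P /Ppart /= !mulmxA //.
Qed.

Context {n p : nat}.
Local Notation E := (rmx R k n p * rmx R k p p)%type.
Local Notation M := (@total_space R k n p).
Implicit Types S w xi eta : E.

(** Equal products have equal ranges, so Y Y^H fixes Y' and the group element must be U = Y^H Y'. *)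
Lemma quo_proj_fiber S S' : M S -> M S' ->
  quo_proj S = quo_proj S' <-> exists2 U, unitary U & S' = Uact S U.
Proof.
move=> [YS pS] [YS' pS']; have YY : (Ypart S)^H *m Ypart S = 1%:M by [].
have YY' : (Ypart S')^H *m Ypart S' = 1%:M by [].
have uP := posdef_unit pS; have uP' := posdef_unit pS'.
rewrite /quo_proj; split=> [e|[U uU ->]]; last first.
  have UU : U *m U^H = 1%:M by rewrite mulmx1C.
  rewrite /Uact !partE ctrmxM !mulmxA -(mulmxA _ U U^H) UU mulmx1.
  by rewrite -(mulmxA _ U U^H) UU mulmx1.
pose U := (Ypart S)^H *m Ypart S'.
have YU : Ypart S *m U = Ypart S'.
  have h : Ypart S' = Ypart S *m (Ppart S *m (Ypart S)^H *m Ypart S' *m invmx (Ppart S')).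
    by rewrite !mulmxA e -(mulmxA _ _ (Ypart S')) YY' mulmx1 mulmxK.
  by rewrite /U [in LHS]h !mulmxA -(mulmxA _ _ (Ypart S)) YY mulmx1 [in RHS]h !mulmxA.
exists U.
  by rewrite /unitary /stiefel /= /U ctrmxM ctrmxK -mulmxA -/U YU.
apply: E_ext; rewrite /Uact !partE ?YU //.
have -> : Ppart S' = (Ypart S')^H *m (Ypart S' *m Ppart S' *m (Ypart S')^H) *m Ypart S'.
  by rewrite -!mulmxA YY' mulmx1 mulmxA YY' mul1mx.
by rewrite -e /U ctrmxM ctrmxK !mulmxA.
Qed.

End Quotient.

(** A nonzero d would fix the sign of all small difference quotients, but at a minimum they have
    opposite weak signs for h and -h; [near_pt] produces an h usable with both signs. *)
Lemma deriv_at_min (R : realType) (f : R -> R) d :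
  is_derive (0 : R) (1 : R) f d -> (\forall t \near (0 : R), f 0 <= f t) -> d = 0.
Proof.
move=> /is_deriveP hd hf.
have near_pt (P : R -> Prop) : (\forall h \near 0^', P h) -> exists h : R, 0 < h /\ P h /\ P (- h).
  move=> /nbhs_ballP[e /= e0 eP]; exists (e / 2); have e2 : 0 < e / 2 by rewrite divr_gt0.
  have e3 : e / 2 < e by rewrite ltr_pdivrMr // mulr_natr mulr2n ltrDl.
  split=> //; split; apply: eP; rewrite /ball /= ?sub0r ?opprK ?normrN ?gtr0_norm //.
  - by rewrite gt_eqF.
  - by rewrite oppr_eq0 gt_eqF.
have nf : \forall h \near 0^', f 0 <= f (h *: 1 + 0).
  have : \forall h \near 0^', f 0 <= f h by apply: cvg_within hf.
  by apply: filterS => h; rewrite [h *: 1]mulr1 addr0.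
apply/eqP; rewrite eq_le; apply/andP; split; rewrite leNgt; apply/negP => d0.
- have /(_ _) c1 := cvgr_gt _ hd _ d0.
  have [h [h0 [_ [q1 q2]]]] := near_pt _ (filterI c1 nf).
  move: q1; rewrite /= ltNge => /negP; apply.
  by rewrite invrN scaleNr oppr_le0 mulr_ge0 ?invr_ge0 ?(ltW h0) // subr_ge0.
- have /(_ _) c1 := cvgr_lt _ hd _ d0.
  have [h [h0 [[q1 q2] _]]] := near_pt _ (filterI c1 nf).
  move: q1; rewrite /= ltNge => /negP; apply.
  by rewrite mulr_ge0 ?invr_ge0 ?(ltW h0) // subr_ge0.
Qed.

Section QuotientGeometry.
Context {R : realType} {k : scalars} {n p : nat}.
Local Notation K := (scal R k).
Local Notation rM m n := (rmx R k m n).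
Local Notation E := (rmx R k n p * rmx R k p p)%type.
Local Notation M := (@total_space R k n p).
Local Notation B := (@psd_rank R k n p).
Implicit Types S w xi eta : E.

Definition dquo S eta : rM n n :=
  Ypart eta *m Ppart S *m (Ypart S)^H + Ypart S *m Ppart eta *m (Ypart S)^H
  + Ypart S *m Ppart S *m (Ypart eta)^H.

Lemma is_dirD_quo S eta : tangent_space M S eta ->
  is_dirD M quo_proj S eta (dquo S eta).
Proof.
move=> eT; have dY := is_dirD_fst eT; have dP := is_dirD_snd eT.
have := is_dirD_rmul (is_dirD_rmul dY dP) (is_dirD_rctr dY).
rewrite /rmul mulmxDl; exact.
Qed.

Lemma dquoD S (x : R) (a b : E) : dquo S (x *: a + b) = x *: dquo S a + dquo S b.
Proof.
have -> : x *: dquo S a + dquo S b = x%:K *: (dquo S a : 'M[K]_n) + dquo S b :> 'M[K]_n by [].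
rewrite /dquo !partE ctrmxD ctrmxZr; mxnorm; mxring.
Qed.

Lemma dquo_vert S a : a^H = - a -> dquo S (vert S a) = 0.
Proof.
move=> ha; rewrite /dquo /vert !partE ctrmxM ha; mxnorm; mxring.
Qed.

Lemma dquo_tangent S eta : M S -> tangent_space M S eta ->
  tangent_space B (quo_proj S) (dquo S eta).
Proof.
move=> MS eT; have [_ hq] := is_dirD_quo eT; have [c hc] := eT.
exists (quo_proj \o c); have [c0 cM _] := hc; split.
- by rewrite /= c0.
- by apply: filterS cM => t; exact: quo_proj_psd.
- exact: hq.
Qed.

(** Multiplying dquo = 0 by Y on the right, and then by Y^H on the left, gives eta_P = P a - a P;
    substituting it back and cancelling P gives eta_Y = Y a. *)
Lemma dquo_ker S eta : M S -> tangent_space M S eta -> dquo S eta = 0 ->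
  exists2 a, a^H = - a & eta = vert S a.
Proof.
move=> MS eT d0; have [YS pS] := MS; have YY : (Ypart S)^H *m Ypart S = 1%:M by [].
have [hY hP] := (tangentP _ MS).1 eT; have uP := posdef_unit pS.
set a := (Ypart S)^H *m Ypart eta.
have ha' : (Ypart eta)^H *m Ypart S = - a by apply/eqP; rewrite -addr_eq0; apply/eqP.
have ha : a^H = - a by rewrite /a ctrmxM ctrmxK.
have e1 : Ypart eta *m Ppart S + Ypart S *m Ppart eta - Ypart S *m Ppart S *m a = 0.
  have := congr1 (fun X : 'M[K]_n => X *m Ypart S) d0.
  rewrite /dquo mul0mx !mulmxDl -!(mulmxA _ (_^H) (Ypart S)) YY !mulmx1 ha'.
  by rewrite mulmxN.
have e2 : Ppart eta = Ppart S *m a - a *m Ppart S.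
  have := congr1 (mulmx (Ypart S)^H) e1.
  rewrite mulmx0 mulmxBr mulmxDr !mulmxA YY !mul1mx -/a => /eqP.
  by rewrite subr_eq0 => /eqP <-; rewrite addrAC subrr add0r.
exists a => //; apply: E_ext => //; rewrite /vert !partE.
apply: (can_inj (mulmxK uP)); move/eqP: e1.
by rewrite e2 mulmxBr !mulmxA addrA addrAC addrK subr_eq0 => /eqP.
Qed.

(* For [w = Q u], t |-> w^H X(t) w is nonnegative and vanishes at t = 0. *)
Lemma tangent_psd S v : M S -> tangent_space B (quo_proj S) v ->
  let Q := 1%:M - Ypart S *m (Ypart S)^H in
  (v : 'M[K]_n)^H = v /\ Q *m v *m Q = 0.
Proof.
move=> [YS pS] vT Q; have YY : (Ypart S)^H *m Ypart S = 1%:M by [].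
have dv := is_dirD_id vT.
have hv : (v : 'M[K]_n)^H = v.
  have /(is_dirD_ext (G := id)) := is_dirD_rctr dv.
  move=> h; apply: (is_dirD_unique (h _) dv); by move=> X [].
split=> //; have hQ : Q^H = Q by rewrite /Q ctrmxB ctrmx1 ctrmxM ctrmxK.
apply: herm_form0 => [|u]; first by rewrite !ctrmxM hQ hv mulmxA.
rewrite -!mulmxA ip_adjl hQ; set w := Q *m u.
have dw := is_dirD_cst (w : rM n 1) vT.
have [_ df] := is_dirD_bilinear (@rip_bdd R k n 1) (is_dirD_rmul dv dw) dw.
have [c hc] := vT; have := df c hc; have [c0 cB _] := hc.
rewrite /rmul /rip /cst mulmx0 addr0 ip0r addr0.
set f := (f in is_derive _ _ f _) => /deriv_at_min; apply.
have f0 : f 0 = 0.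
  rewrite /f /= c0 /quo_proj -!mulmxA.
  have -> : (Ypart S)^H *m w = 0.
    by rewrite /w mulmxA mulmxDr mulmxN mulmxA YY mul1mx mulmx1 subrr mul0mx.
  by rewrite !mulmx0 ip0l.
rewrite f0; apply: filterS cB => t [_ pc _]; rewrite /f /=.
by rewrite -form_ipr -(@inK_ge0 _ k) -ge0_inK.
Qed.

Lemma dquo_surj S v : M S -> tangent_space B (quo_proj S) v ->
  exists2 eta, tangent_space M S eta & dquo S eta = v.
Proof.
move=> MS vT; have [hv Qv] := tangent_psd MS vT.
have [YS pS] := MS; have YY : (Ypart S)^H *m Ypart S = 1%:M by [].
set Q := 1%:M - _ in Qv; have hQ : Q^H = Q by rewrite /Q ctrmxB ctrmx1 ctrmxM ctrmxK.
have uP := posdef_unit pS; have YQ : (Ypart S)^H *m Q = 0.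
  by rewrite /Q mulmxBr mulmxA YY mul1mx mulmx1 subrr.
have QY : Q *m Ypart S = 0 by rewrite -[RHS](ctrmx0 _ _) -YQ ctrmxM ctrmxK hQ.
(* Its image consists of the blocks of v cut out by Y Y^H and Q, except Q v Q, which vanishes for
   tangent v. The Y component lies in the range of Q, so the first tangency equation is
   immediate. *)
pose eta : E := mkE (Q *m v *m Ypart S *m invmx (Ppart S)) ((Ypart S)^H *m v *m Ypart S).
exists eta.
  apply/tangentP => //; rewrite /eta !partE; split.
    rewrite !ctrmxM hQ -!mulmxA QY !mulmx0 add0r.
    by rewrite (mulmxA (Ypart S)^H Q) YQ mul0mx.
  by rewrite !ctrmxM ctrmxK hv mulmxA.
rewrite /dquo /eta !partE mulmxKV // !ctrmxM hQ hv (posdef_inv_herm pS).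
rewrite !mulmxA mulmxK //.
have vE : v = Ypart S *m (Ypart S)^H *m v + v *m Ypart S *m (Ypart S)^H
    - Ypart S *m (Ypart S)^H *m v *m Ypart S *m (Ypart S)^H.
  apply/eqP; rewrite -subr_eq0 -Qv /Q; apply/eqP; mxnorm.
  by rewrite !(mulmx1, mul1mx); mxring.
rewrite [RHS]vE /Q; mxnorm; rewrite !(mulmx1, mul1mx); mxring.
Qed.

Variables alpha0 alpha1 beta : R.
Hypotheses (ha0 : 0 < alpha0) (ha1 : 0 < alpha1) (hb : 0 < beta).
Local Notation h := (@metric_form R k n p alpha0 alpha1 beta).
Local Notation H := (@horizontal_space R k n p alpha0 alpha1 beta).
Local Notation PiH := (@hproj R k n p alpha0 alpha1 beta).

Lemma dquo_hproj S w : M S -> tangent_space M S w -> dquo S (PiH S w) = dquo S w.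
Proof.
move=> MS wT; have [a ha {2}->] := tangent_split ha0 ha1 hb MS wT.
rewrite -[PiH S w in RHS]scale1r dquoD dquo_vert // addr0 scale1r //.
Qed.

Lemma horizontal_dquo0 S eta : M S -> H S eta -> dquo S eta = 0 -> eta = 0.
Proof.
move=> MS He d0; have eT := He.1; have [a ha e] := dquo_ker MS eT d0.
apply/eqP; apply: contraT => /(metric_form_gt0 ha0 ha1 hb MS).
have := He.2 _ (vert_tangent MS ha); rewrite -e => ->; by rewrite ltxx.
Qed.

Lemma horizontal_dquo_inj S a b : M S -> H S a -> H S b -> dquo S a = dquo S b -> a = b.
Proof.
move=> MS Ha Hb e; apply/eqP; rewrite -subr_eq0; apply/eqP.
have aE : a - b = (-1) *: b + a by rewrite scaleN1r addrC.
apply: (horizontal_dquo0 MS); rewrite aE; first exact: horizontal_lin.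
by rewrite dquoD e scaleN1r addNr.
Qed.

Lemma horizontal_lift_exists S v : M S -> tangent_space B (quo_proj S) v ->
  exists2 eta, H S eta & dquo S eta = v.
Proof.
move=> MS vT; have [eta eT ev] := dquo_surj MS vT.
by exists (PiH S eta); [exact: hproj_hor|rewrite dquo_hproj].
Qed.

End QuotientGeometry.

(** One entry of the Y component of g(g^-1 w): [x] is an entry of w_Y and [y] the corresponding
    entry of Y Y^H w_Y, after Y Y^H has been used as an idempotent. *)
Lemma two_block_inverse (F : fieldType) (a b x y : F) : a != 0 -> b != 0 ->
  a * (a^-1 * x) + a * ((b^-1 - a^-1) * y)
  + ((b - a) * (a^-1 * y) + (b - a) * ((b^-1 - a^-1) * y)) = x.
Proof. by move=> a0 b0; field; rewrite a0 b0. Qed.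

(** * The inverse of the metric operator and equivariance under the unitary group *)

Section Equivariance.
Context {R : realType} {k : scalars} {n p : nat}.
Local Notation K := (scal R k).
Local Notation rM m n := (rmx R k m n).
Local Notation E := (rmx R k n p * rmx R k p p)%type.
Local Notation M := (@total_space R k n p).
Local Notation B := (@psd_rank R k n p).
Implicit Types S w xi eta : E.
Variables alpha0 alpha1 beta : R.
Hypotheses (ha0 : 0 < alpha0) (ha1 : 0 < alpha1) (hb : 0 < beta).
Local Notation g := (@metric_op R k n p alpha0 alpha1 beta).
Local Notation h := (@metric_form R k n p alpha0 alpha1 beta).
Local Notation H := (@horizontal_space R k n p alpha0 alpha1 beta).
Local Notation PiH := (@hproj R k n p alpha0 alpha1 beta).

(** On w_Y the operator g is alpha1 on the range of Y Y^H and alpha0 on the complement; the inverse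
    has the same shape with reciprocals. *)
Definition ginv S w : E :=
  let Y := Ypart S in let P := Ppart S in
  mkE ((alpha0^-1)%:K *: Ypart w
         + (alpha1^-1 - alpha0^-1)%:K *: (Y *m Y^H *m Ypart w))
      ((beta^-1)%:K *: (P *m Ppart w *m P)).

Lemma metric_op_ginv S w : M S -> g S (ginv S w) = w.
Proof.
move=> [YS pS]; have YY : (Ypart S)^H *m Ypart S = 1%:M by [].
have uP := posdef_unit pS.
have a0 : alpha0%:K != 0 :> K by rewrite fmorph_eq0 gt_eqF.
have a1 : alpha1%:K != 0 :> K by rewrite fmorph_eq0 gt_eqF.
have b0 : beta%:K != 0 :> K by rewrite fmorph_eq0 gt_eqF.
apply: E_ext; rewrite /metric_op /ginv !partE.
  mxnorm; rewrite -!(mulmxA _ (_^H) (Ypart S)) YY !mulmx1.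
  apply/matrixP => i j; rewrite !(mxDE, mxNE, mxZE) !raddfB /= !fmorphV /=.
  exact: two_block_inverse.
rewrite -scalemxAr -scalemxAl -!mulmxA mulmxV // mulmx1 mulKmx // scalerA fmorphV /= divff //.
by rewrite scale1r.
Qed.

Lemma ginv_metric_op S w : M S -> ginv S (g S w) = w.
Proof.
move=> MS; have e := metric_op_ginv (g S w) MS.
have d : g S (ginv S (g S w) - w) = 0.
  rewrite -[ginv S _ - w]addrC -scaleN1r metric_opD metric_opZ e scaleN1r addNr //.
apply/eqP; rewrite -subr_eq0; apply: contraT => /(metric_form_gt0 ha0 ha1 hb MS).
by rewrite /metric_form d /ipA !ip0r addr0 ltxx.
Qed.

Lemma opinv_metric_op S w : M S -> opinv (g S) w = ginv S w.
Proof.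
move=> MS; apply: opinvP; last exact: metric_op_ginv.
exact: (can_inj (fun w => ginv_metric_op w MS)).
Qed.

Lemma metric_form_ginv S w eta : M S -> h S eta (ginv S w) = ipA eta w.
Proof. by move=> MS; rewrite /metric_form metric_op_ginv. Qed.

Lemma UactDZ (U : 'M[K]_p) (x : R) (a b : E) :
  Uact (x *: a + b) U = x *: Uact a U + Uact b U.
Proof. apply: E_ext; rewrite /Uact !partE; mxnorm; mxring. Qed.

Lemma Uact_bdd (U : 'M[K]_p) : bdd_linear (fun w : E => Uact w U).
Proof.
have bM m q r (A : rM q r) : bdd_linear (fun X : rM m q => rmul X A).
  by apply: Klinear_bdd => *; [exact: mulmxDl|rewrite scalemxAl].
have bM' m q r (A : rM m q) : bdd_linear (fun X : rM q r => rmul A X).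
  by apply: Klinear_bdd => *; [exact: mulmxDr|rewrite scalemxAr].
have b1 : bdd_linear (fun w : E => ((rmul w.1 U : rM n p), 0 : rM p p) : E).
  exact: (bdd_linear_comp (bdd_linear_comp (fst_bdd _ _) (bM _ _ _ U)) (inl_bdd _ _)).
have b2 : bdd_linear (fun w : E => ((0 : rM n p), rmul (rmul (U^H : rM p p) w.2) U) : E).
  exact: (bdd_linear_comp (bdd_linear_comp (bdd_linear_comp (snd_bdd _ _)
    (bM' _ _ _ (U^H))) (bM _ _ _ U)) (inr_bdd _ _)).
have [_ _ [C1 C10 h1]] := b1; have [_ _ [C2 C20 h2]] := b2.
have e (w : E) : Uact w U = ((rmul w.1 U : rM n p), 0 : rM p p)
    + ((0 : rM n p), rmul (rmul (U^H : rM p p) w.2) U) :> E.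
  by apply: E_ext; rewrite /Uact !partE /Ypart /Ppart /= ?addr0 ?add0r.
split=> [u v|a u|].
- by have := UactDZ U 1 u v; rewrite !scale1r.
- have U0 : Uact (0 : E) U = 0 :> E.
    by apply: E_ext; rewrite /Uact !partE /Ypart /Ppart /= ?mul0mx ?mulmx0 ?mul0mx.
  by have := UactDZ U a u 0; rewrite U0 !addr0.
- exists (C1 + C2) => [|u]; first exact: addr_ge0.
  by rewrite e mulrDl (le_trans (ler_normD _ _)) // lerD.
Qed.

Section Unitary.
Variables (U : 'M[K]_p) (uU : unitary U).

Let UU : U^H *m U = 1%:M. Proof. exact: uU. Qed.
Let UU' : U *m U^H = 1%:M. Proof. by rewrite mulmx1C. Qed.

Lemma unitary_ctr : unitary U^H.
Proof. by rewrite /unitary /stiefel /= ctrmxK. Qed.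

Lemma UactK w : Uact (Uact w U) U^H = w.
Proof.
apply: E_ext; rewrite /Uact !partE ?ctrmxK -?mulmxA UU' ?mulmx1 //.
by rewrite !mulmxA UU' mul1mx.
Qed.

Lemma UactVK w : Uact (Uact w U^H) U = w.
Proof.
apply: E_ext; rewrite /Uact !partE ?ctrmxK -?mulmxA UU ?mulmx1 //.
by rewrite !mulmxA UU mul1mx.
Qed.

Lemma Uact_total S : M S -> M (Uact S U).
Proof. by move=> MS; apply: (orbit_in MS); exists U. Qed.

Lemma invmx_conj (P : 'M[K]_p) : P \in unitmx ->
  invmx (U^H *m P *m U) = U^H *m invmx P *m U.
Proof.
move=> uP; have uUP : U^H *m P *m U \in unitmx.
  have [u1 u2] := mulmx1_unit UU; by rewrite !unitmx_mul u1 u2 uP.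
apply: (can_inj (mulKmx uUP)); rewrite mulmxV // !mulmxA -(mulmxA _ U) UU' mulmx1.
by rewrite -(mulmxA _ P) mulmxV // mulmx1 UU.
Qed.

Lemma quo_proj_Uact S : M S -> quo_proj (Uact S U) = quo_proj S.
Proof. by move=> MS; apply/esym/quo_proj_fiber => //; [exact: Uact_total|exists U]. Qed.

Lemma ip_conj (A C : 'M[K]_p) : ip (U^H *m A *m U) (U^H *m C *m U) = ip A C.
Proof.
rewrite ip_adjr -(mulmxA _ U) UU' mulmx1 ip_adjl ctrmxK !mulmxA UU' mul1mx.
by [].
Qed.

Lemma ip_mulr m (A C : 'M[K]_(m, p)) : ip (A *m U) (C *m U) = ip A C.
Proof. by rewrite ip_adjr -mulmxA UU' mulmx1. Qed.

Lemma metric_form_Uact S a b : M S -> h (Uact S U) (Uact a U) (Uact b U) = h S a b.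
Proof.
move=> MS; have [YS pS] := MS; have uP := posdef_unit pS.
rewrite !metric_formE //; last exact: Uact_total.
rewrite /Uact !partE ip_mulr ctrmxM invmx_conj // !mulmxA.
congr (_ + _ * _ + _ * _).
  by rewrite -(mulmxA U^H _ (Ypart a)) -(mulmxA U^H _ (Ypart b)) ip_conj.
rewrite -!(mulmxA _ U U^H) UU' !mulmx1.
by rewrite -(mulmxA U^H _ (Ppart a)) -(mulmxA U^H _ (invmx _)) ip_conj.
Qed.

Lemma tangent_Uact S eta : M S -> tangent_space M S eta ->
  tangent_space M (Uact S U) (Uact eta U).
Proof.
move=> MS /(tangentP _ MS)[hY hP]; apply/tangentP; first exact: Uact_total.
rewrite /Uact !partE !ctrmxM ctrmxK hP !mulmxA; split=> //.
by have := congr1 (fun X => U^H *m X *m U) hY; rewrite mulmx0 mul0mx mulmxDr mulmxDl !mulmxA.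
Qed.

Lemma horizontal_Uact S eta : M S -> H S eta -> H (Uact S U) (Uact eta U).
Proof.
move=> MS /(horizontalE alpha0 beta ha1 _ MS)[he hP].
have [YS pS] := MS; have uP := posdef_unit pS.
apply/horizontalE => //; first exact: Uact_total.
split; last by rewrite /Uact !partE !ctrmxM ctrmxK hP mulmxA.
suff -> : hor_eq alpha1 beta (Uact S U) (Uact eta U) = U^H *m hor_eq alpha1 beta S eta *m U.
  by rewrite he mulmx0 mul0mx.
rewrite /hor_eq /Uact !partE ctrmxM invmx_conj // !mulmxA.
rewrite -!(mulmxA _ U U^H) UU' !mulmx1; mxnorm; mxring.
Qed.

Lemma dquo_Uact S eta : dquo (Uact S U) (Uact eta U) = dquo S eta.
Proof.
by rewrite /dquo /Uact !partE !ctrmxM !mulmxA -!(mulmxA _ U U^H) UU' !mulmx1.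
Qed.

Lemma ginv_Uact S w : ginv (Uact S U) (Uact w U) = Uact (ginv S w) U.
Proof.
apply: E_ext; rewrite /ginv /Uact !partE ?ctrmxM !mulmxA -!(mulmxA _ U U^H) UU' ?mulmx1;
  mxnorm; mxring.
Qed.

Lemma Kop_Uact S a b : M S -> Kop alpha0 alpha1 beta (Uact S U) (Uact a U) (Uact b U) =
  Uact (Kop alpha0 alpha1 beta S a b) U.
Proof.
move=> [YS pS]; have uP := posdef_unit pS.
apply: E_ext; rewrite /Kop /Uact !partE ?invmx_conj // ?ctrmxM; mxnorm;
  rewrite -?(mulmxA _ U U^H) UU' ?mulmx1; mxring.
Qed.

End Unitary.

(** The group acts by isometries that preserve horizontality, so the moved projection has the
    property that characterizes the projection at the moved point. *)
Lemma hproj_Uact (U : 'M[K]_p) S w : unitary U -> M S ->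
  PiH (Uact S U) (Uact w U) = Uact (PiH S w) U.
Proof.
move=> uU MS; have MU := Uact_total uU MS; apply: hproj_unique => //.
  by apply: horizontal_Uact => //; exact: hproj_hor.
move=> u Hu.
have -> : Uact w U - Uact (PiH S w) U = Uact (w - PiH S w) U.
  by rewrite addrC -scaleN1r -UactDZ scaleN1r addrC.
rewrite -(UactVK uU u) metric_form_Uact //; apply: hproj_orth => //.
have := horizontal_Uact (unitary_ctr uU) MU Hu.
by rewrite UactK.
Qed.

End Equivariance.

(** * The connection *)

Section LinearFamily.
Context {R : realType} {V : normedModType R} (M : set V).

Lemma scale_bdd (W : normedModType R) :
  bdd_bilinear (fun (a : R) (w : W) => a *: w).
Proof.
split=> [a b w|a u v|a b w|a b w|].
- exact: scalerDl.
- exact: scalerDr.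
- by rewrite scalerA.
- by rewrite !scalerA mulrC.
- by exists 1 => // a w; rewrite mul1r normrZ.
Qed.

Lemma is_dirD_sum (W : normedModType R) (I : Type) (r : seq I) (F : I -> V -> W) x xi d :
  tangent_space M x xi -> (forall i, is_dirD M (F i) x xi (d i)) ->
  is_dirD M (fun y => \sum_(i <- r) F i y) x xi (\sum_(i <- r) d i).
Proof.
move=> xT hF; elim: r => [|i r IH].
  rewrite big_nil; apply: (is_dirD_ext _ (is_dirD_cst (0 : W) xT)) => y _.
  by rewrite big_nil.
rewrite big_cons; apply: (is_dirD_ext _ (is_dirDD (hF i) IH)) => y _.
by rewrite big_cons.
Qed.

(* Expanding F in coordinates reduces this to the product rule for a scalar and a
   vector. *)
Lemma is_dirD_family (W W' : normedModType R) (A : V -> W -> W') (dA : W -> W')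
    (F : V -> W) x xi dF : has_coords W -> M x ->
  (forall y, M y -> forall a u v, A y (a *: u + v) = a *: A y u + A y v) ->
  (forall w, is_dirD M (fun y => A y w) x xi (dA w)) -> is_dirD M F x xi dF ->
  is_dirD M (fun y => A y (F y)) x xi (dA (F x) + A x dF).
Proof.
move=> [I [l [e [hl decomp]]]] Mx Alin hA hF; have xT := hF.1.
have A0 y : M y -> A y 0 = 0.
  by move=> My; have := Alin y My (-1) 0 0; rewrite scaler0 addr0 scaleN1r addNr.
have Aexp y w : M y -> A y w = \sum_i l i w *: A y (e i).
  move=> My.
  have AD u v : A y (u + v) = A y u + A y v by rewrite -{1}[u]scale1r Alin // scale1r.
  rewrite {1}[w]decomp (big_morph (A y) AD (A0 y My)); apply: eq_bigr => i _.
  by rewrite -[l i w *: e i]addr0 Alin // A0 // addr0.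
have dAexp w : dA w = \sum_i l i w *: dA (e i).
  apply: is_dirD_unique (hA w) _.
  apply: (is_dirD_ext _ (is_dirD_sum (index_enum I) xT (fun i => is_dirDZ (l i w) (hA (e i))))).
  by move=> y My; rewrite [RHS]Aexp.
have := is_dirD_sum (index_enum I) xT (fun i =>
  is_dirD_bilinear (scale_bdd W') (is_dirD_linear (hl i) hF) (hA (e i))).
rewrite big_split /= -Aexp // -dAexp addrC; apply: is_dirD_ext => y My.
by rewrite [RHS]Aexp.
Qed.

End LinearFamily.

(** The [n] are pairings with nabla, the [d] the same pairings with the ambient derivative, the [p]
    the derivatives of the metric. The first three equations are metric compatibility in cyclic
    order, the next three vanishing torsion. *)
Lemma koszul_arith (R : realType) (n1 n2 n3 n4 n5 n6 d1 d2 d3 d4 d5 d6 p1 p2 p3 c : R) :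
  n1 + n2 = d1 + (p1 + d2) -> n3 + n4 = d3 + (p2 + d4) -> n5 + n6 = d5 + (p3 + d6) ->
  n1 - n4 = d1 - d4 -> n2 - n5 = d2 - d5 -> n3 - n6 = d3 - d6 ->
  p1 + p2 - p3 = 2 * c -> n1 = d1 + c.
Proof. lra. Qed.

(** * The Koszul formula in the ambient space *)

Section Koszul.
Context {R : realType} {k : scalars} {n p : nat}.
Local Notation K := (scal R k).
Local Notation rM m n := (rmx R k m n).
Local Notation E := (rmx R k n p * rmx R k p p)%type.
Local Notation M := (@total_space R k n p).
Implicit Types S w : E.
Variables alpha0 alpha1 beta : R.
Hypotheses (ha0 : 0 < alpha0) (ha1 : 0 < alpha1) (hb : 0 < beta).
Local Notation g := (@metric_op R k n p alpha0 alpha1 beta).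
Local Notation h := (@metric_form R k n p alpha0 alpha1 beta).
Local Notation H := (@horizontal_space R k n p alpha0 alpha1 beta).
Local Notation PiH := (@hproj R k n p alpha0 alpha1 beta).
Local Notation Kop := (@Kop R k n p alpha0 alpha1 beta).

Definition dmetric S (xi w : E) : E :=
  let Y := Ypart S in let Pi := invmx (Ppart S) in
  let xY := Ypart xi in let xP := Ppart xi in
  mkE ((alpha1 - alpha0)%:K *: ((xY *m Y^H + Y *m xY^H) *m Ypart w))
      (- beta%:K *: (Pi *m xP *m Pi *m Ppart w *m Pi + Pi *m Ppart w *m Pi *m xP *m Pi)).

Lemma is_dirD_metric_op S (xi w : E) : tangent_space M S xi ->
  is_dirD M (fun S' => g S' w) S xi (dmetric S xi w).
Proof.
move=> xT; have dY := is_dirD_fst xT; have dPi := is_dirD_Pinv xT.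
have wY := is_dirD_cst (w.1 : rM n p) xT; have wP := is_dirD_cst (w.2 : rM p p) xT.
have d1 := is_dirDD (is_dirDZ alpha0 wY) (is_dirDZ (alpha1 - alpha0)
  (is_dirD_rmul (is_dirD_rmul dY (is_dirD_rctr dY)) wY)).
have d2 := is_dirDZ beta (is_dirD_rmul (is_dirD_rmul dPi wP) dPi).
have := is_dirD_pair d1 d2; set v := (v in is_dirD _ _ _ _ v).
have -> : v = dmetric S xi w; last exact.
apply: E_ext; rewrite /v /dmetric !partE /Ypart /Ppart /= /rmul /rctr /rinv /cst.
  by rewrite mulmx0 scaler0 add0r addr0.
rewrite mulmx0 addr0 scaleNr -scalerN; congr (_ *: _).
by mxnorm; mxring.
Qed.

Lemma is_dirD_ipA S (xi : E) (F G : E -> E) dF dG :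
  is_dirD M F S xi dF -> is_dirD M G S xi dG ->
  is_dirD M (fun y => ipA (F y) (G y)) S xi (ipA dF (G S) + ipA (F S) dG).
Proof.
move=> hF hG.
have := is_dirDD (is_dirD_bilinear (@rip_bdd R k n p) (is_dirD_linear (fst_bdd _ _) hF)
    (is_dirD_linear (fst_bdd _ _) hG))
  (is_dirD_bilinear (@rip_bdd R k p p) (is_dirD_linear (snd_bdd _ _) hF)
    (is_dirD_linear (snd_bdd _ _) hG)).
by rewrite addrACA.
Qed.

Lemma metric_op_lin S (a : R) (u v : E) : g S (a *: u + v) = a *: g S u + g S v.
Proof. by rewrite metric_opD metric_opZ. Qed.

Lemma is_dirD_metric_form S (xi : E) (F G : E -> E) dF dG : M S ->
  is_dirD M F S xi dF -> is_dirD M G S xi dG ->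
  is_dirD M (fun y => h y (F y) (G y)) S xi
    (h S dF (G S) + (ipA (F S) (dmetric S xi (G S)) + h S (F S) dG)).
Proof.
move=> MS hF hG; have xT := hF.1.
have hg := is_dirD_family (@has_coords_E R k n p) MS (fun y _ => @metric_op_lin y)
  (fun w => is_dirD_metric_op w xT) hG.
have := is_dirD_ipA hF hg.
by rewrite [ipA (F S) (_ + _)]ipADr.
Qed.

(** Half of this combination of derivatives of g is the correction term of the Koszul formula;
    adjunction moves every factor off [zeta] and exhibits [Kop]. In the P component the three
    derivatives coincide, so one of them remains. *)
Lemma Kop_sym S (xi eta zeta : E) : M S -> tangent_space M S xi -> tangent_space M S eta ->
  tangent_space M S zeta ->
  ipA eta (dmetric S xi zeta) + ipA zeta (dmetric S eta xi) - ipA xi (dmetric S zeta eta)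
  = 2 * ipA (Kop S xi eta) zeta.
Proof.
move=> MS xT eT zT; have [_ pS] := MS.
have [hxY hxP] := (tangentP _ MS).1 xT; have [heY heP] := (tangentP _ MS).1 eT.
have [hzY hzP] := (tangentP _ MS).1 zT; have Pih := posdef_inv_herm pS.
rewrite /ipA /dmetric /Defs.Kop !partE.
set Y := Ypart S; set Pi := invmx (Ppart S) in Pih *.
set xY := Ypart xi in hxY *; set eY := Ypart eta in heY *; set zY := Ypart zeta in hzY *.
set xP := Ppart xi in hxP *; set eP := Ppart eta in heP *; set zP := Ppart zeta in hzP *.
(* Tangency turns xi_Y Y^H eta_Y into -xi_Y eta_Y^H Y, and symmetrically. These terms join those of
   the third derivative, which explains the factor 2 in K_Y. *)
have zx : (Y^H *m eY) = - (eY^H *m Y) by apply/eqP; rewrite -addr_eq0 addrC; apply/eqP.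
have xx : (Y^H *m xY) = - (xY^H *m Y) by apply/eqP; rewrite -addr_eq0 addrC; apply/eqP.
have partY : ip eY ((xY *m Y^H + Y *m xY^H) *m zY) + ip zY ((eY *m Y^H + Y *m eY^H) *m xY)
    - ip xY ((zY *m Y^H + Y *m zY^H) *m eY)
  = ip (Y *m (eY^H *m xY + xY^H *m eY) - 2%:R *: ((eY *m xY^H + xY *m eY^H) *m Y)) zY.
  have e1 : ip eY ((xY *m Y^H + Y *m xY^H) *m zY) = ip ((Y *m xY^H + xY *m Y^H) *m eY) zY.
    by rewrite ipC ip_adjl ipC ctrmxD !ctrmxM !ctrmxK.
  have e2 (A C : 'M[K]_(n, p)) : ip A (zY *m Y^H *m C) = ip (A *m C^H *m Y) zY.
    by rewrite -mulmxA ipC ip_adjr ipC ctrmxM ctrmxK mulmxA.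
  have e3 : ip xY (Y *m zY^H *m eY) = ip (eY *m xY^H *m Y) zY.
    rewrite -mulmxA ipC ip_adjl -ip_ctr !ctrmxM !ctrmxK ip_adjr.
    have -> : xY^H *m Y *m zY^H = (zY *m Y^H *m xY)^H by rewrite !ctrmxM ctrmxK mulmxA.
    by rewrite ip_ctr e2.
  rewrite e1 (ipC zY) (mulmxDl (zY *m _)) (ipDr _ _ xY) e2 e3 -!ipDl -ipBl; congr ip.
  mxnorm; rewrite -!(mulmxA _ Y^H) zx xx; mxnorm; mxring.
have partP : ip eP (Pi *m xP *m Pi *m zP *m Pi + Pi *m zP *m Pi *m xP *m Pi)
   + ip zP (Pi *m eP *m Pi *m xP *m Pi + Pi *m xP *m Pi *m eP *m Pi)
   - ip xP (Pi *m zP *m Pi *m eP *m Pi + Pi *m eP *m Pi *m zP *m Pi)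
  = ip (Pi *m eP *m Pi *m xP *m Pi + Pi *m xP *m Pi *m eP *m Pi) zP.
  have adj (A L N : 'M[K]_p) : ip A (L *m zP *m N) = ip (L^H *m A *m N^H) zP.
    by rewrite ipC ip_adjr ip_adjl ipC mulmxA.
  have q (A C : 'M[K]_p) : A^H = A -> ip C (Pi *m zP *m Pi *m A *m Pi) = ip (Pi *m C *m Pi *m A *m Pi) zP.
    move=> hA; have -> : Pi *m zP *m Pi *m A *m Pi = Pi *m zP *m (Pi *m A *m Pi) by rewrite !mulmxA.
    by rewrite adj !ctrmxM hA Pih !mulmxA.
  have q' (A C : 'M[K]_p) : A^H = A -> ip C (Pi *m A *m Pi *m zP *m Pi) = ip (Pi *m A *m Pi *m C *m Pi) zP.
    by move=> hA; rewrite adj !ctrmxM hA Pih !mulmxA.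
  rewrite !ipDr !q // !q' // (ipC zP) (ipC zP) -!ipDl -ipBl; congr ip; mxring.
rewrite !scaleNr !(ipNr, ipNl) !(ipZr, ipZl) -partY -partP.
move: (ip _ _) (ip _ _) (ip _ _) (ip _ _) (ip _ _) (ip _ _) => a1 a2 a3 b1 b2 b3.
by field.
Qed.

Section Connection.
Variable nabla : (E -> E) -> (E -> E) -> E -> E.
Hypothesis lc : levi_civita M [set phi | smooth_on M phi] (vector_field M) h nabla.

Lemma is_dirD_dirD (W : normedModType R) (F : E -> W) S xi : normed_by_dual W ->
  smooth_on M F -> tangent_space M S xi -> is_dirD M F S xi (dirD M F S xi).
Proof.
move=> nW sF xT; have [dF [_ hdF]] := smooth_dirD (@has_coords_E R k n p) nW sF (tangent_in xT).
by rewrite (dirD_eq (hdF xi xT)); exact: hdF.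
Qed.

Lemma is_dirD_vf (F : E -> E) S xi : smooth_on M F -> tangent_space M S xi ->
  is_dirD M F S xi (dirD M F S xi).
Proof. exact: is_dirD_dirD (@normed_by_dual_E R k n p). Qed.

Lemma tangentB S a b : M S -> tangent_space M S a -> tangent_space M S b ->
  tangent_space M S (a - b).
Proof.
move=> MS /(tangentP _ MS)[aY aP] /(tangentP _ MS)[bY bP]; apply/tangentP => //.
rewrite !partE !ctrmxB aP bP mulmxBl mulmxBr; split=> //.
by rewrite addrACA -opprD aY bY subrr.
Qed.

Lemma ipA_bdd w : bdd_linear (fun v : E => ipA v w).
Proof.
have [D1 _ Z1 _ [C1 C10 h1]] := @rip_bdd R k n p.
have [D2 _ Z2 _ [C2 C20 h2]] := @rip_bdd R k p p.
split=> [u v|a u|]; [exact: ipADl|exact: ipAZl|].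
exists (C1 * `|w.1| + C2 * `|w.2|) => [|u]; first by rewrite addr_ge0 // mulr_ge0.
rewrite /ipA (le_trans (ler_normD _ _)) // mulrDl; apply: lerD.
  apply: le_trans (h1 _ _) _; rewrite mulrAC ler_wpM2l ?mulr_ge0 //.
  by rewrite prod_normE le_max lexx.
apply: le_trans (h2 _ _) _; rewrite mulrAC ler_wpM2l ?mulr_ge0 //.
by rewrite prod_normE le_max lexx orbT.
Qed.

Lemma ipA_eq (a b : E) : (forall w, ipA a w = ipA b w) -> a = b.
Proof.
move=> ab; apply/eqP; rewrite -subr_eq0; apply/eqP.
have := ab (a - b); move/eqP; rewrite -subr_eq0 -ipABl /ipA => /eqP e.
have [e1 e2] : ip (Ypart (a - b)) (Ypart (a - b)) = 0 /\ ip (Ppart (a - b)) (Ppart (a - b)) = 0.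
  have h1 := ip_ge0 (Ypart (a - b)); have h2 := ip_ge0 (Ppart (a - b)); lra.
by apply: E_ext; [rewrite (ip_eq0 e1)|rewrite (ip_eq0 e2)].
Qed.

(** The torsion axiom only speaks of scalar functions. It is tested on the functionals <., w>, whose
    derivative along v is <v, w>, so that the second derivatives become pairings of w with D_xi eta
    and D_eta xi. *)
Lemma torsion_free xi eta S : vector_field M xi -> vector_field M eta -> M S ->
  nabla xi eta S - nabla eta xi S = dirD M eta S (xi S) - dirD M xi S (eta S).
Proof.
move=> vx ve MS; apply: ipA_eq => w; case: lc => l1 _ _ _ l5.
pose phi (v : E) := ipA v w.
have bphi : bdd_linear phi := ipA_bdd w.
have sphi : smooth_on M phi by exact: (smooth_linear bphi (@smooth_id _ _ M)).
have dphi S' v : tangent_space M S' v -> dirD M phi S' v = phi v.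
  by move=> vT; apply: dirD_eq; exact: (is_dirD_linear bphi (is_dirD_id vT)).
have dd (a b : E -> E) : vector_field M a -> vector_field M b ->
    dirD M (fun y => dirD M phi y (b y)) S (a S) = phi (dirD M b S (a S)).
  move=> va vb; rewrite (@dirD_ext _ _ _ _ _ (phi \o b)); last first.
    by move=> y My; rewrite dphi //; exact: vb.2.
  apply: dirD_eq; apply: is_dirD_linear => //.
  by apply: is_dirD_vf; [exact: vb.1|exact: va.2].
have := l5 phi xi eta sphi vx ve S MS; rewrite !dd // dphi; last first.
  by apply: tangentB => //; [apply: (l1 _ _ vx ve).2|apply: (l1 _ _ ve vx).2].
by rewrite /phi -ipABl => ->.
Qed.

Lemma koszul xi eta zeta S : vector_field M xi -> vector_field M eta ->
  vector_field M zeta -> M S ->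
  h S (nabla xi eta S) (zeta S) =
  h S (dirD M eta S (xi S)) (zeta S) + ipA (Kop S (xi S) (eta S)) (zeta S).
Proof.
move=> vx ve vz MS; case: (lc) => l1 _ _ l4 _.
have T a : vector_field M a -> tangent_space M S (a S) by move=> va; exact: va.2.
have D a b : vector_field M a -> vector_field M b -> is_dirD M b S (a S) (dirD M b S (a S)).
  by move=> va vb; apply: is_dirD_vf; [exact: vb.1|exact: T].
(* Metric compatibility, with the derivative of the metric pairing expanded by the ambient product
   rule. *)
have L a b c : vector_field M a -> vector_field M b -> vector_field M c ->
    h S (nabla a b S) (c S) + h S (b S) (nabla a c S) =
    h S (dirD M b S (a S)) (c S) + (ipA (b S) (dmetric S (a S) (c S))
      + h S (b S) (dirD M c S (a S))).
  move=> va vb vc; rewrite -l4 //; apply: dirD_eq.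
  by apply: is_dirD_metric_form => //; exact: D.
have A := L _ _ _ vx ve vz; have B := L _ _ _ ve vz vx; have C := L _ _ _ vz vx ve.
have Bl (a b c : E) : h S (a - b) c = h S a c - h S b c.
  by rewrite addrC -scaleN1r metric_formDZl mulN1r addrC.
have tors a b c : vector_field M a -> vector_field M b -> h S (nabla a b S) c - h S (nabla b a S) c =
    h S (dirD M b S (a S)) c - h S (dirD M a S (b S)) c.
  by move=> va vb; rewrite -!Bl torsion_free.
have t1 := tors _ _ (zeta S) vx ve.
have t2 := tors _ _ (eta S) vx vz.
have t3 := tors _ _ (xi S) ve vz.
have := Kop_sym MS (T _ vx) (T _ ve) (T _ vz).
move: A B C t1 t2 t3.
rewrite (metric_formC _ _ _ (eta S) (nabla xi zeta S) MS).
rewrite (metric_formC _ _ _ (zeta S) (nabla eta xi S) MS).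
rewrite (metric_formC _ _ _ (xi S) (nabla zeta eta S) MS).
rewrite (metric_formC _ _ _ (eta S) (dirD M zeta S (xi S)) MS).
rewrite (metric_formC _ _ _ (zeta S) (dirD M xi S (eta S)) MS).
rewrite (metric_formC _ _ _ (xi S) (dirD M eta S (zeta S)) MS).
by move=> A B C t1 t2 t3 KE; exact: (koszul_arith A B C t1 t2 t3 KE).
Qed.

(* Horizontal vectors u extend to the horizontal fields Pi_H u. *)
Lemma hproj_nabla xi eta S : vector_field M xi -> vector_field M eta -> M S ->
  PiH S (nabla xi eta S) =
  PiH S (dirD M eta S (xi S) + opinv (g S) (Kop S (xi S) (eta S))).
Proof.
move=> vx ve MS; rewrite (opinv_metric_op ha0 ha1 hb _ MS).
pose d := dirD M eta S (xi S); pose c := ginv alpha0 alpha1 beta S (Kop S (xi S) (eta S)).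
pose X := d + c; rewrite -/d -/c -/X.
apply: hproj_unique => //; first exact: hproj_hor.
move=> u Hu; pose zeta S' := PiH S' u.
have vz : vector_field M zeta.
  split; first by apply: (smooth_hproj ha0 ha1 hb (F := cst u)); exact: smooth_cst.
  by move=> S' MS'; have [] : H S' (PiH S' u) by exact: hproj_hor.
have zS : zeta S = u by rewrite /zeta hproj_id.
have e : h S u (nabla xi eta S) = h S u X.
  rewrite metric_formC // -[in LHS]zS koszul // zS [RHS]metric_formC //.
  have -> : X = 1 *: d + c by rewrite scale1r.
  rewrite metric_formDZl mul1r; congr (_ + _).
  by rewrite metric_formC // metric_form_ginv // ipAC.
have Br (a b : E) : h S u (a - b) = h S u a - h S u b.
  by rewrite addrC -scaleN1r metric_formDZr mulN1r addrC.
by rewrite Br e -Br; apply: hproj_orth.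
Qed.

End Connection.

End Koszul.

(** * The lifted connection and the lifted Hessian *)

Section QuotientConnection.
Context {R : realType} {k : scalars} {n p : nat}.
Local Notation K := (scal R k).
Local Notation rM m n := (rmx R k m n).
Local Notation E := (rmx R k n p * rmx R k p p)%type.
Local Notation M := (@total_space R k n p).
Implicit Types S w : E.
Variables alpha0 alpha1 beta : R.
Hypotheses (ha0 : 0 < alpha0) (ha1 : 0 < alpha1) (hb : 0 < beta).
Local Notation g := (@metric_op R k n p alpha0 alpha1 beta).
Local Notation h := (@metric_form R k n p alpha0 alpha1 beta).
Local Notation H := (@horizontal_space R k n p alpha0 alpha1 beta).
Local Notation PiH := (@hproj R k n p alpha0 alpha1 beta).
Local Notation Kop := (@Kop R k n p alpha0 alpha1 beta).
Local Notation lift := (@horizontal_lift R k n p alpha0 alpha1 beta).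
Local Notation bfield := (@base_field R k n p alpha0 alpha1 beta).

Lemma lift_vector_field X xi : lift X xi -> vector_field M xi.
Proof. by move=> [sx hx]; split=> // S MS; have [[]] := hx S MS. Qed.

Lemma lift_dquo X xi S : lift X xi -> M S -> dquo S (xi S) = X (quo_proj S).
Proof.
move=> [_ hx] MS; have [[xT _] hq] := hx S MS.
exact: is_dirD_unique (is_dirD_quo xT) hq.
Qed.

(** Both sides are horizontal at the moved point and project to the same vector of the quotient, and
    such a vector is unique. *)
Lemma lift_equivariant X xi S (U : 'M[K]_p) : lift X xi -> M S -> unitary U ->
  xi (Uact S U) = Uact (xi S) U.
Proof.
move=> hx MS uU; have MU := Uact_total uU MS; have [_ hx'] := hx.
have [HS _] := hx' _ MS; have [HU _] := hx' _ MU.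
apply: (horizontal_dquo_inj ha0 ha1 hb MU HU (horizontal_Uact ha1 uU MS HS)).
by rewrite (lift_dquo hx MU) (dquo_Uact uU) (lift_dquo hx MS) (quo_proj_Uact uU MS).
Qed.

(** A curve through S U is carried back by U^H to a curve through S, where the derivative of [F] is
    known. *)
Lemma is_dirD_equivariant (F : E -> E) S v d (U : 'M[K]_p) : unitary U -> M S ->
  (forall S', M S' -> F (Uact S' U) = Uact (F S') U) ->
  is_dirD M F S v d -> is_dirD M F (Uact S U) (Uact v U) (Uact d U).
Proof.
move=> uU MS eF [vT hF]; split; first exact: tangent_Uact.
move=> c [c0 cM cd]; pose c' t := Uact (c t) U^H.
have hc' : curve_at M S v c'.
  split; first by rewrite /c' c0 UactK.
    by apply: filterS cM => t; apply: Uact_total; exact: unitary_ctr.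
  by have := is_derive_bdd_linear (Uact_bdd U^H) cd; rewrite (UactK uU).
have := is_derive_bdd_linear (Uact_bdd U) (hF c' hc').
apply: near_eq_is_derive; case: hc' => _ c'M _.
apply: filterS c'M => t ct; rewrite /= -(eF _ ct).
by rewrite /c' (UactVK uU).
Qed.

Section Nabla.
Variable nabla : (E -> E) -> (E -> E) -> E -> E.
Hypothesis lc : levi_civita M [set phi | smooth_on M phi] (vector_field M) h nabla.

Lemma hconn_equivariant X Z xi eta S (U : 'M[K]_p) : lift X xi -> lift Z eta ->
  M S -> unitary U ->
  hconn alpha0 alpha1 beta nabla xi eta (Uact S U)
  = Uact (hconn alpha0 alpha1 beta nabla xi eta S) U.
Proof.
move=> hx hz MS uU; have MU := Uact_total uU MS.
have vx := lift_vector_field hx; have ve := lift_vector_field hz.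
rewrite /hconn (hproj_nabla ha0 ha1 hb lc vx ve MU) (hproj_nabla ha0 ha1 hb lc vx ve MS).
have xT : tangent_space M S (xi S) := vx.2 S MS.
have dE := is_dirD_equivariant uU MS (fun S' MS' => lift_equivariant hz MS' uU)
  (is_dirD_vf ve.1 xT).
rewrite (opinv_metric_op ha0 ha1 hb _ MU) (opinv_metric_op ha0 ha1 hb _ MS).
rewrite (lift_equivariant hx MS uU) (lift_equivariant hz MS uU) (dirD_eq dE).
rewrite (Kop_Uact _ _ _ uU _ _ MS) (ginv_Uact _ _ _ uU) -(hproj_Uact ha0 ha1 hb _ uU MS).
by have [-> _ _] := Uact_bdd (k := k) (n := n) U.
Qed.

Lemma hconn_lift xi eta : bfield xi -> bfield eta ->
  bfield (hconn alpha0 alpha1 beta nabla xi eta).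
Proof.
move=> [X hx] [Z hz].
have vx := lift_vector_field hx; have ve := lift_vector_field hz.
have [l1 _ _ _ _] := lc; have vn := l1 _ _ vx ve.
pose F := hconn alpha0 alpha1 beta nabla xi eta.
have HF S : M S -> H S (F S) by move=> MS; exact: hproj_hor.
(* The field on the quotient is read off at an arbitrary point of each fibre; equivariance makes the
   choice immaterial. *)
exists (fun x => xget 0 [set v | exists2 S, M S /\ quo_proj S = x & v = dquo S (F S)]).
split; first by apply: smooth_hproj => //; exact: vn.1.
move=> S MS; split; first exact: HF.
suff -> : xget 0 [set v | exists2 S0, M S0 /\ quo_proj S0 = quo_proj S & v = dquo S0 (F S0)]
    = dquo S (F S) by apply: is_dirD_quo; have [] := HF S MS.
case: xgetP => [v _ [S' [MS' qS] ->]|/(_ (dquo S (F S))) []]; last by exists S.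
have [U uU SE] := (quo_proj_fiber MS' MS).1 qS.
by rewrite SE /F (hconn_equivariant hx hz MS' uU) (dquo_Uact uU).
Qed.

(** [phi] is constant on orbits, so its differential kills the vertical part of [w]. This lets the
    torsion axiom survive projection of the connection. *)
Lemma hproj_dirD_base (phi : E -> R) S w : base_function phi -> M S ->
  tangent_space M S w -> dirD M phi S (PiH S w) = dirD M phi S w.
Proof.
move=> [sphi [f hf]] MS wT.
have [a ha we] := tangent_split ha0 ha1 hb MS wT.
have [dF [bF hdF]] := smooth_dirD (@has_coords_E R k n p) (@normed_by_dual_real R) sphi MS.
have vT := vert_tangent MS ha.
have [c [c0 cO cd]] := vT.
have cM : curve_at M S (vert S a) c.
  by split=> //; apply: filterS cO => t; exact: orbit_in.
have vMT : tangent_space M S (vert S a) by exists c.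
have dv0 : dF (vert S a) = 0.
  have [_ /(_ c cM) h1] := hdF _ vMT.
  have h2 : is_derive (0 : R) (1 : R) (phi \o c) 0.
    apply: near_eq_is_derive (is_derive_cst (phi S) (0 : R) (1 : R)).
    apply: filterS cO => t [U uU /= ->]; rewrite !hf //; last exact: Uact_total.
    by rewrite (quo_proj_Uact uU MS).
  by case: h1 => _ <-; case: h2 => _ ->.
have HT : tangent_space M S (PiH S w) by have [] : H S (PiH S w) by exact: hproj_hor.
rewrite (dirD_eq (hdF _ HT)) (dirD_eq (hdF _ wT)).
by rewrite {2}we; case: bF => -> _ _; rewrite dv0 addr0.
Qed.

(** Each axiom is that of [nabla] after projection: Pi_H is linear and fixes horizontal fields,
    pairings with horizontal vectors ignore what Pi_H removes, and functions from the base ignore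
    vertical vectors. *)
Lemma hconn_levi_civita :
  levi_civita M (@base_function R k n p) bfield h (hconn alpha0 alpha1 beta nabla).
Proof.
have [l1 l2 l3 l4 l5] := lc.
have bv xi : bfield xi -> vector_field M xi by move=> [X]; exact: lift_vector_field.
have bs phi : base_function phi -> smooth_on M phi by move=> [].
have bH xi S : bfield xi -> M S -> H S (xi S).
  by move=> [X [_ hx]] MS; have [] := hx S MS.
have bT xi S : bfield xi -> M S -> tangent_space M S (xi S).
  by move=> bx MS; have [] := bH xi S bx MS.
split.
- exact: hconn_lift.
- move=> phi xi xi' eta bphi bx bx' be S MS.
  rewrite /hconn (l2 phi xi xi' eta (bs _ bphi) (bv _ bx) (bv _ bx') (bv _ be) S MS).
  exact: (hproj_lin ha0 ha1 hb).
- move=> phi xi eta eta' bphi bx be be' S MS.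
  rewrite /hconn (l3 phi xi eta eta' (bs _ bphi) (bv _ bx) (bv _ be) (bv _ be') S MS).
  rewrite -addrA (hproj_lin ha0 ha1 hb _ _ _ MS) (hproj_lin ha0 ha1 hb _ _ _ MS).
  rewrite (hproj_id ha0 ha1 hb MS (bH eta S be MS)).
  exact: addrA.
- move=> xi eta zeta bx be bz S MS.
  rewrite (l4 _ _ _ (bv _ bx) (bv _ be) (bv _ bz) S MS).
  have o u w : H S u -> h S u w = h S u (PiH S w).
    move=> Hu; have := hproj_orth ha0 ha1 hb w MS Hu.
    rewrite addrC -scaleN1r metric_formDZr mulN1r addrC => /eqP.
    by rewrite subr_eq0 => /eqP.
  rewrite (metric_formC _ _ _ (nabla xi eta S) (zeta S) MS).
  rewrite (metric_formC _ _ _ (hconn _ _ _ nabla xi eta S) (zeta S) MS).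
  by rewrite (o _ (nabla xi eta S) (bH zeta S bz MS)) (o _ (nabla xi zeta S) (bH eta S be MS)).
- move=> phi xi eta bphi bx be S MS.
  rewrite (l5 phi xi eta (bs _ bphi) (bv _ bx) (bv _ be) S MS).
  have vx := bv _ bx; have ve := bv _ be.
  have wT : tangent_space M S (nabla xi eta S - nabla eta xi S).
    by apply: tangentB => //; [apply: (l1 _ _ vx ve).2|apply: (l1 _ _ ve vx).2].
  rewrite -(hproj_dirD_base bphi MS wT); congr (dirD M phi S _).
  rewrite /hconn addrC -scaleN1r (hproj_lin ha0 ha1 hb _ _ _ MS) scaleN1r addrC.
  by [].
Qed.

(** Product rule for an operator applied to a moving argument; in the first term the argument is
    frozen at its value at S. *)
Lemma hproj_family S (xi : E) (F : E -> E) dF : M S -> is_dirD M F S xi dF ->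
  is_dirD M (fun y => PiH y (F y)) S xi
    (dirD M (fun S' => PiH S' (F S)) S xi + PiH S dF).
Proof.
move=> MS hF; have xT := hF.1.
apply: (is_dirD_family (@has_coords_E R k n p) MS _ _ hF
  (dA := fun w => dirD M (fun S' => PiH S' w) S xi)).
  by move=> y My a u v; exact: (hproj_lin ha0 ha1 hb).
move=> w; have hw := is_dirD_hproj ha0 ha1 hb w MS xT.
by rewrite (dirD_eq hw).
Qed.

(** Differentiating Pi_H eta = eta gives Pi_H D_xi eta = D_xi eta - (D_xi Pi_H) eta, which is
    substituted into [hproj_nabla]. *)
Lemma hconn_formula xi eta X Z S : lift X xi -> lift Z eta -> M S ->
  hconn alpha0 alpha1 beta nabla xi eta S =
    dirD M eta S (xi S) - dirD M (fun S' => PiH S' (eta S)) S (xi S)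
    + PiH S (opinv (g S) (Kop S (xi S) (eta S))).
Proof.
move=> hx hz MS; have vx := lift_vector_field hx; have ve := lift_vector_field hz.
rewrite /hconn (hproj_nabla ha0 ha1 hb lc vx ve MS).
have xT : tangent_space M S (xi S) := vx.2 S MS.
have de := is_dirD_vf ve.1 xT.
have e : forall y, M y -> PiH y (eta y) = eta y.
  by move=> y My; apply: (hproj_id ha0 ha1 hb My); have [] := hz.2 y My.
have dE := is_dirD_unique (is_dirD_ext e (hproj_family MS de)) de.
rewrite -[X in PiH S (X + _)]scale1r (hproj_lin ha0 ha1 hb _ _ _ MS) scale1r.
by congr (_ + _); rewrite -[X in _ = X - _]dE addrAC subrr add0r.
Qed.

Lemma smooth_ginv (F : E -> E) : smooth_on M F ->
  smooth_on M (fun S => opinv (g S) (F S)).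
Proof.
move=> hF; have sY := smooth_Y (@smooth_id _ _ M); have sP := smooth_P (@smooth_id _ _ M).
have fY := smooth_Y hF; have fP := smooth_P hF.
have h1 := smoothD (smoothZ (alpha0^-1) fY) (smoothZ (alpha1^-1 - alpha0^-1)
  (smooth_rmul (smooth_rmul sY (smooth_rctr sY)) fY)).
have h2 := smoothZ (beta^-1) (smooth_rmul (smooth_rmul sP fP) sP).
apply: (smooth_ext _ (smooth_pair h1 h2)) => S MS.
by rewrite (opinv_metric_op ha0 ha1 hb _ MS).
Qed.

(** With F = g^-1 f_S, the letters stand for a = (D_xi Pi_H) F, d = D_xi F, b = dg = (D_xi g) F, df
    = D_xi f_S and kk = K. The equation for df is g F = f_S differentiated; it lets g^-1 be pulled
    out of the whole sum. *)
Lemma hproj_rearrange S (a b d kk df dg : E) : M S -> df = b + g S d -> dg = b ->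
  PiH S (a + PiH S d + opinv (g S) kk) = PiH S (opinv (g S) (df + g S a - dg + kk)).
Proof.
move=> MS -> ->; rewrite !(opinv_metric_op ha0 ha1 hb _ MS).
set c := ginv _ _ _ _ kk.
have -> : b + g S d + g S a - b + kk = g S (a + d + c).
  rewrite 2!metric_opD (metric_op_ginv ha0 ha1 hb _ MS); congr (_ + _).
  by rewrite addrAC (addrAC b) subrr add0r addrC.
rewrite (ginv_metric_op ha0 ha1 hb _ MS).
have L (u v : E) : PiH S (u + v) = PiH S u + PiH S v.
  by rewrite -[u in LHS]scale1r (hproj_lin ha0 ha1 hb _ _ _ MS) scale1r.
by rewrite !L (hproj_id ha0 ha1 hb MS (hproj_hor ha0 ha1 hb d MS)).
Qed.

(** [hproj_nabla] holds for all smooth tangent fields, hence directly for Pi_H g^-1 f_S; the rest is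
    the product rule for Pi_H F and for g F = f_S. *)
Lemma rhess_formula (fS : E -> E) xi X S : smooth_on M fS -> lift X xi -> M S ->
  let fSi := opinv (g S) (fS S) in
  rhess alpha0 alpha1 beta nabla fS xi S =
    PiH S (opinv (g S)
      (dirD M fS S (xi S)
       + g S (dirD M (fun S' => PiH S' fSi) S (xi S))
       - dirD M (fun S' => g S' fSi) S (xi S)
       + Kop S (xi S) (PiH S fSi))).
Proof.
move=> sf hx MS fSi; have vx := lift_vector_field hx.
have xT : tangent_space M S (xi S) := vx.2 S MS.
pose F S' := opinv (g S') (fS S').
have sF : smooth_on M F := smooth_ginv sf.
have ve : vector_field M (fun S' => PiH S' (F S')).
  split; first exact: smooth_hproj.
  by move=> y My; have [] : H y (PiH y (F y)) by exact: hproj_hor.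
have hn := hproj_nabla ha0 ha1 hb lc vx ve MS.
have dF := is_dirD_vf sF xT.
have df := is_dirD_vf sf xT.
have gF y : M y -> g y (F y) = fS y.
  by move=> My; rewrite /F (opinv_metric_op ha0 ha1 hb _ My) metric_op_ginv.
have dg := is_dirD_family (@has_coords_E R k n p) MS
  (fun y _ => @metric_op_lin _ _ _ _ alpha0 alpha1 beta y)
  (fun w => is_dirD_metric_op alpha0 alpha1 beta w xT) dF.
have dE := is_dirD_unique (is_dirD_ext gF dg) df.
have dgE := dirD_eq (is_dirD_metric_op alpha0 alpha1 beta (F S) xT).
have e1 := dirD_eq (hproj_family MS dF).
apply: (etrans hn); apply: (etrans (congr1 (fun z => PiH S (z + _)) e1)).
exact: hproj_rearrange MS (esym dE) dgE.
Qed.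

End Nabla.
End QuotientConnection.

(** * The quotient metric, horizontal lifts and the range of N(S) *)

Section QuotientMetric.
Context {R : realType} {k : scalars} {n p : nat}.
Local Notation K := (scal R k).
Local Notation rM m n := (rmx R k m n).
Local Notation E := (rmx R k n p * rmx R k p p)%type.
Local Notation M := (@total_space R k n p).
Local Notation B := (@psd_rank R k n p).
Implicit Types S w : E.
Variables alpha0 alpha1 beta : R.
Hypotheses (ha0 : 0 < alpha0) (ha1 : 0 < alpha1) (hb : 0 < beta).
Local Notation g := (@metric_op R k n p alpha0 alpha1 beta).
Local Notation h := (@metric_form R k n p alpha0 alpha1 beta).
Local Notation H := (@horizontal_space R k n p alpha0 alpha1 beta).
Local Notation PiH := (@hproj R k n p alpha0 alpha1 beta).

Lemma metric_form_trR S w : M S -> h S w w =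
  let Y := Ypart S in let P := Ppart S in
  let wY := Ypart w in let wP := Ppart w in
  trR (alpha0%:K *: (wY^H *m wY)
       + (alpha1 - alpha0)%:K *: (wY^H *m Y *m Y^H *m wY)
       + beta%:K *: (wP^H *m invmx P *m wP *m invmx P)).
Proof.
have trD (a b : 'M[K]_p) : trR (a + b) = trR a + trR b by exact: raddfD.
move=> MS; rewrite metric_formE //= !trD !trRZ.
congr (_ * _ + _ * _ + _ * _); first by rewrite /ip trR_mulC.
  by rewrite /ip trR_mulC ctrmxM ctrmxK !mulmxA.
by rewrite /ip trR_mulC !mulmxA.
Qed.

Lemma smooth_metric_form (xi eta : E -> E) : smooth_on M xi -> smooth_on M eta ->
  smooth_on M (fun S => h S (xi S) (eta S)).
Proof.
move=> hx he; have sY := smooth_Y (@smooth_id _ _ M); have sP := smooth_P (@smooth_id _ _ M).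
have sPi := @smooth_Pinv R k n p.
have h1 := smoothD (smoothZ alpha0 (smooth_Y he)) (smoothZ (alpha1 - alpha0)
  (smooth_rmul (smooth_rmul sY (smooth_rctr sY)) (smooth_Y he))).
have h2 := smoothZ beta (smooth_rmul (smooth_rmul sPi (smooth_P he)) sPi).
exact: (smooth_ext _ (smoothD (smooth_bilinear (@rip_bdd R k n p) (smooth_Y hx) h1)
  (smooth_bilinear (@rip_bdd R k p p) (smooth_P hx) h2))).
Qed.

Lemma metric_riemannian : riemannian_metric M h.
Proof.
split=> [S MS|xi eta [sx _] [se _]]; last exact: smooth_metric_form.
have [i1 i2 i3] := metric_inner ha0 ha1 hb MS; split.
- by move=> a x y z _ _ _; exact: i1.
- by move=> x y _ _; exact: i2.
- by move=> x _; exact: i3.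
Qed.

Definition hlift S (v : rM n n) : E := xget 0 [set eta | H S eta /\ dquo S eta = v].

Lemma hliftE S eta : M S -> H S eta -> hlift S (dquo S eta) = eta.
Proof.
move=> MS He; rewrite /hlift; case: xgetP => [z _ [Hz ez]|/(_ eta) []]; last by split.
exact: (horizontal_dquo_inj ha0 ha1 hb MS Hz He ez).
Qed.

Lemma dirD_quo S eta : H S eta -> dirD M quo_proj S eta = dquo S eta.
Proof. by move=> [eT _]; apply: dirD_eq; exact: is_dirD_quo. Qed.

(** Evaluated at an arbitrarily chosen point of the fibre; [quotient_metricE] shows that every other
    point gives the same value. *)
Definition quotient_metric (X u v : rM n n) : R :=
  let S := xget 0 [set S | M S /\ quo_proj S = X] in h S (hlift S u) (hlift S v).

Lemma quotient_metric_inner X : B X ->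
  inner_product (tangent_space B X) (quotient_metric X).
Proof.
move=> BX; have [S MS qS] := quo_proj_surj BX.
rewrite /quotient_metric; case: xgetP => [S' _ [MS' qS']|/(_ S) []]; last by split.
have lf v : tangent_space B X v -> exists2 eta, H S' eta & dquo S' eta = v.
  by rewrite -qS' => vT; exact: horizontal_lift_exists.
split.
- move=> a _ _ _ /lf[x Hx <-] /lf[y Hy <-] /lf[z Hz <-].
  rewrite -dquoD !hliftE //; last exact: horizontal_lin.
  exact: metric_formDZl.
- move=> _ _ /lf[x Hx <-] /lf[y Hy <-]; rewrite !hliftE //.
  exact: metric_formC.
- move=> _ /lf[x Hx <-] x0; rewrite hliftE //; apply: metric_form_gt0 => //.
  apply: contra_neq x0 => ->.
  by rewrite /dquo /Ypart /Ppart /= ctrmx0 !(mul0mx, mulmx0) !addr0.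
Qed.

(** The chosen point is S U for some unitary U, horizontal lifts there are the images under U of
    those at S, and U acts isometrically. *)
Lemma quotient_metricE S eta zeta : M S -> H S eta -> H S zeta ->
  quotient_metric (quo_proj S) (dirD M quo_proj S eta) (dirD M quo_proj S zeta)
  = h S eta zeta.
Proof.
move=> MS He Hz; rewrite !dirD_quo //.
rewrite /quotient_metric; case: xgetP => [S' _ [MS' qS']|/(_ S) []]; last by split.
have [U uU SE] := (quo_proj_fiber MS MS').1 (esym qS').
have l x : H S x -> hlift S' (dquo S x) = Uact x U.
  move=> Hx; rewrite -(dquo_Uact uU S x) -SE hliftE // SE.
  exact: horizontal_Uact.
by rewrite !l // SE metric_form_Uact.
Qed.

Lemma horizontal_projects S eta : M S -> H S eta ->
  exists2 v, tangent_space B (quo_proj S) v & is_dirD M quo_proj S eta v.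
Proof.
move=> MS [eT _]; exists (dquo S eta); first exact: dquo_tangent.
exact: is_dirD_quo.
Qed.

Lemma horizontal_lift_unique S v : M S -> tangent_space B (quo_proj S) v ->
  exists! eta, H S eta /\ is_dirD M quo_proj S eta v.
Proof.
move=> MS vT; have [eta He ev] := horizontal_lift_exists ha0 ha1 hb MS vT.
exists eta; split.
  by split=> //; rewrite -ev; apply: is_dirD_quo; have [] := He.
move=> z [Hz qz]; apply: (horizontal_dquo_inj ha0 ha1 hb MS He Hz).
by rewrite ev; apply: (is_dirD_unique qz); apply: is_dirD_quo; have [] := Hz.
Qed.

(** Destructing the equality of dimensions removes the cast. Both products are kept: one gives the
    orthogonality relations between Y and its complement, the other the resolution of the
    identity. *)
Lemma unitary_castmx m q (A : 'M[K]_(m, q)) (e : q = m) :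
  unitary (castmx (erefl, e) A) -> A^H *m A = 1%:M /\ A *m A^H = 1%:M.
Proof.
case: m / e A => A; rewrite castmx_id => uA; have UU : A^H *m A = 1%:M by [].
by split=> //; rewrite mulmx1C.
Qed.

Lemma Nop_range (hpn : (p <= n)%N) S (Yp : 'M[K]_(n, n - p)) : M S ->
  unitary (castmx (erefl, subnKC hpn) (row_mx (Ypart S) Yp)) ->
  let N := Nop alpha1 beta S Yp in
  (forall A D A' D', D^H = D -> D'^H = D' ->
    N A D = N A' D' -> A = A' /\ D = D') /\
  (forall eta, H S eta <-> exists A D, D^H = D /\ eta = N A D).
Proof.
move=> MS uQ N; have [YS pS] := MS; have YY : (Ypart S)^H *m Ypart S = 1%:M by [].
have [] := unitary_castmx uQ; rewrite ctrmx_row mul_col_row mul_row_col => Q1 Q2.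
have [YpYp YYp] : Yp^H *m Yp = 1%:M /\ (Ypart S)^H *m Yp = 0.
  by move: Q1; rewrite scalar_mx_block => /eq_block_mx[_ ? _ ?].
have a1 : alpha1%:K != 0 :> K by rewrite fmorph_eq0 gt_eqF.
split=> [A D A' D' _ _ e|eta].
  have eD : D = D' by have := congr1 Ppart e; rewrite /N /Nop !partE => /(scalerI a1).
  split=> //; have := congr1 Ypart e; rewrite /N /Nop !partE eD => /addrI e'.
  by rewrite -[A]mul1mx -[A']mul1mx -YpYp -!mulmxA e'.
split=> [/(horizontalE alpha0 beta ha1 _ MS)[he hP]|[A [D [hD ->]]]].
  (* Both witnesses are read off the components of N; horizontality supplies the part of eta_Y along
     Y, and Y Y^H + Yp Yp^H = 1 reassembles eta_Y. *)
  exists (Yp^H *m Ypart eta), ((alpha1^-1)%:K *: Ppart eta); split.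
    by rewrite ctrmxZr hP.
  apply: E_ext; rewrite /N /Nop !partE; last by rewrite scalerA fmorphV /= divff // scale1r.
  have XE : (Ypart S)^H *m Ypart eta = beta%:K *:
      (invmx (Ppart S) *m ((alpha1^-1)%:K *: Ppart eta)
       - ((alpha1^-1)%:K *: Ppart eta) *m invmx (Ppart S)).
    apply: (scalerI a1).
    move/eqP: he; rewrite /hor_eq subr_eq0 => /eqP/(canRL (addrK _)) ->.
    rewrite -scalemxAr -scalemxAl -!scalerBr !scalerA (mulrC _ beta%:K) -mulrA fmorphV /=.
    by rewrite divff // mulr1.
  by rewrite scalemxAr -XE !mulmxA -mulmxDl Q2 mul1mx.
apply/horizontalE => //; rewrite /N /Nop !partE; split; last by rewrite ctrmxZr hD.
rewrite /hor_eq !partE mulmxDr -scalemxAr !mulmxA YY YYp mul1mx mul0mx addr0.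
by mxnorm; mxring.
Qed.

End QuotientMetric.

(** The quotient is not built as a type: it is [psd_rank] with the map [quo_proj], whose fibres are
    the orbits, and its functions, fields and connection are represented by their lifts. *)
Theorem theorem3 (R : realType) (k : scalars) (n p : nat) (hpn : (p <= n)%N)
    (alpha0 alpha1 beta : R)
    (halpha0 : 0 < alpha0) (halpha1 : 0 < alpha1) (hbeta : 0 < beta) :
  let K := scal R k in
  let E := (rmx R k n p * rmx R k p p)%type in
  let M : set E := total_space in
  let B : set (rmx R k n n) := psd_rank p in
  let g : E -> E -> E := metric_op alpha0 alpha1 beta in
  let h : E -> E -> E -> R := metric_form alpha0 alpha1 beta in
  let H : E -> set E := horizontal_space alpha0 alpha1 beta in
  let PiH : E -> E -> E := hproj alpha0 alpha1 beta in
  let L : 'M[K]_p -> 'M[K]_p -> 'M[K]_p := Lop alpha1 beta in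
  let calD : E -> E -> 'M[K]_p := calD alpha1 beta in
  let calDring : E -> E -> E -> 'M[K]_p := calDring alpha1 beta in
  let Kop : E -> E -> E -> E := Kop alpha0 alpha1 beta in
  (* S^+_{K,p,n} = M / U_{K,p} *)
  [/\ forall S, M S -> B (quo_proj S),
      forall X, B X -> exists2 S, M S & quo_proj S = X &
      forall S S', M S -> M S' ->
        (quo_proj S = quo_proj S' <-> exists2 U, unitary U & S' = Uact S U)] /\
  (* g defines an inner product on E and an invariant metric on M *)
  [/\ forall S w eta, M S -> ipA (g S w) eta = ipA w (g S eta),
      forall S, M S -> inner_product [set: E] (h S),
      (forall S w, M S -> h S w w =
        let Y := Ypart S in let P := Ppart S in
        let wY := Ypart w in let wP := Ppart w in
        trR (alpha0%:K *: (wY^H *m wY)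
             + (alpha1 - alpha0)%:K *: (wY^H *m Y *m Y^H *m wY)
             + beta%:K *: (wP^H *m invmx P *m wP *m invmx P))),
      riemannian_metric M h &
      (forall S U, M S -> unitary U -> M (Uact S U) /\
        forall xi eta, tangent_space M S xi -> tangent_space M S eta ->
          tangent_space M (Uact S U) (Uact xi U) /\
          h (Uact S U) (Uact xi U) (Uact eta U) = h S xi eta)] /\
  (* quotient metric on S^+_{K,p,n} *)
  (exists q : rmx R k n n -> rmx R k n n -> rmx R k n n -> R,
    (forall X, B X -> inner_product (tangent_space B X) (q X)) /\
    (forall S eta zeta, M S -> H S eta -> H S zeta ->
      q (quo_proj S) (dirD M quo_proj S eta) (dirD M quo_proj S zeta) = h S eta zeta)) /\
  (* the tangent bundle of S^+_{K,p,n} lifts to the subbundle H *)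
  [/\ forall S eta, M S -> H S eta ->
        exists2 v, tangent_space B (quo_proj S) v & is_dirD M quo_proj S eta v,
      forall S v, M S -> tangent_space B (quo_proj S) v ->
        exists! eta, H S eta /\ is_dirD M quo_proj S eta v &
      forall w, smooth_on M (fun S => PiH S w)] /\
  (* horizontality *)
  (forall S eta, M S -> tangent_space M S eta ->
    let Y := Ypart S in let P := Ppart S in
    (H S eta <->
     alpha1%:K *: (Y^H *m Ypart eta) + beta%:K *: (Ppart eta *m invmx P)
       - beta%:K *: (invmx P *m Ppart eta) = 0)) /\
  (* H_S is the range of the one-to-one operator N(S) *)
  (forall S (Yp : 'M[K]_(n, n - p)), M S ->
    unitary (castmx (erefl, subnKC hpn) (row_mx (Ypart S) Yp)) ->
    let N := Nop alpha1 beta S Yp in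
    (forall A D A' D', D^H = D -> D'^H = D' ->
      N A D = N A' D' -> A = A' /\ D = D') /\
    (forall eta, H S eta <-> exists A D, D^H = D /\ eta = N A D)) /\
  (* the horizontal projection *)
  (forall S w, M S ->
    let Y := Ypart S in let P := Ppart S in let D := calD S w in
    orth_projection (H S) (h S) w (PiH S w) /\
    PiH S w =
      mkE (beta%:K *: (Y *m (invmx P *m D - D *m invmx P))
             + Ypart w - Y *m Y^H *m Ypart w)
          (alpha1%:K *: D)) /\
  (* L(P) is invertible *)
  (forall P : 'M[K]_p, posdef P -> bijective (L P) /\
    forall (U : 'M[K]_p) (Lam : 'rV[K]_p),
      unitary U -> P = U *m diag_mx Lam *m U^H ->
      forall A : 'M[K]_p,
        opinv (L P) A =
        U *m (\matrix_(i, j)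
           ((U^H *m A *m U) i j
            / (alpha1%:K + beta%:K * ((Lam ord0 i)^-1 * Lam ord0 j
                                       + Lam ord0 i * (Lam ord0 j)^-1 - 2%:R))))
          *m U^H) /\
  (* lifted Levi-Civita connection and lifted Riemannian Hessian *)
  (forall nabla : (E -> E) -> (E -> E) -> E -> E,
    levi_civita M [set phi | smooth_on M phi] (vector_field M) h nabla ->
    let nablaH := hconn alpha0 alpha1 beta nabla in
    [/\ levi_civita M base_function (base_field alpha0 alpha1 beta) h nablaH,
        (forall xi eta X Z,
          horizontal_lift alpha0 alpha1 beta X xi ->
          horizontal_lift alpha0 alpha1 beta Z eta ->
          forall S, M S ->
          nablaH xi eta S =
            dirD M eta S (xi S)
            - dirD M (fun S' => PiH S' (eta S)) S (xi S)
            + PiH S (opinv (g S) (Kop S (xi S) (eta S)))) &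
        (forall (f : rmx R k n n -> R) (fS : E -> E) xi X,
          smooth_on M (fun S => f (quo_proj S)) ->
          ambient_gradient (fun S => f (quo_proj S)) fS ->
          horizontal_lift alpha0 alpha1 beta X xi ->
          forall S, M S ->
          let fSi := opinv (g S) (fS S) in
          rhess alpha0 alpha1 beta nabla fS xi S =
            PiH S (opinv (g S)
              (dirD M fS S (xi S)
               + g S (dirD M (fun S' => PiH S' fSi) S (xi S))
               - dirD M (fun S' => g S' fSi) S (xi S)
               + Kop S (xi S) (PiH S fSi))))]) /\
  (* derivatives of calD and of the horizontal projection *)
  (forall S xi w, M S -> tangent_space M S xi ->
    let Y := Ypart S in let P := Ppart S in let Pi := invmx P in
    let xY := Ypart xi in let xP := Ppart xi in
    let D := calD S w in let Dr := calDring S xi w in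
    is_dirD M (fun S' => calD S' w : rmx R k p p) S xi Dr /\
    is_dirD M (fun S' => PiH S' w) S xi
      (mkE (beta%:K *: (xY *m (Pi *m D - D *m Pi))
            + beta%:K *: (Y *m (Pi *m Dr - Dr *m Pi
                                + D *m Pi *m xP *m Pi - Pi *m xP *m Pi *m D))
            - (xY *m Y^H + Y *m xY^H) *m Ypart w)
           (alpha1%:K *: Dr))).
Proof.
move=> K E M B g h H PiH L cD cDr Kp.
split.
  split; [exact: quo_proj_psd|exact: quo_proj_surj|exact: quo_proj_fiber].
split.
  split.
  - by move=> S w eta MS; exact: metric_op_adj.
  - by move=> S MS; exact: metric_inner.
  - by move=> S w MS; exact: metric_form_trR.
  - exact: metric_riemannian.
  - move=> S U MS uU; split; first exact: Uact_total.
    move=> xi eta xT eT; split; first exact: tangent_Uact.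
    exact: metric_form_Uact.
split.
  exists (@quotient_metric R k n p alpha0 alpha1 beta); split.
    by move=> X BX; exact: quotient_metric_inner.
  by move=> S eta zeta MS He Hz; exact: quotient_metricE.
split.
  split.
  - by move=> S eta MS He; exact: (horizontal_projects MS He).
  - by move=> S v MS vT; exact: horizontal_lift_unique.
  - by move=> w; apply: (smooth_hproj halpha0 halpha1 hbeta (F := cst w)); exact: smooth_cst.
split.
  by move=> S eta MS eT; exact: horizontalP.
split.
  by move=> S Yp MS uQ; exact: Nop_range.
split.
  move=> S w MS; split.
    by split; [exact: hproj_hor|move=> u Hu; exact: hproj_orth].
  exact: hprojE.
split.
  move=> P pP; split; first exact: Lop_bij.
  by move=> U Lam uU PE A; exact: opinv_Lop_eig.
split.
  move=> nabla lc; split.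
  - exact: hconn_levi_civita.
  - by move=> xi eta X Z hx hz S MS; exact: (hconn_formula halpha0 halpha1 hbeta lc hx hz MS).
  - move=> f fS xi X sf [sfS _] hx S MS.
    exact: (rhess_formula halpha0 halpha1 hbeta lc sfS hx MS).
move=> S xi w MS xT; split; first exact: is_dirD_calD.
exact: is_dirD_hproj.
Qed.
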